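(* Let $v\ge 3$ be an odd integer and let $G=D_{4v}=\langle r,s\mid r^{2v}=s^2=(sr)^2=1\rangle$ be the dihedral group of order $4v$. Let $Q_1=\{1\}$, $Q_2=\langle sr^v\rangle$, $Q_3=\langle r^v\rangle$, $Q_4=\langle s\rangle$, $Q_5=\langle s,r^v\rangle$, which represent the conjugacy classes of $2$-subgroups of $G$. Label the columns of the first and third block columns of the trivial source character table $\mathrm{Triv}_2(D_{4v})=[T_{i,j}]_{1\le i,j\le5}$ by $1,r^2,r^4,\dots,r^{v-1}$ and the (single) columns of the second, fourth and fifth block columns by $1$. Label the rows by the ordinary characters $\chi_{\widehat M}$ of the trivial source modules $M$. Then, up to the order of rows within block rows, $\mathrm{Triv}_2(D_{4v})$ is given as follows. - Block row $1$ (vertex $Q_1$): the rows are labelled by $\chi_1+\chi_2+\chi_3+\chi_4$ and by $\chi_{4+m}+\chi_{4+(v-m)}$ for $1\le m\le\frac{v-1}{2}$. In $T_{1,1}$ all entries of the row $\chi_1+\chi_2+\chi_3+\chi_4$ are $4$, and the entry of the row $\chi_{4+m}+\chi_{4+(v-m)}$ in column $r^{2u}$ $(0\le u\le\frac{v-1}{2})$ is $2(\omega_m^{2u}+\overline{\omega}_m^{2u})$. Moreover $T_{1,j}=\mathbf 0$ for $j\ne1$. - Block row $2$ (vertex $Q_2$): one row, labelled $\chi_1+\chi_4$; all entries of $T_{2,1}$ are $2$, $T_{2,2}=[2]$, and $T_{2,j}=\mathbf 0$ for $j\in\{3,4,5\}$. - Block row $3$ (vertex $Q_3$): the rows are labelled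 by $\chi_1+\chi_3$ and by $\chi_{4+m}$ for $m\in\{2,4,\dots,v-1\}$. In both $T_{3,1}$ and $T_{3,3}$ all entries of the row $\chi_1+\chi_3$ are $2$, and the entry of the row $\chi_{4+m}$ in column $r^{2u}$ $(0\le u\le\frac{v-1}{2})$ is $\omega_m^{2u}+\overline{\omega}_m^{2u}$. Moreover $T_{3,j}=\mathbf 0$ for $j\in\{2,4,5\}$. - Block row $4$ (vertex $Q_4$): one row, labelled $\chi_1+\chi_2$; all entries of $T_{4,1}$ are $2$, $T_{4,4}=[2]$, and $T_{4,j}=\mathbf 0$ for $j\in\{2,3,5\}$. - Block row $5$ (vertex $Q_5$): one row, labelled $\chi_1$; all entries of $T_{5,j}$ are $1$ for $1\le j\le5$. In particular, $T_{3,3}=T_{3,1}$ and $T_{3,1}=\frac12\cdot T_{1,1}$ after a suitable permutation of the rows of $\mathrm{Triv}_2(D_{4v})$.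
   Context: Let $(K,\mathcal O,k)$ be a $2$-modular system with $k$ algebraically closed of characteristic $2$ and $K$ large enough for $G$ and its subgroups. Ordinary characters of $D_{4v}$: put $\omega_m:=\exp(-\frac{2\pi i m}{2v})$. The linear characters are $\chi_1=1_G$; $\chi_2$ with $\chi_2(r)=-1,\ \chi_2(s)=1$; $\chi_3$ with $\chi_3(r)=1,\ \chi_3(s)=-1$; $\chi_4$ with $\chi_4(r)=-1,\ \chi_4(s)=-1$. For $1\le m\le v-1$, $\chi_{4+m}$ is the degree $2$ irreducible character with $\chi_{4+m}(r^u)=\omega_m^u+\overline{\omega}_m^u$ and $\chi_{4+m}(sr^u)=0$ for all $u$. A trivial source $kG$-module is an indecomposable direct summand of $\mathrm{Ind}_Q^G(k)$ for some $2$-subgroup $Q\le G$; $\mathrm{TS}(G;Q)$ is the set of isomorphism classes of those with vertex $Q$. Each trivial source module $M$ has a unique (up to isomorphism) lift to a trivial source $\mathcal OG$-lattice $\widehat M$, and $\chi_{\widehat M}$ is the character of $K\otimes_{\mathcal O}\widehat M$. For a $p$-subgroup $Q\le G$, $M[Q]:=M^Q/\sum_{R<Q}\mathrm{tr}_R^Q(M^R)$ is the Brauer quotient, a $kN_G(Q)/Q$-module, with Brauer character $\varphi_{M[Q]}$. Trivial source character table: given representatives $Q_1,\dots,Q_n$ of the conjugacy classes of $p$-subgroups of $G$ (ordered by non-decreasing order) and $\overline N_j:=N_G(Q_j)/Q_j$, set $T_{i,j}:=\big(\varphi_{M[Q_j]}(s)\big)$ with rows indexed by $M\in\mathrm{TS}(G;Q_i)$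 and columns by representatives $s$ of the $p'$-conjugacy classes of $\overline N_j$, and $\mathrm{Triv}_p(G):=[T_{i,j}]_{1\le i,j\le n}$. Columns are labelled by $p'$-elements of $N_G(Q_j)$ representing the classes of $\overline N_j$. Here $N_G(Q_1)=N_G(Q_3)=G$, and $N_G(Q_j)=Q_5$ for $j\in\{2,4,5\}$. *)

(* Defs.v *)
From Stdlib Require Import ClassicalEpsilon.
From mathcomp Require Import all_boot all_order all_algebra all_fingroup.
From mathcomp Require Import all_solvable all_field all_character.

Set Implicit Arguments.
Unset Strict Implicit.
Unset Printing Implicit Defensive.

Import GRing.Theory.
Local Open Scope ring_scope.

(* inj is the inclusion of O in K, and red the reduction O -> k.  The field   *)
(* ms_dvr says that O is a discrete valuation ring with uniformizer pi,       *)
(* complete for the pi-adic topology.                                         *)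
Record modular_system (p : nat) (O : idomainType) (K k : fieldType)
    (inj : {rmorphism O -> K}) (red : {rmorphism O -> k}) : Prop :=
  ModularSystem {
    ms_inj : injective inj;
    ms_frac : forall x : K, exists a b : O, b != 0 /\ x = inj a / inj b;
    ms_surj : forall y : k, exists a : O, red a = y;
    ms_local : forall a : O, (red a == 0) = (a \isn't a GRing.unit);
    ms_dvr : exists pi : O,
      [/\ pi != 0, pi \isn't a GRing.unit,
          forall a : O, a != 0 ->
            exists (u : O) (n : nat), u \is a GRing.unit /\ a = u * pi ^+ n
        & forall f : nat -> O,
            (forall n, exists c, f n.+1 - f n = pi ^+ n * c) ->
            exists l, forall n, exists c, l - f n = pi ^+ n * c];
    ms_char0 : [pchar K] =i pred0;
    ms_charp : p \in [pchar k]
  }.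

Definition large_enough (K : fieldType) (gT : finGroupType) (G : {group gT}) :=
  forall H : {group gT}, H \subset G -> group_splitting_field K H.

Section Representations.

Variables (R : comUnitRingType) (gT : finGroupType) (G : {group gT}).

(* Modules are right modules of row vectors, as in mxrepresentation.          *)
Definition repr_iso m n (rU : mx_representation R G m)
    (rV : mx_representation R G n) :=
  exists (A : 'M[R]_(m, n)) (B : 'M[R]_(n, m)),
    [/\ A *m B = 1%:M, B *m A = 1%:M
      & {in G, forall x, rU x *m A = A *m rV x}].

Lemma dsum_mx_repr m n (rU : mx_representation R G m)
    (rV : mx_representation R G n) :
  mx_repr G (fun x => block_mx (rU x) 0 0 (rV x)).
Proof.
split=> [|x y Gx Gy]; first by rewrite !repr_mx1 -scalar_mx_block.
by rewrite mulmx_block !(mulmx0, mul0mx, addr0, add0r, repr_mxM).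
Qed.
Definition dsum_repr m n (rU : mx_representation R G m)
  (rV : mx_representation R G n) := MxRepresentation (dsum_mx_repr rU rV).

Definition direct_summand m n (rU : mx_representation R G m)
    (rV : mx_representation R G n) :=
  exists (l : nat) (rW : mx_representation R G l),
    repr_iso rV (dsum_repr rU rW).

Definition indecomposable n (rM : mx_representation R G n) :=
  (0 < n)%N /\
  forall l m (rU : mx_representation R G l) (rV : mx_representation R G m),
    repr_iso rM (dsum_repr rU rV) -> l = 0%N \/ m = 0%N.

Lemma triv_mx_repr : mx_repr G (fun _ : gT => 1%:M : 'M[R]_1).
Proof. by split=> // x y _ _; rewrite mulmx1. Qed.
Definition triv_repr := MxRepresentation triv_mx_repr.

(* With t_A the representative of the right coset A of H, the induced module  *)
(* is the direct sum of the M (x) t_A, and (m (x) t_A) g = m h (x) t_B where  *)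
(* B = A g and t_A g = h t_B.                                                 *)
Section Induction.

Variables (H : {group gT}) (n : nat) (rH : mx_representation R H n).
Hypothesis sHG : H \subset G.

Definition ind_mx (g : gT) : 'M[R]_(\sum_(i < #|rcosets H G|) n) :=
  \mxblock_(i < #|rcosets H G|, j < #|rcosets H G|)
    (let A := enum_val i in let B := enum_val j in
     if (A :* g == B)%g then rH (repr A * g * (repr B)^-1)%g else 0).

Lemma ind_mx_repr : mx_repr G ind_mx.
Proof.
have cosG (i : 'I_#|rcosets H G|) : {x | x \in G & enum_val i = (H :* x)%g}.
  have /rcosetsP/sig2_eqW[x Gx ->] := enum_valP i; by exists x.
have reprG (i : 'I_#|rcosets H G|) :
    (repr (enum_val i) \in G) * (enum_val i = H :* repr (enum_val i))%g.
  have [x Gx ->] := cosG i; rewrite rcoset_repr; split=> //.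
  have: repr (H :* x)%g \in (H :* x)%g by apply: mem_repr (rcoset_refl H x).
  by case/rcosetP=> h Hh ->; rewrite groupM // (subsetP sHG).
have inH (i j : 'I_#|rcosets H G|) g : ((enum_val i :* g)%g == enum_val j) ->
    (repr (enum_val i) * g * (repr (enum_val j))^-1)%g \in H.
  rewrite {1}(reprG i).2 {1}(reprG j).2 -rcosetM => /eqP/rcoset_eqP.
  by rewrite mem_rcoset.
split=> [|x y Gx Gy].
  rewrite /ind_mx -(@mxdiagZ _ _ (fun=> n)); apply: eq_mxblock => i j.
  rewrite rcoset1 (inj_eq enum_val_inj).
  case: eqVneq => [->|ne] //.
  by rewrite mulg1 mulgV repr_mx1 conform_mx_id.
rewrite /ind_mx mul_mxblock; apply: eq_mxblock => i j /=.
have [z Gz Ei] := cosG i.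
have cAx : (enum_val i :* x)%g \in rcosets H G.
  by rewrite Ei -rcosetM; apply/rcosetsP; exists (z * x)%g; rewrite ?groupM.
pose l := enum_rank_in cAx (enum_val i :* x)%g.
have El : enum_val l = (enum_val i :* x)%g by rewrite enum_rankK_in.
rewrite (bigD1 l) //= big1 ?addr0 => [|l' nl]; last first.
  case: eqP => [El'|]; last by rewrite mul0mx.
  by case/eqP: nl; apply: enum_val_inj; rewrite El.
rewrite El eqxx -rcosetM; case: eqP => [Ej|]; last by rewrite mulmx0.
rewrite -El -repr_mxM; last 2 first.
- by apply: inH; rewrite El.
- by apply: inH; rewrite El -rcosetM Ej.
by congr (rH _); rewrite !mulgA mulgKV.
Qed.
Definition ind_repr := MxRepresentation ind_mx_repr.

End Induction.

End Representations.

Definition trivial_source (R : comUnitRingType) (gT : finGroupType)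
    (G : {group gT}) (p n : nat) (rM : mx_representation R G n) :=
  indecomposable rM /\
  exists (Q : {group gT}) (sQG : Q \subset G),
    (p.-group Q)%g /\ direct_summand rM (ind_repr (triv_repr R Q) sQG).

Definition rel_projective (R : comUnitRingType) (gT : finGroupType)
    (G H : {group gT}) (sHG : H \subset G) n (rM : mx_representation R G n) :=
  direct_summand rM (ind_repr (subg_repr rM sHG) sHG).

Definition is_vertex (R : comUnitRingType) (gT : finGroupType)
    (G Q : {group gT}) n (rM : mx_representation R G n) :=
  (exists sQG : Q \subset G, rel_projective sQG rM) /\
  (forall (S : {group gT}) (sSG : S \subset G),
     S \proper Q -> ~ rel_projective sSG rM).

(* M lists TS(G;Q), one representative for each isomorphism class.            *)
Definition TS_reps (k : fieldType) (gT : finGroupType) (G : {group gT})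
    (p : nat) (Q : {group gT}) m (M : 'I_m -> representation k G) :=
  [/\ forall a, trivial_source p (M a) /\ is_vertex Q (M a),
      forall a b, repr_iso (M a) (M b) -> a = b
    & forall n (rM : mx_representation k G n),
        trivial_source p rM -> is_vertex Q rM -> exists a, repr_iso rM (M a)].

Section BrauerQuotient.

Variables (k : fieldType) (gT : finGroupType) (G Q : {group gT}).
Hypothesis sQG : Q \subset G.
Variables (n : nat) (rM : mx_representation k G n).

Definition rel_trace_mx (S : {group gT}) : 'M[k]_n :=
  \sum_(A in rcosets S Q) rM (repr A).

Definition trace_sum_mx : 'M[k]_n :=
  (\sum_(S : {group gT} | S \proper Q) rfix_mx rM S *m rel_trace_mx S)%MS.

Definition norm_repr := subg_repr rM (subsetIl G 'N(Q)%g).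

Lemma fix_module : mxmodule norm_repr (rfix_mx rM Q).
Proof.
apply/mxmoduleP=> x Nx.
have := subsetP (norm_sub_rstabs_rfix_mx rM sQG) x Nx.
by rewrite inE => /andP[].
Qed.

Lemma trace_module : mxmodule norm_repr trace_sum_mx.
Proof.
apply/mxmoduleP=> x Nx; rewrite sumsmxMr; apply/sumsmx_subP=> S pSQ.
have /setIP[Gx nQx] := Nx; have sSQ := proper_sub pSQ.
have sSG := subset_trans sSQ sQG.
have Qx : (Q :^ x)%g = Q by apply: normP.
have pSx : (S :^ x)%G \proper Q by rewrite /= -(properJ S Q x) Qx in pSQ.
apply: submx_trans (sumsmx_sup (S :^ x)%G pSx (submx_refl _)).
suff -> : rfix_mx rM S *m rel_trace_mx S *m norm_repr x
    = rfix_mx rM S *m rM x *m rel_trace_mx (S :^ x)%G.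
  by rewrite submxMr //= rfix_mx_conjsg.
rewrite /rel_trace_mx !mulmx_sumr mulmx_suml /=.
rewrite [RHS](reindex_onto (fun A : {set gT} => (A :^ x)%g)
                           (fun A : {set gT} => (A :^ x^-1)%g)) /=; last first.
  by move=> A _; rewrite conjsgKV.
have Sx A : (A :^ x \in rcosets (S :^ x) Q)%g = (A \in rcosets S Q).
  apply/rcosetsP/rcosetsP=> [[y Qy eA]|[y Qy ->]].
    exists (y ^ x^-1)%g; first by rewrite memJ_norm // groupV.
    by apply: (act_inj 'Js x); rewrite /= eA conjsMg conjg_set1 conjgKV.
  by exists (y ^ x)%g; rewrite ?memJ_norm // conjsMg conjg_set1.
apply: eq_big => [A|A]; first by rewrite conjsgK eqxx andbT Sx.
case/rcosetsP=> y Qy ->.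
have Gy := subsetP sQG y Qy.
have [h Sh ->] : exists2 h, h \in S & repr (S :* y)%g = (h * y)%g.
  have: repr (S :* y)%g \in (S :* y)%g by apply: mem_repr (rcoset_refl S y).
  by case/rcosetP=> h Sh ->; exists h.
have [h' Sh' ->] : exists2 h', h' \in S &
   repr ((S :* y) :^ x)%g = (h' ^ x * y ^ x)%g.
  rewrite conjsMg conjg_set1.
  have: repr ((S :^ x) :* y ^ x)%g \in ((S :^ x)%G :* y ^ x)%g.
    by apply: mem_repr (rcoset_refl (S :^ x)%G _).
  by case/rcosetP=> z /imsetP[h' Sh' ->] ->; exists h'.
have [Gh Gh'] := (subsetP sSG h Sh, subsetP sSG h' Sh').
rewrite -conjMg -!mulmxA.
have Ghy' : ((h' * y) ^ x)%g \in G by rewrite groupJ ?groupM.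
rewrite -(repr_mxM rM Gx Ghy') -conjgC !(repr_mxM rM) ?groupM //.
by rewrite !mulmxA (rfix_mx_id rM Sh) (rfix_mx_id rM Sh').
Qed.

Lemma brauer_ker : Q \subset rker (section_repr trace_module fix_module).
Proof.
apply/subsetP=> x Qx; have Gx := subsetP sQG x Qx.
have Nx : x \in 'N_G(Q)%g by rewrite inE Gx (subsetP (normG Q)).
rewrite rker_submod (eqmx_rstab _ (genmxE _)).
apply: (subsetP (rstab_factmod _ _)).
by rewrite inE Nx; apply/eqP/(rfix_mx_id rM Qx).
Qed.

Definition brauer_quotient :=
  quo_repr brauer_ker (subsetIr G 'N(Q)%g).

End BrauerQuotient.

Section Table.

Variables (O : idomainType) (K : fieldType) (k : closedFieldType).
Variables (inj : {rmorphism O -> K}) (red : {rmorphism O -> k}).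
Variable gT : finGroupType.

(* For m prime to the characteristic of k, the unique m-th root of unity of O *)
(* with reduction l.                                                          *)
Definition root_lift (m : nat) (l : k) : O :=
  epsilon (inhabits 0) (fun a : O => a ^+ m = 1 /\ red a = l).

(* Meaningful at p'-elements only.  The sum is over the eigenvalues of rM x   *)
(* with multiplicity.                                                         *)
Definition brauer_char (G : {group gT}) n (rM : mx_representation k G n)
    (x : gT) : K :=
  \sum_(l <- sval (closed_field_poly_normal (char_poly (rM x))))
     inj (root_lift #[x]%g l).

End Table.

Definition ts_block (O : idomainType) (K : fieldType) (k : closedFieldType)
    (inj : {rmorphism O -> K}) (red : {rmorphism O -> k})
    (gT : finGroupType) (G : {group gT}) m n (M : 'I_m -> representation k G)
    (Q : {group gT}) (sQG : Q \subset G) (c : 'I_n -> gT) : 'M[K]_(m, n) :=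
  \matrix_(a < m, b < n)
     brauer_char inj red (brauer_quotient sQG (M a)) (coset Q (c b)).

(* The character of the trivial source lift of M to O is chi on G.            *)
Definition lift_character (p : nat) (O : idomainType) (K k : fieldType)
    (inj : {rmorphism O -> K}) (red : {rmorphism O -> k})
    (gT : finGroupType) (G : {group gT}) (M : representation k G)
    (chi : gT -> K) :=
  let lifts n (L : mx_representation O G n) :=
    trivial_source p L /\ repr_iso (map_repr red L) M in
  (exists n (L : mx_representation O G n), lifts n L) /\
  forall n (L : mx_representation O G n), lifts n L ->
    {in G, forall x, \tr (map_repr inj L x) = chi x}.

Definition p_subgroup_reps (p : nat) (gT : finGroupType) (G : {group gT})
    (Qs : seq {group gT}) :=
  [/\ all (fun Q : {group gT} => (Q \subset G) && (p.-group Q)%g) Qs,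
      uniq (map (fun Q : {group gT} => Q :^: G)%g Qs),
      forall P : {group gT}, P \subset G -> (p.-group P)%g ->
        exists2 Q, Q \in Qs & gval P \in (Q :^: G)%g
    & sorted leq (map (fun Q : {group gT} => #|Q|) Qs)].

Definition pprime_class_reps (p : nat) (gT : finGroupType) (G : {group gT}) n
    (c : 'I_n -> gT) :=
  [/\ forall b, c b \in G /\ (p^'.-elt (c b))%g,
      injective (fun b => c b ^: G)%g
    & forall x, x \in G -> (p^'.-elt x)%g -> exists b, x \in (c b ^: G)%g].

(* The columns are labelled by p'-elements of 'N_G(Q) whose images represent  *)
(* the p'-classes of 'N_G(Q) / Q.                                             *)
Definition column_labels (p : nat) (gT : finGroupType) (G Q : {group gT}) n
    (c : 'I_n -> gT) :=
  (forall b, c b \in 'N_G(Q)%g /\ (p^'.-elt (c b))%g) /\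
  pprime_class_reps p ('N_G(Q) / Q)%G (fun b => coset Q (c b)).

Section Dihedral.

Variables (v : nat) (gT : finGroupType) (G : {group gT}) (r s : gT).

(* G is presented by r and s: since G is isomorphic to the presented group,   *)
(* which is finite, mapping its generators to r and s is an isomorphism.      *)
Definition dihedral_presented :=
  [/\ G = <<[set r; s]>>%G,
      [/\ (r ^+ (2 * v))%g = 1%g, (s ^+ 2)%g = 1%g & ((s * r) ^+ 2)%g = 1%g]
    & (G \isog Grp (x : y : x ^+ (2 * v), y ^+ 2, (y * x) ^+ 2))%g].

Definition dihedral_Q (i : nat) : {group gT} :=
  match i with
  | 1 => 1%G
  | 2 => <[s * r ^+ v]>%G
  | 3 => <[r ^+ v]>%G
  | 4 => <[s]>%G
  | _ => <<[set s; (r ^+ v)%g]>>%G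
  end.

Lemma dihedral_Q_sub (hG : dihedral_presented) (i : nat) :
  dihedral_Q i \subset G.
Proof.
case: hG => -> _ _.
have Gr : r \in <<[set r; s]>>%G by apply: mem_gen; rewrite !inE eqxx.
have Gs : s \in <<[set r; s]>>%G by apply: mem_gen; rewrite !inE eqxx orbT.
case: i => [|[|[|[|[|i]]]]]; rewrite /dihedral_Q ?sub1G ?cycle_subG ?gen_subG //.
- by rewrite subUset !sub1set Gs groupX.
- by rewrite groupM // groupX.
- by rewrite groupX.
- by rewrite subUset !sub1set Gs groupX.
Qed.

(* The number of rows and of columns in the i-th blocks; v./2 is (v - 1) / 2. *)
Definition dihedral_size (i : nat) : nat :=
  match i with 1 | 3 => (v./2).+1 | _ => 1%N end.

Definition dihedral_col (j : nat) (b : 'I_(dihedral_size j)) : gT :=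
  (r ^+ (2 * b))%g.

Variables (K : fieldType) (w : K).

(* w stands for exp (- 2 pi i / 2 v), so that w ^- m is the conjugate of      *)
(* w ^+ m; chi_1, ..., chi_4 are homomorphisms.                               *)
Definition dihedral_characters (chi : nat -> gT -> K) :=
  [/\ forall i, (1 <= i <= 4)%N ->
        {in G &, {morph chi i : x y / (x * y)%g >-> x * y}},
      [/\ chi 1%N r = 1 /\ chi 1%N s = 1, chi 2%N r = -1 /\ chi 2%N s = 1,
          chi 3%N r = 1 /\ chi 3%N s = -1 & chi 4%N r = -1 /\ chi 4%N s = -1]
    & forall m, (1 <= m <= v.-1)%N -> forall u : nat,
        chi (4 + m)%N (r ^+ u)%g = (w ^+ m) ^+ u + (w ^- m) ^+ u /\
        chi (4 + m)%N (s * r ^+ u)%g = 0].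

End Dihedral.

(* Main.v *)
(* Let Q_i be a 2-subgroup in the list and H_i = Q_i <r^2>. For a linear character
   of H_i trivial on Q_i and of odd order, the induced OG-lattice is a direct
   summand of Ind_{Q_i}^G O, because the index of Q_i in H_i is odd, and its
   character is a row label. Its reduction mod 2 is indecomposable, since it has a
   simple socle, and has vertex Q_i: by Higman's criterion, relative projectivity
   amounts to the identity being a relative trace.

   Conversely let M be a trivial source module. If r^2 acts trivially, then M, a
   summand of Ind_P^G k, is a summand of Ind_{H_i}^G k where P <r^2> = H_i, hence
   equal to it. Otherwise r^2 has an eigenvector in M with eigenvalue different
   from 1, and one of the modules above splits off M.

   Lifts are unique up to isomorphism because fixed points of permutation modules
   lift along O -> k, hence so do homomorphisms between trivial source modules.
   When Q_j <= Q_i the subgroup Q_j acts trivially on M, hence M[Q_j] = M and the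
   entries are the values of the label at 2'-elements. Otherwise H_i lies in a
   subgroup of index 2 not containing Q_j, so that every Q_j-fixed vector of M is a
   trace from a proper subgroup of Q_j, and M[Q_j] = 0. *)

Require Import Defs.
From mathcomp Require Import all_boot all_order all_algebra all_fingroup.
From mathcomp Require Import all_solvable all_field all_character.
From mathcomp Require Import zify ring.

Set Implicit Arguments.
Unset Strict Implicit.
Unset Printing Implicit Defensive.

Import GRing.Theory.
Local Open Scope ring_scope.

(** A candidate module is recognised by its socle. It is generated by the translates of one row [e],
    is separated by the translates of one column [d], and contains a vector [x0] lying in every
    nonzero submodule; an endomorphism that does not kill [x0] is therefore bijective. Hence a
    candidate splits off M as soon as M has a suitable eigenvector u and a dual column w with
    nonzero pairing.

    When r^2 acts nontrivially, Q_1 and Q_3 compete for the same eigenvalue mu^2 of r^2. On that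
    eigenspace (r - mu)^2 = r^2 - mu^2 = 0 in characteristic 2. Either r is the scalar mu there, and
    the module with vertex Q_3 splits off, or some u has u r different from mu u, and the projective
    one does.

    Summands are handled as pairs of maps with A B = 1, which need no complement; complements enter
    only to return to the definitions, and over O they are lifted from k.

    The root of unity w comes from some o in O with o^v = -1, while [red o] has order v because -1 =
    1 in k. The labels for Q_3 use the exponents 2a, those for Q_1 the exponents a; doubling modulo
    v and up to sign is the row permutation relating the two blocks. *)

(** * Sums over right cosets *)

Section CosetSums.

Variables (gT : finGroupType) (V : nmodType).
Implicit Types (G H K S Q : {group gT}) (F : gT -> V).

Definition coset_invariant G H F :=
  {in H & G, forall h x, F (h * x)%g = F x}.

Lemma coset_invariantS G H K F :
  K \subset H -> coset_invariant G H F -> coset_invariant G K F.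
Proof. by move=> sKH FH h x Kh; apply: FH; apply: (subsetP sKH). Qed.

Lemma mem_repr_rcosets G H A : H \subset G -> A \in rcosets H G ->
  repr A \in G /\ A = (H :* repr A)%g.
Proof.
move=> sHG /rcosetsP[x Gx ->]; rewrite rcoset_repr; split=> //.
case: repr_rcosetP => h Hh.
by rewrite groupM // (subsetP sHG).
Qed.

Lemma coset_invariant_repr G H F x : coset_invariant G H F -> x \in G ->
  F (repr (H :* x)%g) = F x.
Proof. by move=> FH Gx; case: repr_rcosetP => h Hh; apply: FH. Qed.

Lemma sum_rcosetsM G H F g : H \subset G -> coset_invariant G H F ->
    g \in G ->
  \sum_(A in rcosets H G) F (repr A * g)%g = \sum_(A in rcosets H G) F (repr A).
Proof.
move=> sHG FH Gg.
have mG (x : gT) A : x \in G -> A \in rcosets H G -> (A :* x)%g \in rcosets H G.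
  move=> Gx /rcosetsP[y Gy ->]; rewrite -rcosetM.
  by apply/rcosetsP; exists (y * x)%g; rewrite ?groupM.
rewrite [RHS](reindex_onto (fun A => A :* g)%g (fun A => A :* g^-1)%g) /=.
  apply: eq_big => [A|A HA].
    rewrite -rcosetM mulgV rcoset1 eqxx andbT.
    apply/idP/idP=> [/mG->//|/(mG g^-1%g)]; rewrite groupV => /(_ Gg).
    by rewrite -rcosetM mulgV rcoset1.
  have [GA {2}->] := mem_repr_rcosets sHG HA.
  by rewrite -rcosetM (coset_invariant_repr FH) // groupM.
by move=> A _; rewrite -rcosetM mulVg rcoset1.
Qed.

(** Every coset of H in G lies in one coset B of K, and right translation by [(repr B)^-1] turns
    those inside B into the cosets of H in K. This becomes transitivity of the relative trace. *)
Lemma sum_rcosets_trans G H K F :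
    H \subset K -> K \subset G -> coset_invariant G H F ->
  \sum_(A in rcosets H G) F (repr A)
    = \sum_(B in rcosets K G) \sum_(A in rcosets H K) F (repr A * repr B)%g.
Proof.
move=> sHK sKG FH; have sHG := subset_trans sHK sKG.
rewrite (partition_big (fun A : {set gT} => K :* repr A)%g
                       [in rcosets K G]) /=; last first.
  move=> A HA; have [GA _] := mem_repr_rcosets sHG HA.
  by apply/rcosetsP; exists (repr A).
apply: eq_bigr => B KB; have [GB eB] := mem_repr_rcosets sKG KB.
rewrite [LHS](reindex_onto (fun A : {set gT} => A :* repr B)%g
                     (fun A : {set gT} => A :* (repr B)^-1)%g) /=; last first.
  by move=> A _; rewrite -rcosetM mulVg rcoset1.
have KHx x : (K :* repr (H :* x) = K :* x)%g.
  case: repr_rcosetP => h Hh.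
  by rewrite rcosetM rcoset_id // (subsetP sHK).
apply: eq_big => [A|A].
  rewrite -rcosetM mulgV rcoset1 eqxx andbT.
  apply/andP/rcosetsP=> [[/rcosetsP[x Gx eA]]|[x Kx ->]].
    rewrite eA KHx => /eqP eKx.
    have: x \in (K :* repr B)%g by apply/rcoset_eqP; rewrite -eB.
    rewrite mem_rcoset => Kx.
    exists (x * (repr B)^-1)%g => //.
    by rewrite rcosetM -eA -rcosetM mulgV rcoset1.
  rewrite -rcosetM KHx (rcosetM K) (rcoset_id Kx) -eB; split=> //.
  apply/rcosetsP; exists (x * repr B)%g => //.
  by rewrite groupM // (subsetP sKG).
case/andP=> /andP[HA _] _.
have [x Gx eA] : exists2 x, x \in G & A = (H :* x)%g.
  case/rcosetsP: HA => y Gy eA; exists (y * (repr B)^-1)%g.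
    by rewrite groupM ?groupV.
  by rewrite rcosetM -eA -rcosetM mulgV rcoset1.
rewrite eA -rcosetM (coset_invariant_repr FH) ?groupM //.
by case: (repr_rcosetP H x) => h Hh; rewrite -mulgA [RHS]FH ?groupM.
Qed.

Lemma sum_rcosets_index G H K F :
    H \subset K -> K \subset G -> coset_invariant G K F ->
  \sum_(A in rcosets H G) F (repr A)
    = (\sum_(B in rcosets K G) F (repr B)) *+ #|K : H|%g.
Proof.
move=> sHK sKG FK; rewrite (sum_rcosets_trans sHK sKG (coset_invariantS sHK FK)).
rewrite -sumrMnl; apply: eq_bigr => B /(mem_repr_rcosets sKG)[GB _].
rewrite -sumr_const; apply: eq_bigr => A /(mem_repr_rcosets sHK)[KA _].
exact: FK.
Qed.

(** Q permutes the cosets of S by right translation and F is constant on the orbits, whose sizes are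
    powers of p. An orbit of size 1 would be a coset S x fixed by Q, which puts a conjugate of Q
    inside S; so every orbit contributes a multiple of p. *)
Lemma sum_rcosets_pgroup_eq0 p G S Q F : prime p -> (forall x : V, x *+ p = 0) ->
    S \subset G -> Q \subset G -> (p.-group Q)%g -> coset_invariant G S F ->
    {in G & Q, forall x q, F (x * q)%g = F x} ->
    {in G, forall x, ~~ (Q :^ x \subset S)%g} ->
  \sum_(A in rcosets S G) F (repr A) = 0.
Proof.
move=> p_pr Vp sSG sQG pQ FS FQ nQS.
have actsQ : [acts Q, on rcosets S G | 'Rs]%g.
  apply/subsetP=> q Qq; rewrite !inE /=; apply/subsetP=> _ /rcosetsP[x Gx ->].
  rewrite inE /= rcosetE -rcosetM; apply/rcosetsP; exists (x * q)%g => //.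
  by rewrite groupM // (subsetP sQG).
rewrite (set_partition_big _ (orbit_partition actsQ)) /=.
apply: big1 => _ /imsetP[_ /rcosetsP[x Gx ->] ->].
rewrite (eq_bigr (fun => F x)) => [|_ /imsetP[q Qq ->]] /=; last first.
  rewrite rcosetE -rcosetM (coset_invariant_repr FS) ?FQ //.
  by rewrite groupM // (subsetP sQG).
rewrite sumr_const.
have [] := p_natP (pnat_dvd (dvdn_indexg Q 'C_Q[(S :* x)%g | 'Rs]%g) pQ).
rewrite -card_orbit => -[|n] oQ; last by rewrite oQ expnS mulrnA Vp mul0rn.
case/negP: (nQS _ (groupVr Gx)).
have /orbit1P/afixP fixQ := card_orbit1 oQ.
apply/subsetP=> _ /imsetP[q Qq ->]; rewrite conjgE invgK.
have: (x * q)%g \in (S :* x)%g by rewrite -(fixQ q Qq) /= rcosetE -rcosetM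
  rcoset_refl.
by rewrite mem_rcoset mulgA.
Qed.

End CosetSums.

(** * Relative traces and a matrix interface to induced modules *)

Section RelativeTrace.

Variables (R : comUnitRingType) (gT : finGroupType) (G : {group gT}).
Implicit Types H K : {group gT}.

Definition intertwines H l m (rU : mx_representation R G l)
    (rV : mx_representation R G m) (A : 'M[R]_(l, m)) :=
  {in H, forall x, rU x *m A = A *m rV x}.

Definition conj_mx l m (rU : mx_representation R G l)
    (rV : mx_representation R G m) (A : 'M[R]_(l, m)) x :=
  rU x^-1%g *m A *m rV x.

(** The relative trace from H to G on homomorphisms from U to V. It is independent of the coset
    representatives once [A] intertwines H. *)
Definition rtrace H l m (rU : mx_representation R G l)
    (rV : mx_representation R G m) (A : 'M[R]_(l, m)) :=
  \sum_(B in rcosets H G) conj_mx rU rV A (repr B).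

Section Two.

Variables (l m : nat) (rU : mx_representation R G l).
Variable rV : mx_representation R G m.

Lemma conj_mxM A x y : x \in G -> y \in G ->
  conj_mx rU rV A (x * y)%g = conj_mx rU rV (conj_mx rU rV A x) y.
Proof.
move=> Gx Gy; rewrite /conj_mx invMg !repr_mxM ?groupV //.
by rewrite !mulmxA.
Qed.

Lemma conj_mx_id H A h : H \subset G -> intertwines H rU rV A -> h \in H ->
  conj_mx rU rV A h = A.
Proof.
move=> sHG hA Hh; have Gh := subsetP sHG h Hh.
by rewrite /conj_mx -mulmxA -hA // mulmxA -repr_mxM ?groupV // mulVg repr_mx1 mul1mx.
Qed.

Lemma conj_mx_intertwines A x :
  x \in G -> conj_mx rU rV A x = A -> rU x *m A = A *m rV x.
Proof.
move=> Gx {1}<-; rewrite /conj_mx !mulmxA.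
by rewrite -repr_mxM ?groupV // mulgV repr_mx1 mul1mx.
Qed.

Lemma conj_mx_coset H A : H \subset G -> intertwines H rU rV A ->
  coset_invariant G H (conj_mx rU rV A).
Proof.
move=> sHG hA h x Hh Gx; have Gh := subsetP sHG h Hh.
by rewrite conj_mxM // (conj_mx_id sHG hA).
Qed.

Lemma rtrace_intertwines H A : H \subset G -> intertwines H rU rV A ->
  intertwines G rU rV (rtrace H rU rV A).
Proof.
move=> sHG hA g Gg; apply: conj_mx_intertwines => //.
rewrite {1}/conj_mx mulmx_sumr mulmx_suml.
rewrite -[RHS](sum_rcosetsM sHG (conj_mx_coset sHG hA) Gg).
apply: eq_bigr => B HB; have [GB _] := mem_repr_rcosets sHG HB.
by rewrite conj_mxM.
Qed.

Lemma rtraceZ H a A : rtrace H rU rV (a *: A) = a *: rtrace H rU rV A.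
Proof.
rewrite scaler_sumr; apply: eq_bigr => C _ /=.
by rewrite /conj_mx -scalemxAr -scalemxAl.
Qed.

Lemma rtrace_index H K A : H \subset K -> K \subset G ->
    intertwines K rU rV A ->
  rtrace H rU rV A = #|K : H|%g%:R *: rtrace K rU rV A.
Proof.
move=> sHK sKG hA.
by rewrite scaler_nat -(sum_rcosets_index sHK sKG (conj_mx_coset sKG hA)).
Qed.

End Two.

Lemma rtrace_mull k l m (rU : mx_representation R G k)
    (rV : mx_representation R G l) (rW : mx_representation R G m) H A B :
    H \subset G -> intertwines G rU rV A ->
  A *m rtrace H rV rW B = rtrace H rU rW (A *m B).
Proof.
move=> sHG hA; rewrite /rtrace mulmx_sumr; apply: eq_bigr => C HC.
have [GC _] := mem_repr_rcosets sHG HC.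
by rewrite /conj_mx !mulmxA hA ?groupV.
Qed.

Lemma rtrace_mulr k l m (rU : mx_representation R G k)
    (rV : mx_representation R G l) (rW : mx_representation R G m) H A B :
    H \subset G -> intertwines G rV rW B ->
  rtrace H rU rV A *m B = rtrace H rU rW (A *m B).
Proof.
move=> sHG hB; rewrite /rtrace mulmx_suml; apply: eq_bigr => C HC.
have [GC _] := mem_repr_rcosets sHG HC.
by rewrite /conj_mx -!mulmxA hB.
Qed.

(* rN is induced from rH in matrix form: E and D are the inclusion and the
   projection of the summand attached to the coset H itself. *)
Record induced_via H m (rH : mx_representation R H m) n
    (rN : mx_representation R G n) (E : 'M[R]_(m, n)) (D : 'M[R]_(n, m)) :
    Prop := InducedVia {
  induced_l : {in H, forall h, E *m rN h = rH h *m E};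
  induced_r : {in H, forall h, rN h *m D = D *m rH h};
  induced_1 : E *m D = 1%:M;
  induced_0 : {in G, forall g, g \notin H -> E *m rN g *m D = 0};
  induced_sum : rtrace H rN rN (D *m E) = 1%:M
}.

Lemma ind_repr_via H m (rH : mx_representation R H m) (sHG : H \subset G) :
  exists E D, induced_via rH (ind_repr rH sHG) E D.
Proof.
have HH : (H : {set gT}) \in rcosets H G by rewrite -[in X in X \in _](rcoset1 H)
  mem_rcosets mulSGid.
pose i0 := enum_rank_in HH (H : {set gT}).
have ei0 : enum_val i0 = H by rewrite enum_rankK_in.
(* The representative of the coset H is 1, so the block at [i0] carries [rH] itself and not a
   conjugate of it. *)
have reprH : repr H = 1%g by rewrite /repr group1.
have ei i : (enum_val i == H :> {set gT}) = (i == i0).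
  by rewrite -[X in _ == X]ei0 (inj_eq enum_val_inj).
pose B (g : gT) (i j : 'I_#|rcosets H G|) : 'M[R]_m :=
  let A := enum_val i in let B := enum_val j in
     if (A :* g == B)%g then rH (repr A * g * (repr B)^-1)%g else 0.
pose E : 'M[R]_(m, \sum_(i < #|rcosets H G|) m) :=
  \mxrow_(j < #|rcosets H G|) (if j == i0 then 1%:M else 0 : 'M[R]_(m, m)).
pose D : 'M[R]_(\sum_(i < #|rcosets H G|) m, m) :=
  \mxcol_(i < #|rcosets H G|) (if i == i0 then 1%:M else 0 : 'M[R]_(m, m)).
have EB g : E *m ind_mx G rH g = \mxrow_j B g i0 j.
  rewrite /E mul_mxrow_mxblock; apply: eq_mxrow => j.
  rewrite (bigD1 i0) //= eqxx mul1mx big1 ?addr0 // => i /negPf->.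
  by rewrite mul0mx.
have BD g : ind_mx G rH g *m D = \mxcol_i B g i i0.
  rewrite /D mul_mxblock_mxrow; apply: eq_mxcol => i.
  rewrite (bigD1 i0) //= eqxx mulmx1 big1 ?addr0 // => j /negPf->.
  by rewrite mulmx0.
have EBD g : E *m ind_mx G rH g *m D = B g i0 i0.
  rewrite EB mul_mxrow_mxcol (bigD1 i0) //= eqxx mulmx1 big1 ?addr0 // => j /negPf->.
  by rewrite mulmx0.
have ind1 : ind_mx G rH 1 = 1%:M := repr_mx1 (ind_repr rH sHG).
exists E, D; split=> /=.
- move=> h Hh; rewrite EB mul_mxrow; apply: eq_mxrow => j.
  rewrite /B /= ei0 reprH mul1g rcoset_id // eq_sym ei.
  by case: eqVneq => [->|]; rewrite ?ei0 ?reprH ?invg1 ?mulg1 ?mulmx1 ?mulmx0.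
- move=> h Hh; rewrite BD mxcol_mul; apply: eq_mxcol => i.
  rewrite /B /= ei0 reprH invg1 mulg1.
  have -> : ((enum_val i :* h)%g == H) = (i == i0).
    rewrite -ei; apply/eqP/eqP=> [eiH|->]; last by rewrite rcoset_id.
    by rewrite -(rcoset1 (enum_val i)) -(mulgV h) rcosetM eiH rcoset_id ?groupV.
  by case: eqVneq => [->|]; rewrite ?ei0 ?reprH ?mul1g ?mul1mx ?mul0mx.
- have := EBD 1%g; rewrite ind1 mulmx1 => ->.
  by rewrite /B ei0 rcoset1 eqxx reprH mulg1 invg1 mulg1 repr_mx1.
- move=> g Gg nHg; rewrite EBD /B ei0; case: eqP => // eHg.
  by case/negP: nHg; rewrite -eHg rcoset_refl.
rewrite /rtrace [LHS]big_enum_val /= -ind1 [RHS]/ind_mx.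
(* The conjugate of [D *m E] by the representative of the i-th coset is the projection onto the i-th
   block: by [B1] and [B2] below its factors are the i-th unit block column and block row. *)
have eT (i : 'I_#|rcosets H G|) : conj_mx (ind_repr rH sHG) (ind_repr rH sHG)
  (D *m E) (repr (enum_val i))
    = \mxblock_(a, b) (B (repr (enum_val i))^-1%g a i0 *m B (repr (enum_val i)) i0 b).
  by rewrite /conj_mx !mulmxA /= BD -mulmxA EB mul_mxcol_mxrow.
rewrite [LHS](eq_bigr _ (fun i _ => eT i)) -[LHS]mxblock_sum;
  apply: eq_mxblock => i j.
have GA (l : 'I_#|rcosets H G|) : repr (enum_val l) \in G /\ enum_val l =
  (H :* repr (enum_val l))%g.
  by apply: mem_repr_rcosets => //; apply: enum_valP.
rewrite rcoset1 (inj_eq enum_val_inj) mulg1.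
have B1 (l j' : 'I_#|rcosets H G|) : B (repr (enum_val l)) i0 j' =
  if l == j' then 1%:M else 0.
  rewrite /B ei0 -(GA l).2 (inj_eq enum_val_inj) reprH mul1g.
  by case: eqVneq => // ->; rewrite mulgV repr_mx1.
have B2 (l j' : 'I_#|rcosets H G|) : B (repr (enum_val l))^-1%g j' i0 =
  if j' == l then 1%:M else 0.
  rewrite /B ei0 reprH invg1 mulg1.
  have -> : ((enum_val j' :* (repr (enum_val l))^-1)%g == H) = (j' == l).
    rewrite -(inj_eq enum_val_inj) [X in _ = (_ == X)](GA l).2.
    apply/eqP/eqP=> [ejl|->].
      by rewrite -[X in _ = (X :* _)%g]ejl -rcosetM mulVg rcoset1.
    by rewrite -rcosetM mulgV rcoset1.
  by case: eqVneq => // ->; rewrite mulgV repr_mx1.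
rewrite (bigD1 i) //= B1 B2 eqxx mul1mx big1 ?addr0 => [|l nli].
  by case: eqVneq => // ->; rewrite mulgV repr_mx1.
by rewrite B2 eq_sym (negPf nli) mul0mx.
Qed.

End RelativeTrace.

(** * Retracts, Frobenius reciprocity and Higman's criterion *)

Section Retracts.

Variables (R : comUnitRingType) (gT : finGroupType) (G : {group gT}).
Implicit Types H K : {group gT}.

(** The summand relation without a complement. It agrees with [direct_summand] over a local ring,
    see [retract_direct_summand]. *)
Definition retract m n (rM : mx_representation R G m)
    (rN : mx_representation R G n) :=
  exists A B, [/\ intertwines G rM rN A, intertwines G rN rM B & A *m B = 1%:M].

Lemma direct_summand_retract m n (rM : mx_representation R G m)
    (rN : mx_representation R G n) : direct_summand rM rN -> retract rM rN.
Proof.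
case=> l [rW [X [Y [XY YX hX]]]].
have hY : {in G, forall x, dsum_repr rM rW x *m Y = Y *m rN x}.
  move=> x Gx; rewrite -[LHS]mul1mx -YX -mulmxA (mulmxA X) -hX //.
  by rewrite -(mulmxA _ X) XY mulmx1.
exists (usubmx Y), (lsubmx X); split.
- move=> x Gx; have := hY x Gx; rewrite -{1}[Y]vsubmxK /= mul_block_col.
  rewrite !mul0mx addr0 add0r -[in RHS](vsubmxK Y) mul_col_mx => /eq_col_mx.
  by case.
- move=> x Gx; have := hX x Gx; rewrite -{1 2}[X]hsubmxK /= mul_row_block.
  by rewrite !mulmx0 addr0 add0r mul_mx_row => /eq_row_mx[].
move: YX; rewrite -{1}[Y]vsubmxK -{1}[X]hsubmxK mul_col_row.
by rewrite (scalar_mx_block m l) => /eq_block_mx[].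
Qed.

Section Via.

Variables (H : {group gT}) (sHG : H \subset G).
Variables (m : nat) (rH : mx_representation R H m).
Variables (n : nat) (rN : mx_representation R G n).
Variables (E : 'M[R]_(m, n)) (D : 'M[R]_(n, m)).
Hypothesis iN : induced_via rH rN E D.

Section Frobenius.

Variables (l : nat) (rM : mx_representation R G l).

Lemma coset1_rcosets : (H : {set gT}) \in rcosets H G.
Proof. by apply/rcosetsP; exists 1%g; rewrite ?rcoset1. Qed.

Lemma repr_group K : repr K = 1%g.
Proof. by rewrite /repr group1. Qed.

Lemma repr_notin A : A \in rcosets H G -> A != H -> repr A \notin H.
Proof.
move=> HA; apply: contra => HrA; have [_ ->] := mem_repr_rcosets sHG HA.
by rewrite rcoset_id.
Qed.

(** Frobenius reciprocity: after multiplication by [E] only the term of the coset H survives, the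
    others being killed by [induced_0]. *)
Lemma induced_trace_l (U : 'M_(m, l)) : E *m rtrace H rN rM (D *m U) = U.
Proof.
rewrite /rtrace mulmx_sumr (bigD1 _ coset1_rcosets) /= big1 => [|A].
  rewrite addr0 /conj_mx repr_group invg1 !repr_mx1 mul1mx mulmx1.
  by rewrite mulmxA (induced_1 iN) mul1mx.
case/andP=> HA neA; rewrite /conj_mx !mulmxA (induced_0 iN) ?mul0mx //.
  by rewrite groupV; case: (mem_repr_rcosets sHG HA).
by rewrite groupV repr_notin.
Qed.

Lemma induced_trace_r (V : 'M_(l, m)) : rtrace H rM rN (V *m E) *m D = V.
Proof.
rewrite /rtrace mulmx_suml (bigD1 _ coset1_rcosets) /= big1 => [|A].
  rewrite addr0 /conj_mx repr_group invg1 !repr_mx1 mul1mx mulmx1.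
  by rewrite -mulmxA (induced_1 iN) mulmx1.
case/andP=> HA neA; rewrite /conj_mx -!mulmxA (mulmxA E) (induced_0 iN) ?mulmx0 //.
  by case: (mem_repr_rcosets sHG HA).
exact: repr_notin.
Qed.

Lemma induced_hom_l (U : 'M_(m, l)) :
    {in H, forall h, U *m rM h = rH h *m U} ->
  intertwines G rN rM (rtrace H rN rM (D *m U)).
Proof.
move=> hU; apply: rtrace_intertwines => // h Hh.
by rewrite mulmxA (induced_r iN) // -!mulmxA hU.
Qed.

Lemma induced_hom_r (V : 'M_(l, m)) :
    {in H, forall h, rM h *m V = V *m rH h} ->
  intertwines G rM rN (rtrace H rM rN (V *m E)).
Proof.
move=> hV; apply: rtrace_intertwines => // h Hh.
by rewrite mulmxA hV // -!mulmxA (induced_l iN).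
Qed.

(** Together with [induced_retract] this is Higman's criterion in a form that factors the H-map
    through [rH]. With [rH] the restriction of [rM] it describes relative projectivity; with [rH]
    trivial it describes summands of permutation modules. *)
Lemma retract_induced (U : 'M_(m, l)) (V : 'M_(l, m)) :
    {in H, forall h, U *m rM h = rH h *m U} ->
    {in H, forall h, rM h *m V = V *m rH h} ->
    rtrace H rM rM (V *m U) = 1%:M ->
  retract rM rN.
Proof.
move=> hU hV VU; exists (rtrace H rM rN (V *m E)), (rtrace H rN rM (D *m U)).
split; [exact: induced_hom_r | exact: induced_hom_l |].
rewrite (rtrace_mulr _ _ sHG (induced_hom_l hU)).
by rewrite -mulmxA induced_trace_l.
Qed.

Lemma induced_retract :
  retract rM rN -> exists (U : 'M_(m, l)) (V : 'M_(l, m)),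
  [/\ {in H, forall h, U *m rM h = rH h *m U},
      {in H, forall h, rM h *m V = V *m rH h}
    & rtrace H rM rM (V *m U) = 1%:M].
Proof.
case=> A [B [hA hB AB]]; exists (E *m B), (A *m D); split.
- move=> h Hh; have Gh := subsetP sHG h Hh.
  by rewrite -mulmxA -hB // mulmxA (induced_l iN) // mulmxA.
- move=> h Hh; have Gh := subsetP sHG h Hh.
  by rewrite mulmxA hA // -mulmxA (induced_r iN) // mulmxA.
rewrite -mulmxA (mulmxA D).
rewrite -(rtrace_mull _ _ sHG hA).
rewrite -(rtrace_mulr _ _ sHG hB).
by rewrite (induced_sum iN) mul1mx.
Qed.

End Frobenius.
End Via.

End Retracts.

(** * Complements over a local ring *)

Section LocalRing.

Variables (R : comUnitRingType) (F : fieldType) (red : {rmorphism R -> F}).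
Hypothesis red_surj : forall y, exists a, red a = y.
Hypothesis red_unit : forall a, red a != 0 -> a \is a GRing.unit.

Lemma red_surj_eqP y : exists a, red a == y.
Proof. by have [a <-] := red_surj y; exists a. Qed.

Definition residue_lift y : R := xchoose (red_surj_eqP y).

Lemma residue_liftK : cancel residue_lift red.
Proof. by move=> y; apply/eqP/(xchooseP (red_surj_eqP y)). Qed.

Lemma map_residue_lift m n (A : 'M[F]_(m, n)) :
  map_mx red (map_mx residue_lift A) = A.
Proof. by apply/matrixP=> i j; rewrite !mxE residue_liftK. Qed.

Lemma lift_inverse m n (A : 'M[R]_(m, n)) : m = n ->
    row_free (map_mx red A) ->
  exists2 B : 'M[R]_(n, m), A *m B = 1%:M & B *m A = 1%:M.
Proof.
move=> emn; case: n / emn A => A freeA.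
have uA : A \in unitmx.
  rewrite row_free_unit unitmxE det_map_mx unitfE in freeA.
  by rewrite unitmxE red_unit.
by exists (invmx A); rewrite ?mulmxV ?mulVmx.
Qed.

(** Over the residue field the row space of [A] has a complement. A lift of a basis of it, stacked
    under [A], is invertible because its determinant is nonzero modulo the maximal ideal. *)
Lemma retract_complement m n (A : 'M[R]_(m, n)) (B : 'M[R]_(n, m)) :
    A *m B = 1%:M ->
  exists l (W : 'M[R]_(l, n)) (V : 'M[R]_(n, l)),
    [/\ W *m B = 0, A *m V = 0, W *m V = 1%:M & B *m A + V *m W = 1%:M].
Proof.
move=> AB; pose Af := map_mx red A.
have freeA : row_free Af.
  by apply/row_freeP; exists (map_mx red B); rewrite -map_mxM AB map_mx1.
pose W0 := row_base (Af^C)%MS; pose W' := map_mx residue_lift W0.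
have rAW : \rank (col_mx Af W0) = (m + \rank (Af^C)%MS)%N.
  rewrite -[X in _ = (X + _)%N](eqP freeA) -addsmxE (adds_eqmx (eqmx_refl Af)
    (eq_row_base _)).
  by rewrite (mxrank_disjoint_sum (capmx_compl Af)).
have dimn : (m + \rank (Af^C)%MS)%N = n.
  by rewrite mxrank_compl (eqP freeA) subnKC // -(eqP freeA) rank_leq_col.
have freeT : row_free (map_mx red (col_mx A W')).
  by rewrite map_col_mx map_residue_lift /row_free rAW.
have [X TX XT] := lift_inverse dimn freeT.
rewrite -[X]hsubmxK mul_col_row (scalar_mx_block m) in TX.
have [AP AV WP WV] := eq_block_mx TX.
rewrite -[X]hsubmxK mul_row_col in XT.
(* The lifted rows [W'] need not lie in the kernel of [B]. Subtracting [W' *m B *m A] puts them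
   there, and does not change the product with [rsubmx X], which [A] kills. *)
exists _, (W' - W' *m B *m A), (rsubmx X); split=> //.
- by rewrite mulmxBl -!mulmxA AB mulmx1 subrr.
- by rewrite mulmxBl -!mulmxA AV !mulmx0 subr0.
rewrite mulmxBr addrA addrAC -{1}[B *m A]mul1mx -{1}XT mulmxDl.
rewrite -!mulmxA (mulmxA A) AB mul1mx !mulmxA addrK.
by [].
Qed.

Variables (gT : finGroupType) (G : {group gT}).

(** The rows of [W] span the kernel of the homomorphism [B], so the complement is a submodule, and
    [W *m rN x *m V] is the action on it. *)
Lemma retract_direct_summand m n (rM : mx_representation R G m)
  (rN : mx_representation R G n) : retract rM rN -> direct_summand rM rN.
Proof.
case=> A [B [hA hB AB]].
have [l [W [V [WB AV WV BAVW]]]] := retract_complement AB.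
have VW : V *m W = 1%:M - B *m A by rewrite -BAVW addrC addKr.
have WrB x : x \in G -> W *m rN x *m B = 0.
  by move=> Gx; rewrite -mulmxA hB // mulmxA WB mul0mx.
have rW : mx_repr G (fun x => W *m rN x *m V).
  split=> [|x y Gx Gy]; first by rewrite repr_mx1 mulmx1.
  rewrite !mulmxA -(mulmxA _ V W) VW mulmxBr mulmx1 mulmxBl.
  by rewrite !mulmxA WrB // !mul0mx subr0 repr_mxM // mulmxA.
exists l, (MxRepresentation rW), (row_mx B V), (col_mx A W); split.
- by rewrite mul_row_col.
- by rewrite mul_col_row AB AV WB WV -scalar_mx_block.
move=> x Gx; rewrite mul_mx_row mul_row_block !mulmx0 addr0 add0r hB //=.
rewrite !mulmxA VW !mulmxBl !mul1mx.
by rewrite -(mulmxA B) -hA // -!mulmxA AV !mulmx0 subr0.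
Qed.

End LocalRing.

(** * Isomorphisms and change of scalars *)

Section Isomorphisms.

Variables (R : comUnitRingType) (gT : finGroupType) (G : {group gT}).

Lemma repr_iso_sym m n (rM : mx_representation R G m)
  (rN : mx_representation R G n) : repr_iso rM rN -> repr_iso rN rM.
Proof.
case=> A [B [AB BA hA]]; exists B, A; split=> // x Gx.
rewrite -[LHS]mul1mx -BA -mulmxA (mulmxA A) -hA //.
by rewrite -(mulmxA _ A) AB mulmx1.
Qed.

Lemma repr_iso_refl n (rM : mx_representation R G n) : repr_iso rM rM.
Proof.
by exists 1%:M, 1%:M; split; rewrite ?mulmx1 // => x _; rewrite mulmx1 mul1mx.
Qed.

Lemma repr_iso_trans l m n (rM : mx_representation R G m)
    (rL : mx_representation R G l) (rN : mx_representation R G n) :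
  repr_iso rL rM -> repr_iso rM rN -> repr_iso rL rN.
Proof.
case=> A [B [AB BA hA]] [C [D [CD DC hC]]]; exists (A *m C), (D *m B); split.
- by rewrite -mulmxA (mulmxA C) CD mul1mx.
- by rewrite -mulmxA (mulmxA B) BA mul1mx.
by move=> x Gx; rewrite mulmxA hA // -!mulmxA hC.
Qed.

Lemma repr_iso_retract m n (rM : mx_representation R G m)
  (rN : mx_representation R G n) : repr_iso rM rN -> retract rM rN.
Proof.
case=> A [B [AB BA hA]]; exists A, B; split=> // x Gx.
rewrite -[LHS]mul1mx -BA -mulmxA (mulmxA A) -hA //.
by rewrite -(mulmxA _ A) AB mulmx1.
Qed.

End Isomorphisms.

Section Map.

Variables (R S : comUnitRingType) (f : {rmorphism R -> S}).
Variables (gT : finGroupType) (G : {group gT}).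

Lemma map_repr_iso m n (rM : mx_representation R G m)
    (rN : mx_representation R G n) :
  repr_iso rM rN -> repr_iso (map_repr f rM) (map_repr f rN).
Proof.
case=> A [B [AB BA hA]]; exists (map_mx f A), (map_mx f B); split.
- by rewrite -map_mxM AB map_mx1.
- by rewrite -map_mxM BA map_mx1.
by move=> x Gx; rewrite !map_reprE -!map_mxM hA.
Qed.

Lemma map_dsum_repr l m (rU : mx_representation R G l)
    (rV : mx_representation R G m) :
  repr_iso (map_repr f (dsum_repr rU rV))
           (dsum_repr (map_repr f rU) (map_repr f rV)).
Proof.
exists 1%:M, 1%:M; split; rewrite ?mulmx1 // => x _.
by rewrite mulmx1 mul1mx map_reprE map_block_mx !map_mx0.
Qed.

(** A decomposition is carried by [f] to one with the same dimensions. This is how indecomposability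
    passes from kG-modules up to their lattices. *)
Lemma indecomposable_map n (rM : mx_representation R G n) :
  indecomposable (map_repr f rM) -> indecomposable rM.
Proof.
case=> n_gt0 indM; split=> // l m rU rV iM.
apply: (indM l m (map_repr f rU) (map_repr f rV)).
exact: repr_iso_trans (map_repr_iso iM) (map_dsum_repr _ _).
Qed.

Lemma map_rtrace (H : {group gT}) m n (rM : mx_representation R G m)
    (rN : mx_representation R G n) A :
  map_mx f (rtrace H rM rN A)
    = rtrace H (map_repr f rM) (map_repr f rN) (map_mx f A).
Proof. by rewrite map_mx_sum; apply: eq_bigr => B _; rewrite !map_mxM. Qed.

Lemma induced_via_map (H : {group gT}) m (rH : mx_representation R H m) n
    (rN : mx_representation R G n) E D :
    induced_via rH rN E D ->
  induced_via (map_repr f rH) (map_repr f rN) (map_mx f E) (map_mx f D).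
Proof.
case=> El Dr ED1 ED0 DE; split.
- by move=> h Hh; rewrite !map_reprE -!map_mxM El.
- by move=> h Hh; rewrite !map_reprE -!map_mxM Dr.
- by rewrite -map_mxM ED1 map_mx1.
- by move=> g Gg nHg; rewrite map_reprE -!map_mxM ED0 ?map_mx0.
by rewrite -map_mxM -map_rtrace DE map_mx1.
Qed.

End Map.

(** * Modules over a field *)

Section FieldModules.

Variables (F : fieldType) (gT : finGroupType) (G : {group gT}).

Lemma inverse_dim m n (A : 'M[F]_(m, n)) B :
  A *m B = 1%:M -> B *m A = 1%:M -> m = n.
Proof.
move=> AB BA; apply/eqP; rewrite eqn_leq.
have lemn k l (C : 'M[F]_(k, l)) D : C *m D = 1%:M -> (k <= l)%N.
  move=> CD; have freeC : row_free C by apply/row_freeP; exists D.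
  by rewrite -(eqP freeC) rank_leq_col.
by rewrite (lemn _ _ _ _ AB) (lemn _ _ _ _ BA).
Qed.

Lemma field_direct_summand m n (rM : mx_representation F G m)
  (rN : mx_representation F G n) : retract rM rN -> direct_summand rM rN.
Proof.
apply: (@retract_direct_summand _ _ idfun) => [y|a]; first by exists y.
by rewrite unitfE.
Qed.

(** The complement of [rM] in [rN] must have dimension 0, so the two maps of the retract are square
    and a one-sided inverse is two-sided. *)
Lemma retract_indecomposable m n (rM : mx_representation F G m)
    (rN : mx_representation F G n) :
  (0 < m)%N -> indecomposable rN -> retract rM rN -> repr_iso rM rN.
Proof.
move=> m_gt0 [n_gt0 indN] rMN.
have [l [rW iN]] := field_direct_summand rMN.
have [m0|l0] := indN _ _ _ _ iN; first by rewrite m0 in m_gt0.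
case: iN => X [Y [XY YX _]]; have emn := inverse_dim YX XY.
have {l rW l0 X Y XY YX} emn : m = n by rewrite -emn l0 addn0.
case: n / emn rN n_gt0 indN rMN => rN _ _ [A [B [hA hB AB]]].
by exists A, B; split=> //; apply: mulmx1C.
Qed.

Lemma rel_projectiveP (S : {group gT}) (sSG : S \subset G) n
    (rM : mx_representation F G n) :
  rel_projective sSG rM <->
    exists2 A, intertwines S rM rM A & rtrace S rM rM A = 1%:M.
Proof.
have [E [D iN]] := ind_repr_via (subg_repr rM sSG) sSG; split=> [projM|[A hA A1]].
  have [U [V [hU hV VU]]] := induced_retract sSG iN (direct_summand_retract projM).
  by exists (V *m U) => // h Sh; rewrite mulmxA [rM h *m V]hV // -!mulmxA hU.
apply: field_direct_summand; apply: (retract_induced sSG iN (U := 1%:M) (V := A)).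
- by move=> h _; rewrite mul1mx mulmx1.
- exact: hA.
by rewrite mulmx1.
Qed.

Lemma retract_triv_rel_projective (S : {group gT}) (sSG : S \subset G) n
    (rM : mx_representation F G n) :
  retract rM (ind_repr (triv_repr F S) sSG) -> rel_projective sSG rM.
Proof.
have [E [D iN]] := ind_repr_via (triv_repr F S) sSG.
case/(induced_retract sSG iN)=> U [V [hU hV VU]]; apply/rel_projectiveP.
by exists (V *m U) => // h Sh; rewrite mulmxA hV // -!mulmxA hU.
Qed.

Lemma rel_projective_retract (S : {group gT}) (sSG : S \subset G) m n
    (rM : mx_representation F G m) (rN : mx_representation F G n) :
  retract rM rN -> rel_projective sSG rN -> rel_projective sSG rM.
Proof.
case=> A [B [hA hB AB]] /rel_projectiveP[T hT T1]; apply/rel_projectiveP.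
exists (A *m T *m B).
  move=> h Sh; have Gh := subsetP sSG h Sh.
  by rewrite !mulmxA hA // -(mulmxA A) hT // -!mulmxA hB.
rewrite -(rtrace_mulr rM _ sSG hB) -(rtrace_mull _ _ sSG hA) T1.
by rewrite mulmx1.
Qed.

Lemma char_poly_conj n (A A' B : 'M[F]_n) :
  B \in unitmx -> A *m B = B *m A' -> char_poly A = char_poly A'.
Proof.
move=> uB AB; have nzB : \det (map_mx polyC B) != 0.
  by rewrite det_map_mx polyC_eq0 -unitfE -unitmxE.
apply: (mulIf nzB); rewrite -[RHS]mulrC -!det_mulmx /char_poly; congr (\det _).
rewrite /char_poly_mx mulmxBl mulmxBr -!map_mxM AB scalar_mxC.
by [].
Qed.

Lemma char_poly_rsim m n (rM : mx_representation F G m)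
    (rN : mx_representation F G n) x :
  mx_rsim rM rN -> x \in G -> char_poly (rM x) = char_poly (rN x).
Proof.
case=> B emn; case: n / emn rN B => rN B freeB hB Gx.
by apply: char_poly_conj (hB x Gx); rewrite -row_free_unit.
Qed.

End FieldModules.

(** * Vertices and Brauer quotients in characteristic p *)

Section CharP.

Variables (F : fieldType) (gT : finGroupType) (G : {group gT}) (p : nat).
Hypothesis charFp : p \in [pchar F].

Lemma mxMn_pchar m n (A : 'M[F]_(m, n)) : A *+ p = 0.
Proof. by apply/matrixP=> i j; rewrite mulmxnE mxE (mulrn_pchar charFp). Qed.

(** This bounds vertices from below. As Q acts trivially, the terms of a relative trace from S are
    constant on Q-orbits of cosets; if no conjugate of Q were inside S, the trace equal to the
    identity would vanish by [sum_rcosets_pgroup_eq0]. *)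
Lemma rel_projective_trivial_action (Q S : {group gT}) (sSG : S \subset G) n
    (rM : mx_representation F G n) : (0 < n)%N -> Q \subset rker rM ->
    (p.-group Q)%g -> rel_projective sSG rM ->
  exists2 x, x \in G & (Q :^ x \subset S)%g.
Proof.
move=> n_gt0 kerQ pQ projM; apply/exists_inP; apply: contraT.
rewrite negb_exists_in => /forall_inP nQS.
have [E [D iN]] := ind_repr_via (subg_repr rM sSG) sSG.
have [U [V [hU hV]]] := induced_retract sSG iN (direct_summand_retract projM).
have sQG : Q \subset G by apply: subset_trans kerQ (rstab_sub _ _).
have rQ q : q \in Q -> rM q = 1%:M by move/(subsetP kerQ)/rkerP; case.
have -> : rtrace S rM rM (V *m U) = 0.
  apply: (sum_rcosets_pgroup_eq0 (pcharf_prime charFp) _ sSG sQG pQ) => //.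
  - exact: mxMn_pchar.
  - apply: conj_mx_coset => // s Ss.
    by rewrite mulmxA [rM s *m V]hV // -!mulmxA hU.
  move=> x q Gx Qq; have Gq := subsetP sQG q Qq.
  by rewrite conj_mxM // [LHS]/conj_mx (rQ q) // (rQ q^-1%g) ?groupV // mul1mx mulmx1.
move/matrixP/(_ (Ordinal n_gt0) (Ordinal n_gt0)); rewrite !mxE eqxx.
by move/esym/eqP; rewrite oner_eq0.
Qed.

(** Every vector is fixed, and a trace from a proper subgroup S is multiplication by [#|Q : S|], a
    nontrivial power of p, hence 0. So the Brauer quotient is the restriction of M to the
    normalizer. *)
Lemma char_poly_brauer_quotient (Q : {group gT}) (sQG : Q \subset G) n
    (rM : mx_representation F G n) x :
    Q \subset rker rM -> (p.-group Q)%g -> x \in 'N_G(Q)%g ->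
  char_poly (brauer_quotient sQG rM (coset Q x)) = char_poly (rM x).
Proof.
move=> kerQ pQ Nx.
have rQ q : q \in Q -> rM q = 1%:M by move/(subsetP kerQ)/rkerP; case.
have fix1 : (rfix_mx rM Q :=: 1%:M)%MS.
  by apply/eqmxP; rewrite submx1; apply/rfix_mxP => q /rQ->; rewrite mulmx1.
have trace0 : (trace_sum_mx Q rM :=: (0 : 'M_n))%MS.
  apply/eqmxP; rewrite sub0mx andbT; apply/sumsmx_subP=> S pSQ.
  suff -> : rel_trace_mx Q rM S = 0 by rewrite mulmx0 sub0mx.
  rewrite /rel_trace_mx (eq_bigr (fun=> 1%:M)) => [|A].
    rewrite sumr_const.
    have [] := p_natP (pnat_dvd (dvdn_indexg Q S) pQ) => -[|e] eQS.
      have /andP[sSQ /negP[]] := pSQ.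
      by rewrite -indexg_eq1 eQS.
    by rewrite [#|_|]eQS expnS mulrnA mxMn_pchar mul0rn.
  by move/(mem_repr_rcosets (proper_sub pSQ)) => [QA _]; apply: rQ.
rewrite /brauer_quotient quo_repr_coset //.
pose m1 := mxmodule1 (norm_repr Q rM).
pose m0 := mxmodule0 (norm_repr Q rM) n.
pose s1 := section_eqmx (trace_module sQG rM) m0 (fix_module sQG rM) m1 trace0 fix1.
have s2 := mx_rsim_trans s1 (mx_factmod_sub m0).
have s3 : mx_rsim (factmod_repr m0) (submod_repr m1).
  by apply: mx_rsim_factmod; [rewrite addsmx0_id | apply/mxdirect_addsP;
    rewrite capmx0].
have s4 := mx_rsim_trans (mx_rsim_trans s2 s3) (rsim_submod1 m1 (eqmx_refl _)).
exact: char_poly_rsim s4 Nx.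
Qed.

Lemma brauer_quotient_dim0 (Q : {group gT}) (sQG : Q \subset G) n
    (rM : mx_representation F G n) :
    (rfix_mx rM Q <= trace_sum_mx Q rM)%MS ->
  \rank <<in_factmod (trace_sum_mx Q rM) (rfix_mx rM Q)>>%MS = 0%N.
Proof.
by move=> fixT; apply/eqP; rewrite genmxE mxrank_eq0 in_factmod_eq0.
Qed.

(** Multiply the decomposition of the identity by a Q-fixed x: the factors [rM q^-1] are absorbed by
    x, and what remains is the trace of x P, which is S-fixed. *)
Lemma rfix_sub_trace_sum (Q S : {group gT}) (sQG : Q \subset G) n
    (rM : mx_representation F G n) P :
    S \proper Q -> intertwines S rM rM P ->
    \sum_(A in rcosets S Q) conj_mx rM rM P (repr A) = 1%:M ->
  (rfix_mx rM Q <= trace_sum_mx Q rM)%MS.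
Proof.
move=> pSQ hP P1; apply: (sumsmx_sup S) => //.
suff -> : rfix_mx rM Q = rfix_mx rM Q *m P *m rel_trace_mx Q rM S.
  apply: submxMr; apply/rfix_mxP => s Ss.
  by rewrite -mulmxA -hP // mulmxA rfix_mx_id // (subsetP (proper_sub pSQ)).
rewrite -{1}[rfix_mx rM Q]mulmx1 -P1 !mulmx_sumr; apply: eq_bigr => A.
case/(mem_repr_rcosets (proper_sub pSQ)) => QA _.
by rewrite /conj_mx !mulmxA rfix_mx_id ?groupV.
Qed.

Lemma sum_rcosets_index2 (V : nmodType) (K L : {group gT}) q (f : gT -> V) :
    K \subset L -> q \in L -> q \notin K ->
    {in L, forall x, x \notin K -> (x * q^-1)%g \in K} ->
    coset_invariant L K f ->
  \sum_(A in rcosets K L) f (repr A) = f 1%g + f q.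
Proof.
move=> sKL Lq nKq Lcov fK.
have -> : rcosets K L = [set (K : {set gT}); (K :* q)%g].
  apply/setP=> A; rewrite !inE; apply/rcosetsP/orP=> [[x Lx ->]|[]/eqP->].
  - have [Kx|nKx] := boolP (x \in K); first by left; rewrite rcoset_id.
    by right; apply/eqP/rcoset_eqP; rewrite mem_rcoset Lcov.
  - by exists 1%g; rewrite ?rcoset1.
  by exists q.
rewrite big_setU1 ?big_set1 /=.
  by rewrite -{1}(rcoset1 K) !(coset_invariant_repr fK).
rewrite inE; apply: contra nKq => /eqP eK.
by have := rcoset_refl K q; rewrite -eK.
Qed.

(** The covering hypothesis says that K has index at most 2. For q in Q outside K, transitivity
    writes the identity as P + P^q, where P is the trace of [D *m E] from H to K; since 1 and q also
    represent the cosets of Q :&: K in Q, the identity is a trace from a proper subgroup of Q. *)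
Lemma induced_rfix_sub_trace_sum (H K Q : {group gT}) (sQG : Q \subset G) m
    (rH : mx_representation F H m) n (rN : mx_representation F G n) E D :
    induced_via rH rN E D -> H \subset K -> K \subset G ->
    {in G &, forall x y, x \notin K -> y \notin K -> (x * y^-1)%g \in K} ->
    ~~ (Q \subset K) ->
  (rfix_mx rN Q <= trace_sum_mx Q rN)%MS.
Proof.
move=> iN sHK sKG covK /subsetPn[q Qq nKq].
have hDE : intertwines H rN rN (D *m E).
  by move=> h Hh; rewrite mulmxA (induced_r iN) // -!mulmxA (induced_l iN).
pose P := \sum_(A in rcosets H K) conj_mx rN rN (D *m E) (repr A).
have hP : intertwines K rN rN P.
  exact: (@rtrace_intertwines _ _ _ _ _ (subg_repr rN sKG) (subg_repr rN sKG)).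
have Gq := subsetP sQG q Qq.
have P1 : conj_mx rN rN P 1%g + conj_mx rN rN P q = 1%:M.
  rewrite -(sum_rcosets_index2 sKG Gq nKq) ?(induced_sum iN).
  - rewrite -(induced_sum iN) /rtrace.
    rewrite (sum_rcosets_trans sHK sKG (conj_mx_coset (subset_trans sHK sKG) hDE)).
    apply: eq_bigr => B /(mem_repr_rcosets sKG)[GB _].
    rewrite /P {1}/conj_mx mulmx_sumr mulmx_suml; apply: eq_bigr => A.
    case/(mem_repr_rcosets sHK)=> KA _.
    by rewrite conj_mxM // (subsetP sKG).
  - by move=> x Gx nKx; apply: covK.
  exact: conj_mx_coset.
have sQK : (Q :&: K)%G \proper Q.
  by rewrite properE subsetIl; apply/subsetPn; exists q; rewrite // inE Qq.
apply: (rfix_sub_trace_sum sQG sQK (P := P)).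
  by move=> h /setIP[_ Kh]; apply: hP.
rewrite -P1; apply: sum_rcosets_index2 => //=.
- exact: subsetIl.
- by rewrite inE Qq.
- move=> x Qx; rewrite !inE Qx groupM ?groupV //= => nKx.
  by rewrite covK // (subsetP sQG).
move=> h x /setIP[_ Kh] Qx.
by apply: (conj_mx_coset sKG hP) => //; apply: (subsetP sQG).
Qed.

End CharP.

(** * Modules induced from linear characters *)

Section Monomial.

Variables (R : comUnitRingType) (gT : finGroupType).

(* Falls back to the trivial representation when f is not multiplicative. *)
Definition lin_mx (H : {group gT}) (f : gT -> R) x : 'M[R]_1 :=
  if (f 1%g == 1) && [forall x in H, forall y in H, f (x * y)%g == f x * f y]
  then (f x)%:M else 1%:M.

Lemma lin_mx_repr (H : {group gT}) f : mx_repr H (lin_mx H f).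
Proof.
rewrite /lin_mx; case: andP => [[/eqP f1 /forall_inP fM]|_]; split=> //.
- by rewrite f1.
- move=> x y Hx Hy; rewrite -scalar_mxM.
  by have /forall_inP/(_ y Hy)/eqP-> := fM x Hx.
by move=> x y _ _; rewrite mulmx1.
Qed.

Definition lin_repr (H : {group gT}) f := MxRepresentation (lin_mx_repr H f).

Lemma lin_reprE (H : {group gT}) f x :
  f 1%g = 1 -> {in H &, {morph f : x y / (x * y)%g >-> x * y}} ->
  lin_repr H f x = (f x)%:M.
Proof.
move=> f1 fM; rewrite /= /lin_mx f1 eqxx ifT //; apply/forall_inP=> y Hy.
by apply/forall_inP=> z Hz; rewrite fM.
Qed.

Variables (G H : {group gT}).

(** The formula for induced characters: insert the identity as the trace of [D *m E], and move each
    term cyclically to the form [E *m rN y *m D], which is [rH y] for y in H and 0 otherwise. *)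
Lemma mxtrace_induced m (rH : mx_representation R H m) n
    (rN : mx_representation R G n) E D (sHG : H \subset G) x :
    induced_via rH rN E D -> x \in G ->
  \tr (rN x) = \sum_(A in rcosets H G)
    (if (x ^ (repr A)^-1)%g \in H then \tr (rH (x ^ (repr A)^-1)%g) else 0).
Proof.
move=> iN Gx; rewrite -[rN x]mul1mx -(induced_sum iN) mulmx_suml raddf_sum /=.
apply: eq_bigr => A /(mem_repr_rcosets sHG)[GA _].
rewrite /conj_mx -!mulmxA mxtrace_mulC -!mulmxA mxtrace_mulC.
have Gx' : (x * (repr A)^-1)%g \in G by rewrite groupM ?groupV.
rewrite -!repr_mxM ?groupV //.
have <- : (x ^ (repr A)^-1 = repr A * (x * (repr A)^-1))%g.
  by rewrite conjgE invgK mulgA.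
have [Hy | nHy] := boolP (_ \in H).
  by rewrite (induced_l iN) // -mulmxA (induced_1 iN) mulmx1.
by rewrite (induced_0 iN) ?mxtrace0 // groupJ ?groupV.
Qed.

Lemma induced_kernel m (rH : mx_representation R H m) n
    (rN : mx_representation R G n) E D (sHG : H \subset G) x :
    induced_via rH rN E D -> x \in G ->
    {in G, forall t, (x ^ t)%g \in H /\ rH (x ^ t)%g = 1%:M} ->
  rN x = 1%:M.
Proof.
move=> iN Gx rHx; apply/eqP; rewrite -subr_eq0; apply/eqP.
rewrite -[LHS]mul1mx -[X in X *m _](induced_sum iN) mulmx_suml big1 // => B.
case/(mem_repr_rcosets sHG)=> GB _.
have [|Hxt rxt] := rHx (repr B)^-1%g; first by rewrite groupV.
rewrite /conj_mx -!mulmxA [rN (repr B) *m _]mulmxBr mulmx1 -repr_mxM //.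
have -> : (repr B * x = x ^ (repr B)^-1 * repr B)%g by rewrite conjgE invgK mulgA
  mulgVK.
have Gxt := subsetP sHG _ Hxt.
rewrite repr_mxM // [E *m _]mulmxBr (mulmxA E) (induced_l iN) // rxt mul1mx.
by rewrite subrr !mulmx0.
Qed.

(** The trace of [D *m E] from Q is the index [#|H : Q|] times its trace from H, which is 1;
    dividing [D] by the index gives the maps for Higman's criterion. *)
Lemma induced_retract_triv (Q : {group gT}) (sQG : Q \subset G)
    (rH : mx_representation R H 1) n (rN : mx_representation R G n) E D :
    induced_via rH rN E D -> H \subset G -> Q \subset H ->
    {in Q, forall q, rH q = 1%:M} -> #|H : Q|%g%:R \is a @GRing.unit R ->
  retract rN (ind_repr (triv_repr R Q) sQG).
Proof.
move=> iN sHG sQH rQ1 uHQ.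
have [E' [D' iQ]] := ind_repr_via (triv_repr R Q) sQG.
apply: (retract_induced sQG iQ (U := E) (V := #|H : Q|%g%:R^-1 *: D)).
- by move=> q Qq; have Hq := subsetP sQH q Qq; rewrite (induced_l iN) // rQ1.
- move=> q Qq; have Hq := subsetP sQH q Qq.
  by rewrite -scalemxAr (induced_r iN) // rQ1 // scalemxAl.
have hDE : intertwines H rN rN (D *m E).
  by move=> h Hh; rewrite mulmxA (induced_r iN) // -!mulmxA (induced_l iN).
rewrite -scalemxAl rtraceZ (rtrace_index sQH sHG hDE) (induced_sum iN).
by rewrite scalerA mulVr ?scale1r.
Qed.

(** H is normal, so its elements fix every coset, and the blocks are 1 by 1. *)
Lemma ind_repr_diag (rH : mx_representation R H 1) (sHG : H \subset G) x :
  G \subset 'N(H)%g -> x \in H -> is_diag_mx (ind_repr rH sHG x).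
Proof.
move=> nHG Hx; apply/is_diag_mxblockP; split=> [i j | i]; last exact: mx11_is_diag.
have [GA eA] := mem_repr_rcosets sHG (enum_valP i).
have eAx : (enum_val i :* x)%g = enum_val i.
  rewrite eA norm_rlcoset ?(subsetP nHG) // -mulgA; congr (_ *: _)%g.
  exact: rcoset_id.
by move=> /= /negPf nij; rewrite eAx (inj_eq enum_val_inj) nij.
Qed.

End Monomial.

Lemma diag_mx_repr_exp (R : comUnitRingType) (gT : finGroupType) (G : {group gT})
    n (rN : mx_representation R G n) x i j : x \in G ->
  is_diag_mx (rN x) -> rN (x ^+ j)%g i i = rN x i i ^+ j.
Proof.
move=> Gx /is_diag_mxP dN; elim: j => [|j IHj].
  by rewrite expg0 repr_mx1 mxE eqxx.
rewrite expgS repr_mxM ?groupX // mxE (bigD1 i) //= big1 ?addr0 ?exprS ?IHj //.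
by move=> l nli; rewrite dN ?mul0r // eq_sym.
Qed.

(** * Roots of unity and Brauer characters *)

Section Modular.

Variables (p : nat) (O : idomainType) (K : fieldType) (k : closedFieldType).
Variables (inj : {rmorphism O -> K}) (red : {rmorphism O -> k}).
Hypothesis hms : modular_system p inj red.

Lemma ms_unit a : red a != 0 -> a \is a GRing.unit.
Proof. by rewrite (ms_local hms) negbK. Qed.

(** Compare valuations in x = a / b: if a had the smaller one, raising to the n-th power would make
    a positive power of the uniformizer a unit. *)
Lemma unity_root_integral n (x : K) : (0 < n)%N -> x ^+ n = 1 ->
  exists a, inj a = x.
Proof.
move=> n_gt0 xn1; have [a [b [nzb ex]]] := ms_frac hms x.
have [pi [nzpi npi fac _]] := ms_dvr hms.
have injE c : (inj c == 0) = (c == 0) by rewrite -(inj_eq (ms_inj hms)) rmorph0.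
have nza : a != 0.
  apply: contra_eq_neq xn1 => /eqP; rewrite ex => /eqP->.
  by rewrite rmorph0 mul0r expr0n -(prednK n_gt0) eq_sym oner_eq0.
have [u [i [Uu ea]]] := fac a nza; have [u' [j [Uu' eb]]] := fac b nzb.
have [le_ji|lt_ij] := leqP j i.
  exists (u * u'^-1 * pi ^+ (i - j)); rewrite ex.
  apply: (canRL (mulfK _)); first by rewrite injE.
  rewrite -rmorphM; congr (inj _); rewrite ea eb.
  rewrite -{2}(subnK le_ji) exprD mulrACA -[u * _ * _]mulrA mulVr // mulr1.
  by [].
have exb : inj a = x * inj b by rewrite ex divfK // injE.
have: (u * u'^-1) ^+ n = pi ^+ ((j - i) * n).
  apply: (ms_inj hms); apply: (mulIf (x := inj ((u' * pi ^+ i) ^+ n))).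
    rewrite injE expf_neq0 // mulf_neq0 ?expf_neq0 //.
    by apply: contraTneq Uu' => ->; rewrite unitr0.
  rewrite -!rmorphM -exprMn mulrA divrK // -ea rmorphXn exb exprMn xn1 mul1r.
  rewrite exprM -exprMn mulrCA -exprD subnK ?(ltnW lt_ij) // -eb rmorphXn.
  by [].
move/(congr1 (fun c => c \is a GRing.unit)).
rewrite unitrX ?unitrM ?Uu ?unitrV ?Uu' // => /esym.
by rewrite unitrX_pos ?muln_gt0 ?subn_gt0 ?lt_ij // (negPf npi).
Qed.

(** For c = a / b different from 1 the sum of the c^i with i < m is 0, but it reduces to m, which is
    nonzero in k. *)
Lemma red_unity_inj m a b : m%:R != 0 :> k -> a ^+ m = 1 -> b ^+ m = 1 ->
  red a = red b -> a = b.
Proof.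
move=> nzm am bm eab.
have m_gt0 : (0 < m)%N by case: m nzm {am bm} => //; rewrite eqxx.
have Ub : b \is a GRing.unit by rewrite -(unitrX_pos _ m_gt0) bm unitr1.
pose c := a / b; have cm : c ^+ m = 1 by rewrite expr_div_n am bm divr1.
have rc : red c = 1.
  by rewrite rmorphM rmorphV // eab divff // -unitfE rmorph_unit.
have /eqP: (c - 1) * \sum_(i < m) c ^+ i = 0 by rewrite -subrX1 cm subrr.
rewrite mulf_eq0 subr_eq0 => /orP[/eqP c1|/eqP s0].
  by rewrite -[a](divrK Ub) -/c c1 mul1r.
case/eqP: nzm; rewrite -(rmorph0 red) -s0 rmorph_sum.
rewrite (eq_bigr (fun=> 1)) => [|i _]; last by rewrite rmorphXn rc expr1n.
by rewrite sumr_const card_ord.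
Qed.

Lemma root_liftK m a : m%:R != 0 :> k -> a ^+ m = 1 ->
  root_lift red m (red a) = a.
Proof.
move=> nzm am; rewrite /root_lift.
have /(ClassicalEpsilon.epsilon_spec (inhabits 0)) :
  exists b : O, b ^+ m = 1 /\ red b = red a by exists a.
by case=> bm eb; apply: (red_unity_inj nzm).
Qed.

Section BrauerCharacters.

Variables (gT : finGroupType) (G : {group gT}).

Lemma brauer_char_prod n (rM : mx_representation k G n) x s :
    char_poly (rM x) = \prod_(l <- s) ('X - l%:P) ->
  brauer_char inj red rM x = \sum_(l <- s) inj (root_lift red #[x]%g l).
Proof.
move=> chi_x; rewrite /brauer_char.
case: closed_field_poly_normal => t /=.
rewrite (monicP (char_poly_monic _)) scale1r chi_x => /prod_XsubC_eq st.
by rewrite (perm_big _ st).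
Qed.

Lemma brauer_char_dim0 n (rM : mx_representation k G n) x :
  n = 0%N -> brauer_char inj red rM x = 0.
Proof.
move=> n0; subst n; rewrite (brauer_char_prod (s := [::])) ?big_nil //.
exact: det_mx00.
Qed.

End BrauerCharacters.

(** Two groups appear because [y] will be the image of [x] in the quotient of a normalizer, where
    the Brauer quotient lives, while the lattice [L] is a module for G. *)
Lemma brauer_char_lift (gT : finGroupType) (G : {group gT}) (hT : finGroupType)
    (X : {group hT}) m
    (rM : mx_representation k X m) (y : hT) n (L : mx_representation O G n) x :
    char_poly (rM y) = char_poly (map_repr red L x) ->
    is_diag_mx (L x) -> (forall i, L x i i ^+ #[y]%g = 1) ->
    (#[y]%g%:R != 0 :> k) ->
  brauer_char inj red rM y = inj (\tr (L x)).
Proof.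
move=> chi_y dL Ly nzy.
rewrite (brauer_char_prod (s := [seq red (L x i i) | i : 'I_n])).
  rewrite big_image /= rmorph_sum; apply: eq_bigr => i _.
  by rewrite root_liftK.
rewrite chi_y char_poly_trig.
  by rewrite big_image; apply: eq_bigr => i _; rewrite map_reprE mxE.
apply: is_diag_mx_is_trig; apply/is_diag_mxP => i j ne_ij.
by rewrite map_reprE mxE (is_diag_mxP dL) ?rmorph0.
Qed.

End Modular.

Lemma mxtrace_repr_iso (R : comUnitRingType) (gT : finGroupType)
    (G : {group gT}) m n (rM : mx_representation R G m)
    (rN : mx_representation R G n) x :
  repr_iso rM rN -> x \in G -> \tr (rM x) = \tr (rN x).
Proof.
case=> A [B [AB BA hA]] Gx.
by rewrite -[rM x]mulmx1 -AB mulmxA hA // mxtrace_mulC mulmxA BA mul1mx.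
Qed.

(** * Uniqueness of trivial source lifts *)

Section Lifting.

Variables (p : nat) (O : idomainType) (K : fieldType) (k : closedFieldType).
Variables (inj : {rmorphism O -> K}) (red : {rmorphism O -> k}).
Hypothesis hms : modular_system p inj red.
Variables (gT : finGroupType) (G : {group gT}).

(* A Q-fixed vector of a permutation module is constant on Q-orbits, so it    *)
(* lifts coordinatewise; here the coordinates of x are x (t^-1 V).            *)
Lemma lift_fixed_vector (P Q : {group gT}) n (L : mx_representation O G n)
    (U : 'M[O]_(1, n)) (V : 'M[O]_(n, 1)) (x : 'M[k]_(1, n)) :
    P \subset G -> Q \subset G ->
    {in P, forall h, U *m L h = U} -> {in P, forall h, L h *m V = V} ->
    rtrace P L L (V *m U) = 1%:M ->
    {in Q, forall q, x *m map_repr red L q = x} ->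
  exists2 y : 'M[O]_(1, n), map_mx red y = x & {in Q, forall q, y *m L q = y}.
Proof.
move=> sPG sQG hU hV UV1 hx.
pose c t := map_mx (residue_lift (ms_surj hms)) (x *m map_mx red (L t^-1%g *m V)).
pose F t := c t *m (U *m L t).
have FP : coset_invariant G P F.
  move=> h t Ph Gt; have Gh := subsetP sPG h Ph.
  rewrite /F /c invMg !repr_mxM ?groupV // -(mulmxA _ _ V) (hV h^-1%g) ?groupV //.
  by rewrite (mulmxA U) hU.
exists (\sum_(A in rcosets P G) F (repr A)); last first.
  move=> q Qq; have Gq := subsetP sQG q Qq.
  rewrite mulmx_suml -[RHS](sum_rcosetsM sPG FP Gq); apply: eq_bigr => A.
  case/(mem_repr_rcosets sPG) => GA _; rewrite /F -!mulmxA -repr_mxM //.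
  congr (_ *m _); symmetry.
  rewrite /c invMg repr_mxM ?groupV // -mulmxA map_mxM mulmxA.
  by have := hx q^-1%g; rewrite groupV map_reprE => ->.
rewrite map_mx_sum -[RHS]mulmx1 -(map_mx1 red) -UV1 map_rtrace mulmx_sumr.
apply: eq_bigr => A _.
rewrite /F /c map_mxM map_residue_lift /conj_mx !map_reprE -!map_mxM -mulmxA.
by rewrite -!map_mxM !mulmxA.
Qed.

Lemma trivial_source_fixed n (L : mx_representation O G n) :
    trivial_source p L ->
  exists (P : {group gT}) (U : 'M_(1, n)) (V : 'M_(n, 1)),
  [/\ P \subset G, {in P, forall h, U *m L h = U},
      {in P, forall h, L h *m V = V} & rtrace P L L (V *m U) = 1%:M].
Proof.
case=> _ [P [sPG [_ /direct_summand_retract rLP]]].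
have [E [D iN]] := ind_repr_via (triv_repr O P) sPG.
have [U [V [hU hV UV]]] := induced_retract sPG iN rLP.
exists P, U, V; split=> // h Ph; first by rewrite hU ?mul1mx.
by rewrite hV ?mulmx1.
Qed.

(** The identity of [L] is the trace of [V *m U] with [U] fixed by Q, so the isomorphism A over k is
    the trace of V (U A). Only the Q-fixed vector U A has to be lifted, and the resulting
    homomorphism is invertible because its reduction is. *)
Lemma trivial_source_lift_unique m n (L : mx_representation O G m)
    (L' : mx_representation O G n) :
    trivial_source p L -> trivial_source p L' ->
    repr_iso (map_repr red L) (map_repr red L') ->
  repr_iso L L'.
Proof.
move=> /trivial_source_fixed[Q [U [V [sQG hU hV UV]]]].
move=> /trivial_source_fixed[P [U' [V' [sPG hU' hV' UV']]]] [A [B [AB BA hA]]].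
have hUA : {in Q, forall q, map_mx red U *m A *m map_repr red L' q =
  map_mx red U *m A}.
  move=> q Qq; have Gq := subsetP sQG q Qq.
  by rewrite -mulmxA -hA // mulmxA map_reprE -map_mxM hU.
have [y ey hy] := lift_fixed_vector sPG sQG hU' hV' UV' hUA.
have hC : intertwines G L L' (rtrace Q L L' (V *m y)).
  apply: rtrace_intertwines => // q Qq.
  by rewrite mulmxA hV // -mulmxA hy.
have redC : map_mx red (rtrace Q L L' (V *m y)) = A.
  rewrite map_rtrace map_mxM ey mulmxA -(rtrace_mulr _ _ sQG hA).
  by rewrite -map_mxM -map_rtrace UV map_mx1 mul1mx.
have [|D CD DC] := lift_inverse (ms_unit hms) (A := rtrace Q L L' (V *m y))
  (inverse_dim AB BA).
  by rewrite redC; apply/row_freeP; exists B.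
by exists (rtrace Q L L' (V *m y)), D.
Qed.

Lemma lift_character_map n (L : mx_representation O G n) (chi : gT -> K) :
    trivial_source p L -> {in G, forall x, inj (\tr (L x)) = chi x} ->
  lift_character p inj red (Representation (map_repr red L)) chi.
Proof.
move=> tsL chiL; split; first by exists n, L; split=> //; apply: repr_iso_refl.
move=> m L' [tsL' isoL'] x Gx.
rewrite map_reprE trace_map_mx -chiL //; congr (inj _).
apply: mxtrace_repr_iso => //; exact: trivial_source_lift_unique.
Qed.

End Lifting.

(** * The dihedral group in normal form *)

Section DihedralGroup.

Local Open Scope group_scope.

Variables (v : nat) (gT : finGroupType) (G : {group gT}) (r s : gT).
Hypotheses (v_ge3 : (3 <= v)%N) (v_odd : odd v).
Hypothesis hG : dihedral_presented v G r s.

Let v_gt0 : (0 < v)%N. Proof. exact: leq_trans v_ge3. Qed.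

Lemma dihedral_r : r \in G.
Proof. by case: hG => -> _ _; rewrite mem_gen // !inE eqxx. Qed.

Lemma dihedral_s : s \in G.
Proof. by case: hG => -> _ _; rewrite mem_gen // !inE eqxx orbT. Qed.

Lemma dihedral_r2v : r ^+ (2 * v) = 1.
Proof. by case: hG => _ []. Qed.

Lemma dihedral_ss : s * s = 1.
Proof. by case: hG => _ [_ + _] _; rewrite expgS expg1. Qed.

Lemma dihedral_sV : s^-1 = s.
Proof. by apply: (mulgI s); rewrite mulgV dihedral_ss. Qed.

Lemma dihedral_rs : r ^ s = r^-1.
Proof.
case: hG => _ [_ _ +] _; rewrite expgS expg1 -mulgA => srsr.
apply: (mulIg r); rewrite mulVg conjgE dihedral_sV -srsr.
by rewrite -!mulgA.
Qed.

Lemma dihedral_rXs u : r ^+ u ^ s = r ^- u.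
Proof. by rewrite conjXg dihedral_rs expgVn. Qed.

Lemma dihedral_elt x : x \in G -> exists (e : bool) u, x = s ^+ e * r ^+ u.
Proof.
have nrs : <[s]> \subset 'N(<[r]>).
  by rewrite cycle_subG inE -cycleJ dihedral_rs cycleV.
have -> : G = (<[s]> <*> <[r]>)%G.
  by apply/val_inj; case: hG => -> _ _; rewrite /= joing_idl joing_idr setUC.
move=> /=; rewrite (norm_joinEl nrs) => /mulsgP[_ _ /cycleP[i ->] /cycleP[u ->] ->].
exists (odd i), u; congr (_ * _).
rewrite -{1}(odd_double_half i) expgD -mul2n expgM.
by rewrite (expgS s 1) expg1 dihedral_ss expg1n mulg1.
Qed.

(** The normal form bounds [#|G|] by twice the order of r, at most 4v. Being presented by the
    relations, G also maps onto the concrete dihedral group of order 4v, so all the bounds are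
    equalities. *)
Lemma dihedral_order_card : #[r] = (2 * v)%N /\ #|G| = (4 * v)%N.
Proof.
have v2_gt1 : (1 < 2 * v)%N by rewrite (leq_trans
  (n := 2 * 1)) // leq_mul2l v_gt0 orbT.
have dvr : (#[r] %| 2 * v)%N by rewrite order_dvdn dihedral_r2v.
have le_r : (#[r] <= 2 * v)%N by rewrite dvdn_leq // muln_gt0 v_gt0.
have leG : (#|G| <= 2 * #[r])%N.
  pose f (ei : bool * 'I_#[r]) := s ^+ ei.1 * r ^+ ei.2.
  have sGf : G \subset codom f.
    apply/subsetP=> x /dihedral_elt[e [u ->]]; apply/codomP.
    exists (e, Ordinal (ltn_pmod u (order_gt0 r))); rewrite /f /=.
    by rewrite expg_mod_order.
  by apply: leq_trans (subset_leq_card sGf) _;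
    rewrite (leq_trans (card_size _)) // size_codom card_prod card_bool card_ord.
have leD : (4 * v <= #|G|)%N.
  have [_ _ isoG] := hG.
  have -> : (4 * v = (2 * v).*2)%N by rewrite -mul2n mulnA.
  rewrite -(card_dihedral v2_gt1) dvdn_leq // card_homg // isoG.
  have := isoGrp_hom (Grp_dihedral v2_gt1).
  case/existsP=> [[x y]] /eqP[defD xq y2 xy]; apply/existsP; exists (x, y).
  (* The presentation of the concrete group gives [x ^ y = x^-1], which has to be turned into
     [(y * x) ^+ 2 = 1]. *)
  rewrite /= !xpair_eqE defD xq y2 !eqxx /= (expgS (y * x) 1) expg1 mulgA.
  have yV : y^-1 = y by apply: (mulgI y); rewrite mulgV -y2 (expgS y 1) expg1.
  have -> : y * x * y = x^-1 by rewrite -xy conjgE yV mulgA.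
  by rewrite mulVg.
have le2 : (4 * v <= 2 * #[r])%N := leq_trans leD leG.
have er : #[r] = (2 * v)%N.
  by apply/eqP; rewrite eqn_leq le_r -(leq_pmul2l (isT : 0 < 2)%N) mulnA.
split=> //; apply/eqP; rewrite eqn_leq leD andbT.
by rewrite (leq_trans leG) // er mulnA.
Qed.

Lemma dihedral_or : #[r] = (2 * v)%N. Proof. by case: dihedral_order_card. Qed.
Lemma card_dihedral_presented : #|G| =
  (4 * v)%N. Proof. by case: dihedral_order_card. Qed.

Lemma dihedral_rX_eq i j : (r ^+ i == r ^+ j) = (i == j %[mod 2 * v]).
Proof. by rewrite eq_expg_mod_order dihedral_or. Qed.

Lemma dihedral_s_notin : s \notin <[r]>.
Proof.
apply/negP=> rs; have sGr : G \subset <[r]>.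
  apply/subsetP=> x /dihedral_elt[e [u ->]].
  by rewrite groupM ?mem_cycle // groupX.
have := subset_leq_card sGr; rewrite card_dihedral_presented -[#|_|]/#[r] dihedral_or.
by rewrite leq_pmul2r ?v_gt0.
Qed.

Let C := <[r ^+ 2]>.
Let z := r ^+ v.

Lemma dihedral_mem_r2 u : (r ^+ u \in C) = ~~ odd u.
Proof.
apply/cycleP/idP=> [[i /eqP]|ev_u].
  rewrite -expgM dihedral_rX_eq => /eqP/(congr1 odd).
  by rewrite !odd_mod ?oddM //= => ->.
by exists u./2; rewrite -expgM mul2n even_halfK.
Qed.

Lemma dihedral_mem_r (e : bool) u : (s ^+ e * r ^+ u \in <[r]>) = ~~ e.
Proof.
rewrite groupMr ?mem_cycle //; case: e; last by rewrite group1.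
by rewrite expg1 (negPf dihedral_s_notin).
Qed.

Definition dihedral_H i : {group gT} := (dihedral_Q v r s i <*> <[r ^+ 2]>)%G.

(** The order 2v of r is even, so the parity of an exponent makes sense. It is kept because
    membership in the groups [H i] depends on it alone, besides the exponent of s. *)
Lemma dihedral_rN u : exists j, r ^- u = r ^+ j /\ odd j = odd u.
Proof.
exists ((2 * v).-1 * u)%N; split.
  have rV : r^-1 = r ^+ (2 * v).-1.
    apply: (mulIg r); rewrite mulVg -expgSr prednK ?dihedral_r2v //.
    by rewrite muln_gt0 v_gt0.
  by rewrite -expgVn rV -expgM.
by rewrite oddM -subn1 oddB ?mul2n ?odd_double // double_gt0 v_gt0.
Qed.

Lemma dihedral_sru u : s * r ^+ u = r ^- u * s.
Proof. by rewrite -dihedral_rXs conjgE dihedral_sV -!mulgA dihedral_ss mulg1. Qed.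

Lemma dihedral_zs : z ^ s = z.
Proof.
rewrite dihedral_rXs; apply/eqP; rewrite eq_invg_mul -expgD addnn -mul2n.
by rewrite dihedral_r2v.
Qed.

Lemma dihedral_zz : z * z = 1.
Proof. by rewrite -expgD addnn -mul2n dihedral_r2v. Qed.

Lemma dihedral_z_comm x : x \in G -> commute z x.
Proof.
case/dihedral_elt=> e [u ->]; apply: commuteM; last exact/commuteX2/commute_refl.
by apply: commuteX; rewrite /commute conjgC dihedral_zs.
Qed.

Lemma dihedral_z_neq1 : z != 1.
Proof.
rewrite -(expg0 r) dihedral_rX_eq mod0n modn_small; first by rewrite -lt0n v_gt0.
by rewrite mul2n -addnn -{1}[v]addn0 ltn_add2l v_gt0.
Qed.

Lemma dihedral_order2 (x : gT) : x != 1 -> x * x = 1 -> #[x] = 2.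
Proof.
by move=> nx1 xx; apply: nt_prime_order; rewrite // (expgS x 1) expg1.
Qed.

Lemma dihedral_sr_neq1 u : s * r ^+ u != 1.
Proof.
by apply/eqP=> e1; have := dihedral_mem_r true u; rewrite expg1 e1 group1.
Qed.

Lemma dihedral_srsr u : (s * r ^+ u) * (s * r ^+ u) = 1.
Proof. by rewrite {1}dihedral_sru -mulgA (mulgA s s) dihedral_ss mul1g mulVg. Qed.

Lemma dihedral_Q5E : dihedral_Q v r s 5 = (<[s]> <*> <[z]>)%G.
Proof. by apply/val_inj; rewrite /= joing_idl joing_idr. Qed.

(** The pair (e, odd u) identifies G modulo C with a four-group. The five cases are its subgroups:
    the trivial one, the three of order 2, and the whole group. *)
Definition dihedral_mem i (e : bool) u : bool :=
  match i with
  | 1 => ~~ e && ~~ odd u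
  | 2 => odd u == e
  | 3 => ~~ e
  | 4 => ~~ odd u
  | _ => true
  end.

Lemma dihedral_r2_normed x : x \in G -> x \in 'N(C).
Proof.
have nr : r \in 'N(C) by rewrite (subsetP (cent_sub _)) // cent_cycle;
  apply/cent1P/commuteX/commute_refl.
have ns : s \in 'N(C) by rewrite inE -cycleJ dihedral_rXs cycleV.
by case/dihedral_elt=> e [u ->]; rewrite groupM ?groupX.
Qed.

Lemma dihedral_mem_r2_div (e1 e : bool) u1 u :
  ((s ^+ e1 * r ^+ u1)^-1 * (s ^+ e * r ^+ u) \in C) = (e1 == e) && (odd u1 == odd u).
Proof.
have ss (b : bool) : s ^+ b * s ^+ b = 1 by case: b; rewrite ?mulg1 ?dihedral_ss.
have sV (b : bool) : (s ^+ b)^-1 = s ^+ b by apply: (mulgI (s ^+ b));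
  rewrite mulgV ss.
have [j [rj oj]] := dihedral_rN u1.
rewrite invMg rj sV mulgA -(mulgA _ (s ^+ e1)).
have [<-|ne] /= := eqVneq e1 e.
  by rewrite ss mulg1 -expgD dihedral_mem_r2 oddD oj; case: (odd u1) (odd u) => [] [].
have -> : s ^+ e1 * s ^+ e = s.
  by case: e1 e ne => [] [] //=; rewrite ?mulg1 ?mul1g.
rewrite -rj -dihedral_sru -mulgA -expgD; apply/negP=> Cs.
have := dihedral_mem_r true (u1 + u); rewrite expg1 (subsetP _ _ Cs) //.
by rewrite cycle_subG mem_cycle.
Qed.

Lemma dihedral_QE i : (1 <= i <= 4)%N ->
  dihedral_Q v r s i = [set 1; s ^+ (~~ odd i || (i == 4)) * r ^+ (v *
    (i \in [:: 2; 3]))] :> {set gT}.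
Proof.
case: i => [|[|[|[|[|i]]]]] //= _; rewrite ?muln0 ?muln1 ?mulg1 ?mul1g.
- by rewrite setUid.
- by rewrite cycle2g // dihedral_order2 ?dihedral_sr_neq1 ?dihedral_srsr.
- by rewrite cycle2g // dihedral_order2 ?dihedral_z_neq1 ?dihedral_zz.
have := dihedral_order2 (dihedral_sr_neq1 0) (dihedral_srsr 0).
by rewrite mulg1 => os; rewrite cycle2g.
Qed.

Lemma dihedral_mem_H i (e : bool) u :
  (s ^+ e * r ^+ u \in dihedral_H i) = dihedral_mem i e u.
Proof.
have sQG := dihedral_Q_sub hG i.
rewrite /= norm_joinEl; last first.
  by apply/subsetP=> q Qq; apply: dihedral_r2_normed; apply: (subsetP sQG).
have mulE : (s ^+ e * r ^+ u \in dihedral_Q v r s i * C)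
   = [exists q in dihedral_Q v r s i, q^-1 * (s ^+ e * r ^+ u) \in C].
  apply/mulsgP/exists_inP=> [[q c Qq Cc ->]|[q Qq Cq]].
    by exists q; rewrite ?mulKg.
  by exists q (q^-1 * (s ^+ e * r ^+ u)); rewrite ?mulKVg.
rewrite mulE.
have [i14|ni14] := boolP (1 <= i <= 4)%N.
  have eC1 := dihedral_mem_r2_div false e 0 u; rewrite mulg1 in eC1.
  transitivity ((1^-1 * (s ^+ e * r ^+ u) \in C) || ((s ^+ (~~ odd i ||
    (i == 4)) * r ^+ (v * (i \in [:: 2; 3])))^-1 * (s ^+ e * r ^+ u) \in C)).
    apply/exists_inP/orP=> [[q]|].
      by rewrite dihedral_QE // !inE => /orP[]/eqP-> ?; [left | right].
    by case=> ?; [exists 1 | eexists; [|eassumption]];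
      rewrite // dihedral_QE // !inE eqxx ?orbT.
  rewrite eC1 dihedral_mem_r2_div oddM {eC1}.
  by case: i i14 {sQG mulE} => [|[|[|[|[|i]]]]] //= _; rewrite ?v_odd; case: e;
    case: (odd u).
have -> : dihedral_mem i e u = true by case: i ni14 {sQG mulE} => [|[|[|[|[|i]]]]].
(* As v is odd, v times [odd u] has the parity of u, so this element of Q 5 lies in the right class
   modulo C. *)
apply/exists_inP; exists (s ^+ e * r ^+ (v * odd u)); last first.
  by rewrite dihedral_mem_r2_div oddM v_odd oddb !eqxx.
have -> : dihedral_Q v r s i = dihedral_Q v r s 5 by case: i ni14 {sQG mulE} =>
  [|[|[|[|[|i]]]]].
by rewrite groupM // ?expgM groupX // mem_gen // !inE eqxx ?orbT.
Qed.

End DihedralGroup.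

(** * Residues modulo v up to sign *)

Section HalfRange.

Local Open Scope nat_scope.

Variable v : nat.
Hypothesis v_odd : odd v.

(** Congruence modulo v up to sign. The representatives 0, ..., (v - 1)/2 index the classes of the
    even powers of r, the modules with vertex Q 1 or Q 3, and the row permutation. *)
Definition eq_sign_mod a b := (a == b %[mod v]) || (v %| a + b).

Lemma half_eq a b : a < v./2.+1 -> b < v./2.+1 -> eq_sign_mod a b -> a = b.
Proof.
have ev := odd_double_half v; rewrite v_odd in ev.
move=> le_a le_b /orP[|/dvdnP[[|q]]].
- by rewrite !modn_small; lia.
- by lia.
by rewrite mulSn; have: 0 <= q * v by []; lia.
Qed.

Lemma half_ex u : exists2 b, b < v./2.+1 & eq_sign_mod u b.
Proof.
have ev := odd_double_half v; rewrite v_odd in ev.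
have lt_uv : u %% v < v by rewrite ltn_mod; lia.
have [le_u|gt_u] := ltnP (u %% v) v./2.+1.
  by exists (u %% v); rewrite // /eq_sign_mod modn_mod eqxx.
exists (v - u %% v); first by lia.
apply/orP; right; rewrite {1}(divn_eq u v) -addnA subnKC ?(ltnW lt_uv) //.
by rewrite dvdn_addr // dvdn_mull.
Qed.

Lemma half_lt : v./2 < v.
Proof. by have := odd_double_half v; rewrite v_odd; lia. Qed.

(** [v.+1./2] is the inverse of 2 modulo v. *)
Lemma four_half j : 4 * (j * v.+1./2) = 2 * j + v * (2 * j).
Proof.
have ev := odd_double_half v.+1; rewrite /= v_odd /= add0n -muln2 in ev.
have -> : 4 * (j * v.+1./2) = 2 * j * (v.+1./2 * 2) by lia.
by rewrite ev; lia.
Qed.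

Lemma ndvdn_double j : 0 < j < v -> (v %| 2 * j) = false.
Proof.
case/andP=> j_gt0 lt_jv; rewrite Gauss_dvdr ?coprimen2 //.
by rewrite gtnNdvd.
Qed.

Lemma eq_sign_mod_half a b : eq_sign_mod (2 * a) b -> eq_sign_mod a (v.+1./2 * b).
Proof.
have ev : v.+1./2 * (2 * a) = v * a + a.
  have := odd_double_half v.+1; rewrite /= v_odd /= add0n -muln2 => ev.
  by rewrite mulnA ev mulSn addnC.
case/orP=> [/eqP ab|dv]; apply/orP; [left|right].
  by rewrite -modnMmr -ab modnMmr ev mulnC modnMDl.
have := dvdn_mull v.+1./2 dv; rewrite mulnDr ev -addnA.
by rewrite dvdn_addr // dvdn_mulr.
Qed.

Lemma eq_sign_mod_trans a b c : eq_sign_mod a c -> eq_sign_mod b c -> eq_sign_mod a b.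
Proof.
case/orP=> [/eqP ac|ac] /orP[/eqP bc|bc]; apply/orP.
- by left; rewrite ac bc.
- by right; rewrite /dvdn -modnDml ac modnDml addnC.
- by right; rewrite /dvdn -modnDmr bc modnDmr.
by left; rewrite -(eqn_modDr c) (eqP ac) (eqP bc).
Qed.

End HalfRange.

(** * The 2-subgroups and their products with <r^2> *)

Section DihedralSubgroups.

Local Open Scope group_scope.

Variables (v : nat) (gT : finGroupType) (G : {group gT}) (r s : gT).
Hypotheses (v_ge3 : (3 <= v)%N) (v_odd : odd v).
Hypothesis hG : dihedral_presented v G r s.

Let Q := dihedral_Q v r s.
Let H := dihedral_H v r s.
Let C : {group gT} := <[r ^+ 2]>%G.
Let z := r ^+ v.
Let sQG i : Q i \subset G := dihedral_Q_sub hG i.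
Let Gr := dihedral_r hG.
Let Gs := dihedral_s hG.
Let memH := dihedral_mem_H v_ge3 v_odd hG.

Lemma dihedral_C_sub : C \subset G.
Proof. by rewrite cycle_subG groupX. Qed.

Lemma dihedral_H_sub i : H i \subset G.
Proof. by rewrite join_subG sQG dihedral_C_sub. Qed.

Lemma dihedral_QH i : Q i \subset H i. Proof. exact: joing_subl. Qed.

Lemma dihedral_CH i : C \subset H i. Proof. exact: joing_subr. Qed.

(** Conjugation by r or s preserves both coordinates e and [odd u]. *)
Lemma dihedral_H_norm i : G \subset 'N(H i).
Proof.
suff nH g : g \in [set r; s] -> g \in 'N(H i).
  case: (hG) => -> _ _; rewrite gen_subG; apply/subsetP => g; exact: nH.
move=> gen_g; have Gg : g \in G by case/set2P: gen_g => ->.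
rewrite inE; apply/subsetP=> _ /imsetP[x Hx ->].
have [e [u ex]] := dihedral_elt hG (subsetP (dihedral_H_sub i) x Hx).
rewrite {}ex memH in Hx *.
suff [e' [u' [-> -> ou']]] : exists e' u',
    [/\ (s ^+ e * r ^+ u) ^ g = s ^+ (e' : bool) * r ^+ u', e' = e & odd u' = odd u].
  by rewrite memH; case: i Hx => [|[|[|[|[|i]]]]] //=; rewrite ou'.
have rV (j : nat) : exists k, r ^- j = r ^+ k /\ odd k =
  odd j := dihedral_rN v_ge3 hG j.
case/set2P: gen_g => ->.
  case: e Hx => _; last first.
    by exists false, u; split=> //; rewrite !mul1g conjgE -expgSr expgS mulKg.
  exists true, (u + 2)%N; split=> //; last by rewrite oddD addbF.
  have rVs : r^-1 * s = s * r.
    by have := dihedral_sru hG 1; rewrite expg1.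
  by rewrite !expg1 conjgE !mulgA rVs -!mulgA -expgSr -expgS addn2.
have [j [rj oj]] := rV u.
exists e, j; split=> //; rewrite conjMg (dihedral_rXs hG) rj; congr (_ * _).
by rewrite conjXg conjgE mulKg.
Qed.

Lemma dihedral_H_index2 i : i \in [:: 2; 3; 4] ->
  {in G &, forall x y, x \notin H i -> y \notin H i -> x * y^-1 \in H i}.
Proof.
move=> i234 _ _ /(dihedral_elt hG)[e [u ->]] /(dihedral_elt hG)[e' [u' ->]].
have [j [rj oj]] := dihedral_rN v_ge3 hG u'.
have [l [rl ol]] := dihedral_rN v_ge3 hG (u + j).
rewrite invMg rj mulgA -(mulgA _ (r ^+ u)) -expgD !memH.
have -> : s ^+ e * r ^+ (u + j) * (s ^+ e')^-1
        = s ^+ (e (+) e') * r ^+ (if e' then l else u + j).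
  case: e' => /=; last by rewrite invg1 mulg1 addbF.
  rewrite (dihedral_sV hG) -mulgA (conjgC _ s) (dihedral_rXs hG) rl mulgA.
  by congr (_ * _); case: e; rewrite /= ?mulg1 ?mul1g ?(dihedral_ss hG).
rewrite memH !inE in i234 *; case/or3P: i234 => /eqP-> /=.
all: by case: e; case: e'; rewrite /= ?ol ?oddD ?oj; case: (odd u); case: (odd u').
Qed.

(** Modulo C these are the inclusions in a four-group. The same relation on indices describes the
    inclusion of [Q j] in [Q i], so the normal subgroup [H i] can stand in for [Q i]. *)
Lemma dihedral_Q_sub_H i j : (1 <= i <= 5)%N -> (1 <= j <= 5)%N ->
  (Q j \subset H i) = [|| j == 1, i == 5 | i == j]%N.
Proof.
have mz := memH i false v; rewrite mul1g in mz.
have ms := memH i true 0; rewrite mulg1 expg1 in ms.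
have msz := memH i true v; rewrite expg1 in msz.
move=> i15; case: j => [|[|[|[|[|[|j]]]]]] // _; rewrite /Q /dihedral_Q.
- by rewrite sub1G.
- by rewrite cycle_subG msz; move: i15; clear mz ms msz;
    case: i => [|[|[|[|[|[|i]]]]]]; rewrite //= ?v_odd.
- by rewrite cycle_subG mz; move: i15; clear mz ms msz;
    case: i => [|[|[|[|[|[|i]]]]]]; rewrite //= ?v_odd.
- by rewrite cycle_subG ms; move: i15; clear mz ms msz;
    case: i => [|[|[|[|[|[|i]]]]]]; rewrite //= ?v_odd.
rewrite gen_subG subUset !sub1set ms mz.
by move: i15; clear mz ms msz; case: i => [|[|[|[|[|[|i]]]]]]; rewrite //= ?v_odd.
Qed.

Lemma dihedral_Q_sub_Q i j : (1 <= i <= 5)%N -> (1 <= j <= 5)%N ->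
  (Q j \subset Q i) = [|| j == 1, i == 5 | i == j]%N.
Proof.
move=> i15 j15; apply/idP/idP=> [sji|].
  by rewrite -dihedral_Q_sub_H // (subset_trans sji) // dihedral_QH.
case/or3P=> /eqP->; rewrite ?sub1G //.
have [s5 z5] : s \in Q 5 /\ z \in Q 5 by rewrite !mem_gen ?inE ?eqxx ?orbT.
case: j {j15} => [|[|[|[|[|j]]]]]; rewrite ?sub1G ?cycle_subG //.
by rewrite groupM.
Qed.

Lemma dihedral_H_sub_H i j : (1 <= i <= 5)%N -> (1 <= j <= 5)%N ->
  (H j \subset H i) = [|| j == 1, i == 5 | i == j]%N.
Proof.
by move=> i15 j15; rewrite join_subG dihedral_CH andbT dihedral_Q_sub_H.
Qed.

Lemma dihedral_H3 : H 3 = <[r]>%G.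
Proof.
apply/val_inj/setP=> x /=; apply/idP/idP.
  apply/subsetP; rewrite join_subG !cycle_subG !mem_cycle //.
case/cycleP=> u ->; have := memH 3 false u; rewrite mul1g => ->.
by [].
Qed.

Lemma dihedral_H5 : H 5 = G.
Proof.
apply/val_inj/eqP; rewrite eqEsubset dihedral_H_sub; apply/subsetP => x.
by case/(dihedral_elt hG)=> e [u ->]; rewrite memH.
Qed.

Lemma dihedral_C_odd x : x \in C -> ((2%N)^'.-elt x).
Proof.
case/cycleP=> u ->; apply: p_eltX.
rewrite /p_elt orderXgcd (dihedral_or v_ge3 hG) (gcdn_idPr _) ?dvdn_mulr //.
by rewrite mulKn // -odd_2'nat.
Qed.

Lemma dihedral_odd_C x : x \in G -> (2%N)^'.-elt x -> x \in C.
Proof.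
move=> Gx ox; have [e [u ex]] := dihedral_elt hG Gx.
have Cxx : x ^+ 2 \in C.
  rewrite ex expgS expg1; case: (e); last first.
    by rewrite !mul1g -expgD addnn -mul2n expgM mem_cycle.
  by rewrite expg1 (dihedral_srsr hG) group1.
have oddx : odd #[x] by rewrite odd_2'nat.
(* An element of odd order is a power of its square, and squares lie in C. *)
suff -> : x = (x ^+ 2) ^+ (#[x].+1./2) by rewrite groupX.
by rewrite -expgM mul2n even_halfK /= ?oddx // expgS expg_order mulg1.
Qed.

Lemma dihedral_C_norm : G \subset 'N(C).
Proof. by apply/subsetP=> x Gx; apply: (dihedral_r2_normed hG). Qed.

Lemma dihedral_Q5M : Q 5 = <[s]> * <[z]> :> {set gT}.
Proof.
rewrite /Q (dihedral_Q5E v r s) /= norm_joinEl //.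
rewrite cycle_subG inE -cycleJ.
by rewrite (dihedral_zs hG).
Qed.

Lemma dihedral_Q_2group i : (2%N).-group (Q i).
Proof.
have p2 (g : gT) : g != 1 -> g * g = 1 -> (2%N).-group <[g]>.
  by move=> ng gg; rewrite /pgroup -orderE dihedral_order2.
have ps : (2%N).-group <[s]>.
  have := dihedral_sr_neq1 v_ge3 hG 0; rewrite mulg1 => ns.
  by rewrite p2 ?(dihedral_ss hG).
have pz : (2%N).-group <[z]>.
  by rewrite p2 ?(dihedral_z_neq1 v_ge3 hG) ?(dihedral_zz hG).
have p5 : (2%N).-group (Q 5) by rewrite dihedral_Q5M pgroupM ps pz.
case: i => [|[|[|[|[|i]]]]] //; first exact: pgroup1.
by rewrite p2 ?(dihedral_sr_neq1 v_ge3 hG) ?(dihedral_srsr hG).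
Qed.

Lemma dihedral_C_2'group : (2%N)^'.-group C.
Proof. by have := dihedral_C_odd (cycle_id (r ^+ 2)). Qed.

Lemma odd_index_joinC (P : {group gT}) : P \subset G -> (2%N).-group P ->
  odd #|P <*> C : P|.
Proof.
move=> sPG pP; have nCP := subset_trans sPG dihedral_C_norm.
have tiPC : P :&: C = 1 by apply: coprime_TIg;
  apply: pnat_coprime pP dihedral_C_2'group.
rewrite -divgS ?joing_subl //= norm_joinEl // TI_cardMg // mulKn //.
by rewrite odd_2'nat; apply: dihedral_C_2'group.
Qed.

Lemma dihedral_Q5_cases x : x \in Q 5 -> [\/ x = 1, x = s, x = z | x = s * z].
Proof.
have os : #[s] = 2.
  by have := dihedral_sr_neq1 v_ge3 hG 0; rewrite mulg1 => ns;
    rewrite dihedral_order2 ?(dihedral_ss hG).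
have oz : #[z] = 2 by rewrite dihedral_order2 ?(dihedral_z_neq1 v_ge3 hG)
  ?(dihedral_zz hG).
rewrite dihedral_Q5M (cycle2g os) (cycle2g oz).
case/mulsgP=> a b /set2P[]-> /set2P[]-> ->; rewrite ?mulg1 ?mul1g.
- exact: Or41.
- exact: Or43.
- exact: Or42.
exact: Or44.
Qed.

Lemma dihedral_Q5_sylow : (2%N).-Sylow(G) (Q 5).
Proof.
rewrite pHallE sQG /=; apply/eqP.
have eG : Q 5 * C = G.
  rewrite -norm_joinEl; last exact: subset_trans (sQG 5) dihedral_C_norm.
  by have /(congr1 val) := dihedral_H5.
have tiQC : Q 5 :&: C = 1.
  by apply: coprime_TIg; apply: pnat_coprime (dihedral_Q_2group 5) dihedral_C_2'group.
have cG : #|G| = (#|Q 5| * #|C|)%N by rewrite -TI_cardMg ?eG.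
rewrite cG partnM // (part_pnat_id (dihedral_Q_2group 5)).
by rewrite (part_p'nat dihedral_C_2'group) muln1.
Qed.

(** Sylow's theorem conjugates P into the four-group [Q 5], whose subgroups are told apart by which
    of s, z and s z they contain. *)
Lemma dihedral_2subgroup (P : {group gT}) : P \subset G -> (2%N).-group P ->
  exists2 i, (1 <= i <= 5)%N & exists2 x, x \in G & P = (Q i :^ x)%G.
Proof.
move=> sPG pP; have [x Gx sPQx] := Sylow_subJ dihedral_Q5_sylow sPG pP.
have sPQ : P :^ x^-1 \subset Q 5 by rewrite sub_conjgV.
suff [i i15 ePQ] : exists2 i, (1 <= i <= 5)%N & P :^ x^-1 = Q i.
  by exists i => //; exists x => //; apply/val_inj; rewrite /= -ePQ conjsgKV.
have [Ps|nPs] := boolP (s \in P :^ x^-1); have [Pz|nPz] := boolP (z \in P :^ x^-1).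
- exists 5%N => //; apply/eqP; rewrite eqEsubset sPQ.
  by rewrite gen_subG subUset !sub1set Ps Pz.
- exists 4%N => //; apply/eqP; rewrite eqEsubset cycle_subG Ps andbT.
  apply/subsetP=> y Py; have [->|->|ey|ey] := dihedral_Q5_cases (subsetP sPQ y Py).
  - exact: group1.
  - exact: cycle_id.
  - by rewrite -ey Py in nPz.
  by rewrite -[z](mulKg s) -ey groupM ?groupV in nPz.
- exists 3%N => //; apply/eqP; rewrite eqEsubset cycle_subG Pz andbT.
  apply/subsetP=> y Py; have [->|ey|->|ey] := dihedral_Q5_cases (subsetP sPQ y Py).
  - exact: group1.
  - by rewrite -ey Py in nPs.
  - exact: cycle_id.
  by rewrite -[s](mulgK z) -ey groupM ?groupV in nPs.
have [Psz|nPsz] := boolP (s * z \in P :^ x^-1).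
  exists 2%N => //; apply/eqP; rewrite eqEsubset cycle_subG Psz andbT.
  apply/subsetP=> y Py; have [->|ey|ey|->] := dihedral_Q5_cases (subsetP sPQ y Py).
  - exact: group1.
  - by rewrite -ey Py in nPs.
  - by rewrite -ey Py in nPz.
  exact: cycle_id.
exists 1%N => //; apply/eqP; rewrite eqEsubset sub1G andbT.
apply/subsetP=> y Py; have [->|ey|ey|ey] := dihedral_Q5_cases (subsetP sPQ y Py).
- exact: group1.
- by rewrite -ey Py in nPs.
- by rewrite -ey Py in nPz.
by rewrite -ey Py in nPsz.
Qed.

(** C and [H i] are normal, so the conjugation disappears after joining with C. *)
Lemma dihedral_2subgroup_join (P : {group gT}) : P \subset G -> (2%N).-group P ->
  exists2 i, (1 <= i <= 5)%N & (P <*> C)%G = H i.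
Proof.
move=> sPG pP; have [i i15 [x Gx eP]] := dihedral_2subgroup sPG pP.
exists i => //; apply/val_inj; rewrite /= eP /=.
rewrite -{1}(normP (subsetP dihedral_C_norm x Gx)) -conjYg.
exact: (normP (subsetP (dihedral_H_norm i) x Gx)).
Qed.

Lemma dihedral_Q_card : [/\ #|Q 1| = 1, #|Q 2| = 2, #|Q 3| = 2,
  #|Q 4| = 2 & #|Q 5| = 4]%N.
Proof.
have ns : s != 1 by have := dihedral_sr_neq1 v_ge3 hG 0; rewrite mulg1.
have os : #[s] = 2 by rewrite dihedral_order2 ?(dihedral_ss hG).
have oz : #[z] = 2 by rewrite dihedral_order2 ?(dihedral_z_neq1 v_ge3 hG)
  ?(dihedral_zz hG).
split; rewrite -?orderE ?cards1 //.
  by rewrite dihedral_order2 ?(dihedral_sr_neq1 v_ge3 hG) ?(dihedral_srsr hG).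
rewrite dihedral_Q5M TI_cardMg -?orderE ?os ?oz //.
apply/trivgP/subsetP=> x /setIP[] /=; rewrite (cycle2g os) (cycle2g oz).
case/set2P=> ->; first by rewrite group1.
case/set2P=> [->|esz]; first by rewrite group1.
by have := dihedral_s_notin v_ge3 hG; rewrite esz mem_cycle.
Qed.

Lemma card_dihedral_H i : #|H i| = (#|Q i| * v)%N.
Proof.
have tiQC : Q i :&: C = 1.
  by apply: coprime_TIg; apply: pnat_coprime (dihedral_Q_2group i) dihedral_C_2'group.
rewrite /= norm_joinEl; last exact: subset_trans (sQG i) dihedral_C_norm.
rewrite TI_cardMg // -[#|C|]/#[r ^+ 2] orderXdiv (dihedral_or v_ge3 hG) ?dvdn_mulr //.
by rewrite mulKn.
Qed.

Lemma dihedral_H_index i : #|G : H i| = (4 %/ #|Q i|)%N.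
Proof.
have v_gt0 : (0 < v)%N by apply: leq_trans v_ge3.
rewrite -divgS ?dihedral_H_sub // card_dihedral_H (card_dihedral_presented v_ge3 hG).
by rewrite divnMr.
Qed.

Lemma dihedral_p_subgroup_reps :
  p_subgroup_reps 2 G [seq Q i | i <- [:: 1; 2; 3; 4; 5]%N].
Proof.
split.
- apply/allP=> _ /mapP[i _ ->]; apply/andP; split;
    [exact: sQG | exact: dihedral_Q_2group].
- rewrite -map_comp map_inj_in_uniq // => i j i15 j15 /= eQ.
  have r15 l : l \in [:: 1; 2; 3; 4; 5]%N -> (1 <= l <= 5)%N by rewrite !inE;
    case: l => [|[|[|[|[|[|l]]]]]].
  (* [H b] is normal, so it contains all conjugates of [Q b]; applied both ways this forces the two
     indices to coincide. *)
  have subQ a b : Q a :^: G = Q b :^: G -> Q a \subset H b.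
    move=> eab; have: gval (Q a) \in Q b :^: G.
      by rewrite -eab; apply/imsetP; exists 1; rewrite ?conjsg1.
    case/imsetP=> x Gx ->; rewrite -(normP (subsetP (dihedral_H_norm b) x Gx)).
    by rewrite conjSg dihedral_QH.
  have := subQ _ _ eQ; have := subQ _ _ (esym eQ).
  by rewrite !dihedral_Q_sub_H ?r15 //; lia.
- move=> P sPG pP; have [i i15 [x Gx ->]] := dihedral_2subgroup sPG pP.
  exists (Q i); last by apply/imsetP; exists x.
  by apply/mapP; exists i; case: i i15 => [|[|[|[|[|[|i]]]]]].
by have [q1 q2 q3 q4 q5] := dihedral_Q_card; rewrite /= q1 q2 q3 q4 q5.
Qed.

End DihedralSubgroups.

(** * Column labels: 2'-classes of the normalizer quotients *)

Section DihedralColumns.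

Local Open Scope group_scope.

Variables (v : nat) (gT : finGroupType) (G : {group gT}) (r s : gT).
Hypotheses (v_ge3 : (3 <= v)%N) (v_odd : odd v).
Hypothesis hG : dihedral_presented v G r s.

Let Q := dihedral_Q v r s.
Let C : {group gT} := <[r ^+ 2]>%G.
Let z := r ^+ v.
Let sQG i : Q i \subset G := dihedral_Q_sub hG i.

Lemma dihedral_QC_TI i : Q i :&: C = 1.
Proof.
apply: coprime_TIg; apply: pnat_coprime (dihedral_Q_2group v_ge3 hG i) _.
exact: (dihedral_C_2'group v_ge3 v_odd hG).
Qed.

Lemma dihedral_Xr2_eq a b :
  (r ^+ (2 * a) == r ^+ (2 * b)) = (a == b %[mod v]).
Proof. by rewrite (dihedral_rX_eq v_ge3 hG) -!muln_modr eqn_pmul2l. Qed.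

Lemma dihedral_Xr2_class a b :
  (r ^+ (2 * a) \in r ^+ (2 * b) ^: G) = eq_sign_mod v a b.
Proof.
have sE c : r ^+ (2 * c) ^ s = r ^- (2 * c) := dihedral_rXs hG _.
have rE c u : r ^+ c ^ (r ^+ u) = r ^+ c.
  by rewrite conjgE -!expgD addnC expgD mulKg.
have negE : (r ^+ (2 * a) == r ^- (2 * b)) = (v %| a + b)%N.
  rewrite eq_sym eq_invg_mul -expgD -mulnDr addnC.
  by have := dihedral_Xr2_eq (a + b) 0; rewrite muln0 expg0 mod0n.
apply/imsetP/orP=> [[x /(dihedral_elt hG)[e [u ->]] eab]|].
  rewrite conjgM in eab; case: e eab => /=; last first.
    by rewrite conjg1 rE => /eqP; rewrite dihedral_Xr2_eq; left.
  rewrite expg1 sE conjVg rE => /eqP; rewrite negE; by right.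
case=> [ab|ab].
  exists 1; rewrite ?group1 // conjg1; apply/eqP.
  by rewrite dihedral_Xr2_eq.
exists s; first exact: dihedral_s hG.
by rewrite sE; apply/eqP; rewrite negE.
Qed.

(** [Q i] contains a reflection q, which inverts c. The commutator of q and c is then c^2; it lies
    in [Q i] and in C, so it is 1, and c has odd order. *)
Lemma dihedral_norm_Q_trivial i c : i \in [:: 2; 4; 5]%N ->
  c \in C -> c \in 'N(Q i) -> c = 1.
Proof.
move=> i245 Cc nQc; have /cycleP[u eu] := Cc; rewrite -expgM in eu.
have [b Qb] : exists b, s * r ^+ (v * b) \in Q i.
  move: i245; rewrite !inE => /or3P[]/eqP->.
  - by exists 1%N; rewrite muln1 cycle_id.
  - by exists 0%N; rewrite muln0 mulg1 cycle_id.
  by exists 0%N; rewrite muln0 mulg1 mem_gen // !inE eqxx.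
set q := s * _ in Qb.
have cq : c ^ q = c^-1.
  rewrite eu conjgM (dihedral_rXs hG) conjVg; congr (_^-1).
  by rewrite conjgE -!expgD addnC expgD mulKg.
have Qqc : q^-1 * q ^ c \in Q i by rewrite groupM ?groupV // memJ_norm.
have eqc : q^-1 * q ^ c = c * c.
  have -> : q ^ c = c^-1 * q * c by rewrite conjgE mulgA.
  by rewrite mulgA -conjgE conjVg cq invgK.
have Ccc : c * c \in C by rewrite groupM.
have cc1 : c * c = 1.
  have: c * c \in Q i :&: C by rewrite inE Ccc -eqc Qqc.
  by rewrite dihedral_QC_TI => /set1P.
apply/eqP; rewrite -order_eq1; have := dihedral_C_odd v_ge3 v_odd hG Cc.
rewrite /p_elt -odd_2'nat => odd_c.
have: (#[c] %| 2)%N by rewrite order_dvdn expgS expg1 cc1.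
by rewrite dvdn_divisors //= !inE => /orP[]/eqP e; rewrite e in odd_c *.
Qed.

Lemma dihedral_normG i : i \in [:: 1; 3]%N -> 'N_G(Q i) = G.
Proof.
rewrite !inE => /orP[]/eqP->; apply/setIidPl.
  exact: normal_norm (normal1 G).
rewrite /Q /=; apply/subsetP=> x Gx; rewrite (subsetP (cent_sub _)) //.
by rewrite cent_cycle; apply/cent1P/esym/(dihedral_z_comm hG).
Qed.

Lemma dihedral_column_labels j : (1 <= j <= 5)%N ->
  column_labels 2 G (Q j) (@dihedral_col v gT r j).
Proof.
move=> j15; pose n := dihedral_size v j.
have dichotomy : j \in [:: 1; 3]%N /\ n = v./2.+1 \/ j \in [:: 2; 4; 5]%N /\ n = 1%N.
  by rewrite /n; case: j j15 {n} => [|[|[|[|[|[|j]]]]]] //= _;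
    [left | right | left | right | right].
have Cc b : r ^+ (2 * b) \in C by rewrite expgM mem_cycle.
have cN b : (b < n)%N -> r ^+ (2 * b) \in 'N_G(Q j).
  case: dichotomy => [[j13 _] _|[_ ->]].
    by rewrite dihedral_normG // groupX ?(dihedral_r hG).
  by rewrite ltnS leqn0 => /eqP->; rewrite group1.
have c2' b : (2%N)^'.-elt (r ^+ (2 * b)) by apply:
  (dihedral_C_odd v_ge3 v_odd hG (Cc b)).
have sNN : 'N_G(Q j) \subset 'N(Q j) := subsetIr _ _.
have cNQ b : (b < n)%N -> r ^+ (2 * b) \in 'N(Q j).
  by move/cN; apply: (subsetP sNN).
split=> [b|]; first by split; [apply: cN (ltn_ord b) | apply: c2'].
split=> [b|b b' ebb|_ /morphimP[y nQy Ny ->] oy].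
- split; first by apply/mem_quotient/cN/ltn_ord.
  by apply: morph_p_elt; [apply: cNQ (ltn_ord b) | apply: c2'].
- apply/val_inj => /=; case: dichotomy => [[j13 ej]|[_ ej]]; last first.
    have b0 (a : 'I_n) : a = 0%N :> nat.
      by apply/eqP; rewrite -leqn0 -ltnS -ej ltn_ord.
    by rewrite (b0 b) (b0 b').
  have lt_half (a : 'I_n) : (a < v./2.+1)%N by rewrite -ej.
  apply: (half_eq v_odd (lt_half b) (lt_half b')).
  rewrite -dihedral_Xr2_class.
  have : coset (Q j) (r ^+ (2 * b)) \in coset (Q j) (r ^+ (2 * b')) ^:
    ('N_G(Q j) / Q j).
    by rewrite -ebb class_refl.
  case/imsetP=> _ /morphimP[x nQx Nx ->] /=.
  rewrite -morphJ ?(cNQ _ (ltn_ord b')) // => ecos.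
  rewrite dihedral_normG // in Nx.
  have Ccx : r ^+ (2 * b') ^ x \in C.
    by rewrite memJ_norm ?Cc // (subsetP (dihedral_C_norm hG)).
  (* Two elements of C with the same image modulo [Q j] are equal, because their quotient lies in
     both [Q j] and C. *)
  apply/imsetP; exists x => //; apply/eqP; rewrite eq_mulgV1; apply/eqP/set1P.
  rewrite -[[set 1]]/(1 : {set gT}) -(dihedral_QC_TI j) inE.
  rewrite [X in _ && X]groupM ?groupV // andbT.
  rewrite -mem_rcoset; apply/rcoset_kercosetP => //.
    exact: cNQ (ltn_ord b).
  by rewrite groupJ // cNQ ?ltn_ord.
(* The image of y is a 2'-element, so the 2'-part of y has the same image; and that part lies in
   C. *)
pose y' := y.`_(2%N)^'.
have ey : coset (Q j) y = coset (Q j) y' by rewrite morph_constt // constt_p_elt.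
have [Gy' nQy'] : y' \in G /\ y' \in 'N(Q j) by case/setIP: Ny => Gy _;
  rewrite !groupX.
have Cy' : y' \in C by apply: (dihedral_odd_C hG); rewrite ?p_elt_constt.
case: dichotomy => [[j13 ej]|[j245 ej]]; last first.
  have size1 : (0 < dihedral_size v j)%N by rewrite -/n ej.
  exists (Ordinal size1); rewrite /dihedral_col /= muln0 expg0 morph1 ey.
  by rewrite (dihedral_norm_Q_trivial j245 Cy') // morph1 class_refl.
have /cycleP[u eu] := Cy'; rewrite -expgM in eu.
have [b lt_b] := half_ex v_odd u; rewrite -ej in lt_b.
rewrite -dihedral_Xr2_class -eu => /imsetP[x Gx eyx].
have Nx : x \in 'N_G(Q j) by rewrite dihedral_normG.
exists (Ordinal lt_b); rewrite /dihedral_col /= ey eyx morphJ ?cNQ //; last first.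
  exact: (subsetP sNN).
by rewrite memJ_class // mem_quotient.
Qed.

End DihedralColumns.

(** * Modules with a simple socle *)

Section SimpleSocle.

Variables (F : fieldType) (gT : finGroupType) (G : {group gT}).

Definition submodule_pred n (rN : mx_representation F G n) (S : 'rV[F]_n -> Prop) :=
  [/\ forall x y, S x -> S y -> S (x + y), forall a x, S x -> S (a *: x)
    & {in G, forall g x, S x -> S (x *m rN g)}].

Lemma submodule_pred_ker m n (rM : mx_representation F G m)
    (rN : mx_representation F G n) A :
  intertwines G rM rN A -> submodule_pred rM (fun x => x *m A = 0).
Proof.
move=> hA; split=> [x y Sx Sy|a x Sx|g Gg x Sx].
- by rewrite mulmxDl Sx Sy addr0.
- by rewrite -scalemxAl Sx scaler0.
by rewrite -mulmxA hA // mulmxA Sx mul0mx.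
Qed.

(* The nonzero vectors of S0 span the same line, and they lie in every        *)
(* nonzero submodule: rN has a simple socle.                                  *)
Definition simple_socle n (rN : mx_representation F G n) (S0 : 'rV[F]_n -> Prop)
    (x0 : 'rV[F]_n) (d : 'cV[F]_n) :=
  [/\ S0 x0, x0 *m d = 1%:M, forall x, S0 x -> x = (x *m d) 0 0 *: x0
    & forall S, submodule_pred rN S ->
        forall x, S x -> x != 0 -> exists y, [/\ S y, S0 y & y != 0]].

Variables (n : nat) (rN : mx_representation F G n).
Variables (S0 : 'rV[F]_n -> Prop) (x0 : 'rV[F]_n) (d : 'cV[F]_n).
Hypothesis socN : simple_socle rN S0 x0 d.

Lemma socle_neq0 : x0 != 0.
Proof.
case: socN => _ x0d _ _; apply: contra_eq_neq x0d => ->.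
by rewrite mul0mx eq_sym -(scalemx1 1) scaler_eq0 negb_or oner_eq0 /= matrix_nonzero1.
Qed.

Lemma socle_mem S x : submodule_pred rN S -> S x -> x != 0 -> S x0.
Proof.
case: socN => _ _ gen ex smS Sx nzx; have [y [Sy S0y nzy]] := ex S smS x Sx nzx.
have ey := gen y S0y; have [_ SZ _] := smS.
have nza : (y *m d) 0 0 != 0.
  by apply: contra_neq nzy => a0; rewrite ey a0 scale0r.
have -> : x0 = ((y *m d) 0 0)^-1 *: y by rewrite [X in _ =
  _ *: X]ey scalerA mulVf ?scale1r.
exact: SZ.
Qed.

(** The kernel of the projection to one summand contains the other. If both were nonzero, [x0] would
    lie in both kernels and hence be 0. *)
Lemma socle_indecomposable : indecomposable rN.
Proof.
have nz0 := socle_neq0; split.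
  by rewrite lt0n; apply: contra_neq nz0 => n0; apply/matrixP=> i [j lt_jn];
    exfalso; rewrite n0 in lt_jn.
move=> l m rU rV [X [Y [XY YX hX]]].
have hl : intertwines G rN rU (lsubmx X).
  move=> x Gx; have := hX x Gx; rewrite -{1 2}[X]hsubmxK /= mul_row_block.
  by rewrite !mulmx0 addr0 add0r mul_mx_row => /eq_row_mx[].
have hr : intertwines G rN rV (rsubmx X).
  move=> x Gx; have := hX x Gx; rewrite -{1 2}[X]hsubmxK /= mul_row_block.
  by rewrite !mulmx0 addr0 add0r mul_mx_row => /eq_row_mx[].
move: YX; rewrite -{1}[Y]vsubmxK -{1}[X]hsubmxK mul_col_row (scalar_mx_block l m).
case/eq_block_mx=> ul ur dl dr.
have in_ker k q (rW : mx_representation F G q) (A : 'M_(k, n)) A' B :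
    intertwines G rN rW B -> A *m B = 0 -> A *m A' = 1%:M -> k = 0%N \/ x0 *m B = 0.
  case: k A A' => [|k] A A' hB AB AA'; [by left | right].
  apply: (@socle_mem _ (row ord0 A) (submodule_pred_ker hB)).
    by rewrite -row_mul AB row0.
  apply: contra_eq_neq AA' => A0; apply/eqP=> /(congr1 (row ord0)).
  rewrite row_mul A0 mul0mx => /rowP/(_ ord0)/eqP.
  by rewrite !mxE eqxx eq_sym oner_eq0.
have [|x0r] := in_ker _ _ _ _ _ _ hr ur ul; first by left.
have [|x0l] := in_ker _ _ _ _ _ _ hl dl dr; first by right.
case/eqP: nz0; rewrite -[x0]mulmx1 -XY mulmxA -[X]hsubmxK mul_mx_row.
by rewrite x0l x0r row_mx0 mul0mx.
Qed.

(** The kernel of the endomorphism [A *m B] does not contain [x0], so it is 0; correct [B] by the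
    inverse of [A *m B]. *)
Lemma socle_retract m (rM : mx_representation F G m) A B :
    intertwines G rN rM A -> intertwines G rM rN B ->
    x0 *m A *m B *m d != 0 ->
  retract rN rM.
Proof.
move=> hA hB nzAB.
have hAB : intertwines G rN rN (A *m B).
  by move=> x Gx; rewrite mulmxA hA // -!mulmxA hB.
have uAB : A *m B \in unitmx.
  rewrite -row_free_unit -kermx_eq0; apply/rowV0P=> x /sub_kermxP xAB.
  apply/eqP; apply: contraNT nzAB => nzx.
  have x0AB := socle_mem (submodule_pred_ker hAB) xAB nzx.
  by rewrite -(mulmxA x0) x0AB mul0mx.
exists A, (B *m invmx (A *m B)); split=> //; last by rewrite mulmxA mulmxV.
move=> x Gx; rewrite mulmxA hB // -!mulmxA; congr (_ *m _).
by apply: (canRL (mulKmx uAB)); rewrite mulmxA -hAB // -mulmxA mulmxV // mulmx1.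
Qed.

End SimpleSocle.

Section DihedralModules.

Variables (F : fieldType) (v : nat) (gT : finGroupType) (G : {group gT}) (r s : gT).
Hypothesis char2 : 2%N \in [pchar F].
Hypotheses (v_ge3 : (3 <= v)%N) (v_odd : odd v).
Hypothesis hG : dihedral_presented v G r s.

Let C : {group gT} := <[r ^+ 2]>%G.
Let Gr : r \in G := dihedral_r hG.
Let Gs : s \in G := dihedral_s hG.
Let GrX u : (r ^+ u)%g \in G. Proof. exact: groupX. Qed.
Let GrV : r^-1%g \in G. Proof. by rewrite groupV. Qed.

Lemma oppr_char2 (V : lmodType F) (x : V) : - x = x.
Proof. by rewrite -scaleN1r (oppr_pchar2 char2) scale1r. Qed.

Lemma addr_char2_eq0 (V : lmodType F) (x y : V) : x + y = 0 -> x = y.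
Proof. by move/eqP; rewrite addr_eq0 oppr_char2 => /eqP. Qed.

Section Representation.

Variables (n : nat) (rN : mx_representation F G n).

Lemma dihedral_repr_s (x : 'rV_n) :
  (x *m rN s *m rN r = x *m rN r^-1%g *m rN s)
  /\ x *m rN r *m rN s = x *m rN s *m rN r^-1%g.
Proof.
rewrite -!mulmxA -!repr_mxM //; split; congr (_ *m rN _).
  by have := dihedral_sru hG 1; rewrite expg1.
by rewrite conjgC (dihedral_rs hG).
Qed.

Lemma dihedral_repr_sX (x : 'rV_n) u :
  x *m rN s *m rN (r ^+ u)%g = x *m rN (r ^- u)%g *m rN s.
Proof.
by rewrite -!mulmxA -!repr_mxM ?groupV // (dihedral_sru hG).
Qed.

Lemma eigenvector_reprV (g : gT) (x : 'rV_n) a : g \in G -> a != 0 ->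
  x *m rN g = a *: x -> x *m rN g^-1%g = a^-1 *: x.
Proof.
move=> Gg nza xg; have ex : x = a^-1 *:
  (x *m rN g) by rewrite xg scalerA mulVf ?scale1r.
by rewrite {1}ex -scalemxAl -mulmxA -repr_mxM ?groupV // mulgV repr_mx1 mulmx1.
Qed.

Lemma eigenvector_reprX (g : gT) (x : 'rV_n) a u : g \in G ->
  x *m rN g = a *: x -> x *m rN (g ^+ u)%g = a ^+ u *: x.
Proof.
move=> Gg xg; elim: u => [|u IHu]; first by rewrite repr_mx1 mulmx1 scale1r.
by rewrite expgSr repr_mxM ?groupX // mulmxA IHu -scalemxAl xg scalerA exprSr.
Qed.

Lemma mulmx_repr_eq0 (g : gT) (x : 'rV_n) : g \in G -> (x *m rN g == 0) = (x == 0).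
Proof.
move=> Gg; apply/eqP/eqP=> [xg0|->]; last by rewrite mul0mx.
by rewrite -[x]mulmx1 -(repr_mx1 rN) -(mulgV g) repr_mxM ?groupV // mulmxA xg0 mul0mx.
Qed.

End Representation.

(** * Modules induced from a nontrivial character of <r^2> or <r> *)

Section NonprincipalBlock.

Variables (K : {group gT}) (rK : mx_representation F K 1) (mu : F).
Hypotheses (sKr : K \subset <[r]>%g) (sCK : C \subset K).
Hypothesis rKE : forall u, (r ^+ u)%g \in K -> rK (r ^+ u)%g = (mu ^+ u)%:M.
Hypotheses (mu_v : mu ^+ v = 1).
Variables (n : nat) (rN : mx_representation F G n) (e : 'rV[F]_n) (d : 'cV[F]_n).
Hypothesis iN : induced_via rK rN e d.

Let nz_mu : mu != 0.
Proof.
apply: contra_eq_neq mu_v => ->.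
by rewrite expr0n; case: (v) v_ge3 => //= *; rewrite eq_sym oner_eq0.
Qed.

Let sKG : K \subset G.
Proof. by apply: subset_trans sKr _; rewrite cycle_subG. Qed.

Let C2 u : (r ^+ (2 * u))%g \in K.
Proof. by apply: (subsetP sCK); rewrite expgM mem_cycle. Qed.

Let e_r2 : e *m rN (r ^+ 2)%g = mu ^+ 2 *: e.
Proof. by rewrite (induced_l iN) ?rKE ?(C2 1) // mul_scalar_mx. Qed.

Let r2_d : rN (r ^+ 2)%g *m d = mu ^+ 2 *: d.
Proof. by rewrite (induced_r iN) ?rKE ?(C2 1) // mul_mx_scalar. Qed.

Lemma induced_eq0 m (A : 'M_(n, m)) :
  {in G, forall t, e *m rN t *m A = 0} -> A = 0.
Proof.
move=> eA; rewrite -[A]mul1mx -(induced_sum iN) mulmx_suml big1 // => B.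
case/(mem_repr_rcosets sKG)=> GB _.
by rewrite /conj_mx -!mulmxA (mulmxA e) eA // !mulmx0.
Qed.

Lemma coinduced_eq0 (x : 'rV_n) :
  {in G, forall t, x *m rN t *m d = 0} -> x = 0.
Proof.
move=> xd; rewrite -[x]mulmx1 -(induced_sum iN) mulmx_sumr big1 // => B.
case/(mem_repr_rcosets sKG)=> GB _.
by rewrite /conj_mx !mulmxA xd ?groupV // !mul0mx.
Qed.

(** The translates of [e] generate the module, and each is an eigenvector of r^2 with eigenvalue
    mu^2 or, after s, mu^-2. *)
Lemma monomial_quadratic (x : 'rV_n) :
  x *m rN (r ^+ 2)%g *m rN (r ^+ 2)%g + x
    = (mu ^+ 2 + mu ^- 2) *: (x *m rN (r ^+ 2)%g).
Proof.
pose R2 := rN (r ^+ 2)%g; pose A := R2 *m R2 + 1%:M - (mu ^+ 2 + mu ^- 2) *: R2.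
have AE (y : 'rV_n) : y *m A = y *m R2 *m R2 + y - (mu ^+ 2 + mu ^- 2) *: (y *m R2).
  by rewrite /A mulmxBr mulmxDr mulmx1 mulmxA -scalemxAr.
suff A0 : A = 0 by apply/eqP; rewrite -subr_eq0 -AE A0 mulmx0.
have quad (a : F) (y : 'rV_n) : a != 0 -> y *m R2 = a *: y ->
    y *m R2 *m R2 + y - (a + a^-1) *: (y *m R2) = 0.
  move=> nza ey; apply/eqP; rewrite subr_eq0; apply/eqP.
  rewrite ey -scalemxAl ey !scalerA mulrDl mulVf // scalerDl.
  by rewrite scale1r.
apply: induced_eq0 => t Gt; rewrite AE.
have [b [u ->]] := dihedral_elt hG Gt.
have comm (y : 'rV_n) : y *m rN (r ^+ u)%g *m R2 = y *m R2 *m rN (r ^+ u)%g.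
  by rewrite -!mulmxA -!repr_mxM // -!expgD addnC.
rewrite repr_mxM ?groupX // mulmxA; case: b.
  have -> : mu ^+ 2 + mu ^- 2 = mu ^- 2 + (mu ^- 2)^-1 by rewrite invrK addrC.
  apply: quad; first by rewrite invr_neq0 // expf_neq0.
  rewrite comm expg1 dihedral_repr_sX (eigenvector_reprV
    (GrX 2) _ e_r2) ?expf_neq0 //.
  by rewrite -!scalemxAl.
rewrite expg0 repr_mx1 mulmx1; apply: quad; rewrite ?expf_neq0 //.
by rewrite comm e_r2 -scalemxAl.
Qed.

Hypothesis mu_neq1 : mu != 1.

(** Otherwise mu^4 = 1; with mu^v = 1 and v odd this gives mu = 1. *)
Let mu4 : mu ^+ 2 != mu ^- 2.
Proof.
apply: contra_neq mu_neq1 => mu2.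
have mu4 : mu ^+ 4 = 1 by rewrite (exprD _ 2 2) {1}mu2 mulVf // expf_neq0.
have := mu_v; rewrite {1}(divn_eq v 4) exprD mulnC exprM mu4 expr1n mul1r.
have : odd (v %% 4) by rewrite odd_mod.
have: (v %% 4 < 4)%N by rewrite ltn_mod.
case: (v %% 4)%N => [|[|[|[|j]]]] //= _ _ mu3.
by have := mu4; rewrite exprSr mu3 mul1r.
Qed.

(** For r^2 the vector x s has eigenvalue mu^-2 and the column [d] has mu^2; these differ, so x s
    pairs to 0 with [d]. Then so do all translates of x, which are multiples of x or x s. *)
Lemma monomial_eigen_inj (x : 'rV_n) :
  x *m rN r = mu *: x -> x *m d = 0 -> x = 0.
Proof.
move=> xr xd; have xsd : x *m rN s *m d = 0.
  have: x *m rN s *m (rN (r ^+ 2)%g *m d) = mu ^- 2 *: (x *m rN s *m d).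
    rewrite mulmxA dihedral_repr_sX (eigenvector_reprV (GrX 2) _
      (eigenvector_reprX 2 Gr xr)) ?expf_neq0 //.
    by rewrite -!scalemxAl.
  rewrite r2_d -scalemxAr => /eqP; rewrite -subr_eq0 -scalerBl scaler_eq0 subr_eq0.
  by rewrite (negPf mu4) => /eqP.
apply: coinduced_eq0 => t; rewrite -groupV => /(dihedral_elt hG)[b [u et]].
rewrite -[t]invgK et {et}.
rewrite invMg repr_mxM ?groupV ?groupX // mulmxA.
rewrite (eigenvector_reprV (GrX u) _
  (eigenvector_reprX u Gr xr)) ?expf_neq0 // -!scalemxAl.
case: b; last by rewrite expg0 invg1 repr_mx1 mulmx1 xd scaler0.
by rewrite expg1 (dihedral_sV hG) xsd scaler0.
Qed.

(** By the quadratic relation x r^2 - mu^-2 x has r^2-eigenvalue mu^2; if it vanishes, x s has that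
    eigenvalue instead. From such a y, the vector y r + mu y is a mu-eigenvector of r, and if it
    vanishes then y is one, in characteristic 2. *)
Lemma monomial_eigen_ex (S : 'rV_n -> Prop) x : submodule_pred rN S -> S x ->
  x != 0 -> exists y, [/\ S y, y *m rN r = mu *: y & y != 0].
Proof.
move=> [SD SZ Sg] Sx nzx.
have [y [Sy ey nzy]] : exists y, [/\ S y, y *m rN (r ^+ 2)%g = mu ^+ 2 *: y & y != 0].
  pose y := x *m rN (r ^+ 2)%g - mu ^- 2 *: x.
  have [y0|nzy] := eqVneq y 0; last first.
    exists y; split=> //; first by apply: SD; [exact: Sg | rewrite -scaleNr;
      exact: SZ].
    rewrite /y mulmxBl -scalemxAl scalerBr scalerA mulfV ?expf_neq0 // scale1r.
    rewrite -[X in X - _ = _](addrK x) monomial_quadratic scalerDl.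
    by rewrite addrAC addrK.
  have xr2 : x *m rN (r ^+ 2)%g = mu ^- 2 *: x by apply/eqP; rewrite -subr_eq0 -/y y0.
  exists (x *m rN s); split; [exact: Sg | | by rewrite mulmx_repr_eq0].
  rewrite dihedral_repr_sX (eigenvector_reprV (GrX 2) _ xr2) ?invr_neq0 ?expf_neq0 //.
  by rewrite invrK -scalemxAl.
have [z0|nzz] := eqVneq (y *m rN r + mu *: y) 0.
  by exists y; split=> //; apply: addr_char2_eq0.
exists (y *m rN r + mu *: y); split=> //.
  by apply: SD; [exact: Sg | exact: SZ].
rewrite mulmxDl -mulmxA -repr_mxM // -[(r * r)%g]/(r ^+ 2)%g -scalemxAl ey
  scalerDr addrC.
by rewrite scalerA.
Qed.
(** For r outside K this averages x over 1 and r, twisted by mu, so as to turn a mu^2-eigenvector of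
    r^2 into a mu-eigenvector of r. It is stated for any module because it is applied both to [e]
    and to its image in M. *)
Definition monomial_socle m (rM : mx_representation F G m) (x : 'rV[F]_m) :=
  if r \in K then x else x + mu^-1 *: (x *m rM r).

Lemma monomial_simple_socle :
  simple_socle rN (fun x => x *m rN r = mu *: x) (monomial_socle rN e) d.
Proof.
have x0r : monomial_socle rN e *m rN r = mu *: monomial_socle rN e.
  rewrite /monomial_socle; case: ifP => [Kr|_].
    by rewrite (induced_l iN) // -[r]expg1 rKE ?expg1 // mul_scalar_mx.
  rewrite mulmxDl -scalemxAl -mulmxA -repr_mxM // -[(r * r)%g]/(r ^+ 2)%g e_r2.
  by rewrite scalerA expr2 mulKf // scalerDr scalerA mulfV // scale1r addrC.
have x0d : monomial_socle rN e *m d = 1%:M.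
  rewrite /monomial_socle; case: ifP => [_|/negbT nKr]; first exact: (induced_1 iN).
  by rewrite mulmxDl -scalemxAl (induced_0 iN) // scaler0 addr0 (induced_1 iN).
split=> // [x xr|S smS x Sx nzx]; last exact: monomial_eigen_ex smS Sx nzx.
apply/eqP; rewrite -subr_eq0; apply/eqP; apply: monomial_eigen_inj.
  by rewrite mulmxBl -scalemxAl x0r xr scalerBr !scalerA mulrC.
rewrite mulmxBl -scalemxAl x0d scalemx1.
by apply/matrixP=> i j; rewrite !ord1 !mxE eqxx mulr1n subrr.
Qed.

Hypothesis K_dichotomy : forall u, (r ^+ u)%g \in K -> r \in K \/ ~~ odd u.

(* Average any column dual to u over the odd-order group <[r ^+ 2]>, twisted by
   mu; the factor v is invertible in characteristic 2. *)
Lemma eigenvector_dual m (rM : mx_representation F G m) (u : 'rV_m) :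
    u != 0 -> u *m rM (r ^+ 2)%g = mu ^+ 2 *: u ->
  exists w : 'cV_m, [/\ rM (r ^+ 2)%g *m w = mu ^+ 2 *: w, u *m w = 1%:M
    & (forall y : 'rV_m, y *m rM (r ^+ 2)%g = mu ^+ 2 *: y -> y *m rM r = mu *: y) ->
      rM r *m w = mu *: w].
Proof.
move=> nzu ur2; pose R j := mu ^- (2 * j) *: rM (r ^+ (2 * j))%g.
have RS j : rM (r ^+ 2)%g *m R j = mu ^+ 2 *: R j.+1.
  rewrite /R -scalemxAr -repr_mxM // -expgD scalerA mulnS; congr (_ *: _).
  by rewrite exprD invfM mulrA mulfV ?expf_neq0 // mul1r.
have RC j : rM (r ^+ 2)%g *m R j = R j *m rM (r ^+ 2)%g.
  by rewrite /R -scalemxAr -scalemxAl -!repr_mxM // -!expgD addnC.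
have Rv : R v = R 0%N.
  by rewrite /R (dihedral_r2v hG) muln0 expg0 mulnC exprM mu_v expr1n.
pose P := \sum_(j < v) R j.
have r2P : rM (r ^+ 2)%g *m P = mu ^+ 2 *: P.
  rewrite mulmx_sumr (eq_bigr (fun j : 'I_v => mu ^+ 2 *: R j.+1)) => [|j _];
    last exact: RS.
  rewrite -scaler_sumr; congr (_ *: _).
  have v0 : (0 < v)%N by apply: leq_trans v_ge3.
  rewrite /P; case: (v) v0 Rv => // l _ Rl.
  by rewrite big_ord_recr big_ord_recl /= Rl addrC; congr (_ + _);
    apply: eq_bigr => j _.
have Pr2 : P *m rM (r ^+ 2)%g = mu ^+ 2 *: P.
  rewrite -r2P mulmx_sumr mulmx_suml; apply: eq_bigr => j _.
  by rewrite RC.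
have Pr : P *m rM r = rM r *m P.
  rewrite mulmx_sumr mulmx_suml; apply: eq_bigr => j _.
  by rewrite /R -scalemxAr -scalemxAl -!repr_mxM // -expgSr -expgS.
have uP : u *m P = u.
  rewrite mulmx_sumr (eq_bigr (fun=> u)) => [|j _].
    by rewrite sumr_const card_ord -[v]odd_double_half v_odd mulrS -muln2 mulrnA
      (mxMn_pchar char2) addr0.
  by rewrite /R -scalemxAr expgM (eigenvector_reprX j
    (GrX 2) ur2) -exprM scalerA mulVf ?scale1r // expf_neq0.
have [l nzul] : exists l, u 0 l != 0.
  apply/existsP; apply: contraNT nzu; rewrite negb_exists => /forallP u0.
  by apply/eqP/rowP=> l; rewrite mxE; apply/eqP; rewrite -[_ == _]negbK u0.
exists (P *m ((u 0 l)^-1 *: delta_mx l 0)); split.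
- by rewrite mulmxA r2P -scalemxAl.
- rewrite mulmxA uP -scalemxAr; apply/matrixP=> i j.
  by rewrite !ord1 -colE !mxE eqxx mulVf.
move=> hr; rewrite mulmxA -Pr [RHS]scalemxAl; congr (_ *m _).
apply/row_matrixP=> i; rewrite row_mul hr ?linearZ // -row_mul Pr2.
by rewrite linearZ.
Qed.

(** Frobenius reciprocity turns u and its dual column into maps to and from M, and the socle vector
    goes to [monomial_socle rM u], which pairs to 1 with the column. For r outside K, u r different
    from mu u makes this vector nonzero; for r in K, r must be the scalar mu on the whole eigenspace
    for the dual column to be an eigenvector of r as well. *)
Lemma monomial_retract m (rM : mx_representation F G m) (u : 'rV_m) :
    u != 0 -> u *m rM (r ^+ 2)%g = mu ^+ 2 *: u ->
    (if r \in K then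
       forall y : 'rV_m, y *m rM (r ^+ 2)%g = mu ^+ 2 *: y -> y *m rM r = mu *: y
     else u *m rM r != mu *: u) ->
  retract rN rM.
Proof.
move=> nzu ur2 hu.
have nzu' : monomial_socle rM u != 0.
  rewrite /monomial_socle; case: (r \in K) hu => // nu.
  apply: contra_neq nu => /addr_char2_eq0 eu.
  by rewrite {2}eu scalerA mulfV // scale1r.
have u'r2 : monomial_socle rM u *m rM (r ^+ 2)%g = mu ^+ 2 *: monomial_socle rM u.
  rewrite /monomial_socle; case: ifP => // _.
  rewrite mulmxDl ur2 scalerDr -scalemxAl -mulmxA -repr_mxM // -expgS expgSr.
  by rewrite repr_mxM // mulmxA ur2 -scalemxAl !scalerA mulrC.
have [w [r2w u'w rw]] := eigenvector_dual nzu' u'r2.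
have hU : {in K, forall h, u *m rM h = rK h *m u}.
  move=> h Kh; have /cycleP[j ej] := subsetP sKr h Kh; rewrite {}ej in Kh *.
  rewrite rKE // mul_scalar_mx; case: (K_dichotomy Kh) => [Kr|ev_j].
    by rewrite Kr in hu; apply: eigenvector_reprX (hu u ur2).
  by rewrite -(even_halfK ev_j) -mul2n expgM exprM; apply: eigenvector_reprX ur2.
have hV : {in K, forall h, rM h *m w = w *m rK h}.
  move=> h Kh; have /cycleP[j ej] := subsetP sKr h Kh; rewrite {}ej in Kh *.
  rewrite rKE // mul_mx_scalar.
  have eig (g : gT) a l : g \in G -> rM g *m w = a *: w -> rM (g ^+ l)%g *m w =
    a ^+ l *: w.
    move=> Gg gw; elim: l => [|l IHl]; first by rewrite repr_mx1 mul1mx scale1r.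
    by rewrite expgSr repr_mxM ?groupX // -mulmxA gw -scalemxAr IHl scalerA exprS.
  case: (K_dichotomy Kh) => [Kr|ev_j].
    by rewrite Kr in hu; apply: eig (rw hu).
  by rewrite -(even_halfK ev_j) -mul2n expgM exprM; apply: eig r2w.
have hA := induced_hom_l sKG iN hU; have hB := induced_hom_r sKG iN hV.
apply: (socle_retract monomial_simple_socle hA hB).
rewrite -mulmxA (induced_trace_r sKG iN).
have -> : monomial_socle rN e *m rtrace K rN rM (d *m u) = monomial_socle rM u.
  rewrite /monomial_socle; case: ifP => _; first by rewrite (induced_trace_l sKG iN).
  by rewrite mulmxDl -scalemxAl -mulmxA hA // mulmxA (induced_trace_l sKG iN).
by rewrite u'w -scalemx1 scaler_eq0 oner_eq0 /= matrix_nonzero1.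
Qed.

End NonprincipalBlock.

(** * Permutation modules on the cosets of a normal subgroup containing <r^2> *)

Section PrincipalBlock.

Variables (K : {group gT}) (rK : mx_representation F K 1).
Hypotheses (sKG : K \subset G) (sCK : C \subset K) (nKG : G \subset 'N(K)%g).
Hypothesis rK1 : {in K, forall h, rK h = 1%:M}.
Variables (n : nat) (rN : mx_representation F G n) (e : 'rV[F]_n) (d : 'cV[F]_n).
Hypothesis iN : induced_via rK rN e d.

Lemma induced_trivial_kernel : {in K, forall h, rN h = 1%:M}.
Proof.
move=> h Kh; apply: (induced_kernel sKG iN); first exact: (subsetP sKG).
move=> t Gt; have Kht : (h ^ t)%g \in K by rewrite memJ_norm // (subsetP nKG).
by rewrite rK1.
Qed.

(** The action factors through a 2-group, so every nonzero submodule has a nonzero fixed vector; and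
    a fixed vector is a multiple of the sum of all translates of [e]. *)
Lemma permutation_simple_socle :
  simple_socle rN (fun x => {in G, forall g,
    x *m rN g = x}) (rtrace K (triv_repr F G) rN e) d.
Proof.
have he : intertwines K (triv_repr F G) rN e.
  by move=> h Kh; rewrite mul1mx (induced_l iN) // rK1 // mul1mx.
have x0g := rtrace_intertwines sKG he.
have x0d : rtrace K (triv_repr F G) rN e *m d = 1%:M.
  rewrite /rtrace mulmx_suml (bigD1 _ (coset1_rcosets G K)) /= big1 => [|A].
    by rewrite addr0 /conj_mx repr_group mul1mx repr_mx1 mulmx1 (induced_1 iN).
  case/andP=> HA neA; rewrite /conj_mx mul1mx (induced_0 iN) //.
    by case: (mem_repr_rcosets sKG HA).
  exact: (repr_notin sKG HA neA).
split=> // [g Gg|x xg|S [SD SZ Sg] x Sx nzx].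
- by have := x0g g Gg; rewrite mul1mx.
- rewrite -{1}[x]mulmx1 -(induced_sum iN) mulmx_sumr /rtrace scaler_sumr.
  apply: eq_bigr => A /(mem_repr_rcosets sKG)[GA _].
  rewrite /conj_mx !mulmxA xg ?groupV // mul1mx scalemxAl; congr (_ *m _).
  rewrite {1}[x *m d]mx11_scalar mul_scalar_mx.
  by [].
have r2 (y : 'rV_n) : y *m rN r *m rN r = y.
  rewrite -mulmxA -repr_mxM // -[(r * r)%g]/(r ^+ 2)%g induced_trivial_kernel
    ?mulmx1 //.
  by rewrite (subsetP sCK) // cycle_id.
(* As r^2 acts trivially, x r + x is fixed by r; if it is 0, then x is already fixed, in
   characteristic 2. The same trick with s follows, and keeps the vector fixed by r. *)
have [y [Sy yr nzy]] : exists y, [/\ S y, y *m rN r = y & y != 0].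
  have [z0|nzz] := eqVneq (x *m rN r + x) 0.
    by exists x; split=> //; apply: addr_char2_eq0.
  exists (x *m rN r + x); split=> //; first by apply: SD => //; apply: Sg.
  by rewrite mulmxDl r2 addrC.
have [z [Sz zr zs nzz]] : exists z, [/\ S z, z *m rN r = z, z *m rN s = z & z != 0].
  have [z0|nzz] := eqVneq (y *m rN s + y) 0.
    by exists y; split=> //; apply: addr_char2_eq0.
  exists (y *m rN s + y); split=> //; first by apply: SD => //; apply: Sg.
    rewrite mulmxDl yr (dihedral_repr_s rN y).1; congr (_ *m _ + _).
    have := @eigenvector_reprV _ rN r y 1 Gr (oner_neq0 _);
      rewrite !scale1r invr1 scale1r.
    by apply.
  by rewrite mulmxDl -mulmxA -repr_mxM // (dihedral_ss hG) repr_mx1 mulmx1 addrC.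
exists z; split=> // g /(dihedral_elt hG)[b [u ->]].
have eX (h : gT) i : h \in G -> z *m rN h = z -> z *m rN (h ^+ i)%g = z.
  move=> Gh zh; have := @eigenvector_reprX _ rN h z 1 i Gh;
    rewrite expr1n !scale1r; exact.
by rewrite repr_mxM ?groupX // mulmxA !eX.
Qed.

End PrincipalBlock.

End DihedralModules.

(** X^v - 1 is the product of the X - z^i. If no z^j with 0 < j < v were an eigenvalue, all factors
    of the product at T except T - 1 would be invertible, so T = 1. *)
Lemma root_unity_eigenvector (F : fieldType) n (T : 'M[F]_n.+1) v z :
    v.-primitive_root z -> T ^+ v = 1 -> T != 1 ->
  exists j (u : 'rV_n.+1), [/\ (0 < j < v)%N, u != 0 & u *m T = z ^+ j *: u].
Proof.
move=> prim_z TXv nT1; have v_gt0 := prim_order_gt0 prim_z.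
have [/existsP[j /andP[j_gt0 /eigenvalueP[u uT nzu]]]|] :=
    boolP [exists j : 'I_v, (0 < j)%N && eigenvalue T (z ^+ j)].
  by exists j, u; rewrite j_gt0 ltn_ord.
rewrite negb_exists => /forallP nev; case/eqP: nT1.
have U : \prod_(1 <= i < v) (T - (z ^+ i)%:M) \is a GRing.unit.
  rewrite big_nat; apply: rpred_prod => i /andP[i_gt0 lt_iv].
  have := nev (Ordinal lt_iv); rewrite i_gt0 /= /eigenvalue negbK => /eqP ker0.
  suff: T - (z ^+ i)%:M \in unitmx by [].
  by rewrite -row_free_unit -kermx_eq0 -/(eigenspace T _) ker0.
have: horner_mx T (\prod_(0 <= i < v) ('X - (z ^+ i)%:P)) = 0.
  by rewrite factor_Xn_sub_1 // rmorphB rmorphXn /= horner_mx_X TXv rmorph1 subrr.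
rewrite big_ltn // rmorphM rmorph_prod /= rmorphB /= horner_mx_X horner_mx_C.
under eq_bigr do rewrite rmorphB /= horner_mx_X horner_mx_C.
by move/(canRL (mulrK U)); rewrite mul0r => /eqP; rewrite subr_eq0 => /eqP.
Qed.

(** * Characters of a cyclic group and the reduction of roots of unity *)

Section DiscreteLog.

Variables (gT : finGroupType) (R : nzRingType).

(* Junk value 0 when x is not a power of r. *)
Definition discrete_log (r x : gT) : nat :=
  odflt 0%N (omap val [pick u : 'I_#[r]%g | (r ^+ u)%g == x]).

Definition cycle_char (r : gT) (z : R) (x : gT) : R := z ^+ discrete_log r x.

Lemma cycle_charX r z u : z ^+ #[r]%g = 1 -> cycle_char r z (r ^+ u)%g = z ^+ u.
Proof.
move=> zr; rewrite /cycle_char /discrete_log; case: pickP => [i /eqP eiu|nlog] /=.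
  move/eqP: eiu; rewrite eq_expg_mod_order => /eqP eiu.
  by rewrite -(expr_mod i zr) eiu expr_mod.
have lt_u := ltn_pmod u (order_gt0 r).
by have := nlog (Ordinal lt_u); rewrite /= expg_mod_order eqxx.
Qed.

Lemma cycle_char1 r x : cycle_char r 1 x = 1.
Proof. exact: expr1n. Qed.

Lemma cycle_charM r z : z ^+ #[r]%g = 1 ->
  {in <[r]>%g &, {morph cycle_char r z : x y / (x * y)%g >-> x * y}}.
Proof.
move=> zr _ _ /cycleP[i ->] /cycleP[j ->].
by rewrite -expgD !cycle_charX // exprD.
Qed.

End DiscreteLog.

Section Modular2.

Variables (O : idomainType) (K : fieldType) (k : closedFieldType).
Variables (inj : {rmorphism O -> K}) (red : {rmorphism O -> k}).
Hypothesis hms : modular_system 2 inj red.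

Let char2 : 2%N \in [pchar k] := ms_charp hms.

Lemma odd_natr_neq0 m : odd m -> m%:R != 0 :> k.
Proof. by move=> odd_m; rewrite -(dvdn_pcharf char2) dvdn2 odd_m. Qed.

(** If the reduction of o has order m, then o^(2m) is a v-th root of unity reducing to 1, hence
    equal to 1 as v is odd; so 2v divides 2m. *)
Lemma red_primitive_root v w (o : O) : odd v -> (2 * v).-primitive_root w ->
  inj o = w -> o ^+ v = -1 /\ v.-primitive_root (red o).
Proof.
move=> odd_v prim_w ew; have injI := ms_inj hms.
have ov : o ^+ v = -1.
  have: o ^+ v ^+ 2 = 1.
    by apply: injI; rewrite -exprM mulnC rmorphXn ew (prim_expr_order prim_w) rmorph1.
  move/eqP; rewrite sqrf_eq1 => /orP[/eqP o1|/eqP //].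
  have: (2 * v %| v)%N by rewrite (prim_order_dvd prim_w) -ew -rmorphXn o1 rmorph1.
  by case: (v) odd_v => // l _; move/dvdn_leq => /(_ isT); lia.
split=> //; have rov : red o ^+ v = 1.
  by rewrite -rmorphXn ov rmorphN1 (oppr_pchar2 char2).
have v_gt0 : (0 < v)%N by case: (v) odd_v.
have [m prim_m dvd_mv] := prim_order_exists v_gt0 rov.
suff -> : v = m by [].
apply/eqP; rewrite eqn_dvd dvd_mv andbT -(@dvdn_pmul2l 2) //.
rewrite (prim_order_dvd prim_w) -ew -rmorphXn -[X in _ == X](rmorph1 inj).
rewrite (inj_eq injI) exprM; apply/eqP.
apply: (red_unity_inj (red := red) (odd_natr_neq0 odd_v)).
- rewrite -!exprM [(_ * _)%N](_ : _ = v * (2 * m))%N; last by lia.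
  by rewrite exprM ov exprM sqrrN !expr1n.
- exact: expr1n.
have -> : red (o ^+ 2 ^+ m) = red o ^+ m ^+ 2 by rewrite !rmorphXn /= -!exprM mulnC.
by rewrite (prim_expr_order prim_m) expr1n rmorph1.
Qed.

End Modular2.

(** In a four-group, a subgroup not inside another one is separated from it by a subgroup of index
    2: here [H l] contains [H i] but not [Q j]. *)
Lemma separating_index i j : (1 <= i <= 5)%N -> (1 <= j <= 5)%N ->
    ~~ [|| j == 1, i == 5 | i == j]%N ->
  exists l, [/\ (1 <= l <= 5)%N, l \in [:: 2; 3; 4]%N,
    [|| i == 1, l == 5 | l == i]%N & ~~ [|| j == 1, l == 5 | l == j]%N].
Proof.
case: i => [|[|[|[|[|[|i]]]]]] //= _; case: j => [|[|[|[|[|[|j]]]]]] //= _ _;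
  first [by exists 2%N | by exists 3%N | by exists 4%N].
Qed.

(** * The modules of the table, their vertices and characters *)

Section DihedralTable.

Variables (O : idomainType) (K : fieldType) (k : closedFieldType).
Variables (inj : {rmorphism O -> K}) (red : {rmorphism O -> k}).
Hypothesis hms : modular_system 2 inj red.
Variables (v : nat) (gT : finGroupType) (G : {group gT}) (r s : gT).
Hypotheses (v_ge3 : (3 <= v)%N) (v_odd : odd v).
Hypothesis hG : dihedral_presented v G r s.
Variables (w : K) (o : O).
Hypotheses (prim_w : (2 * v).-primitive_root w) (ow : inj o = w).
Variable chi : nat -> gT -> K.
Hypothesis hchi : dihedral_characters v G r s w chi.

Let Q := dihedral_Q v r s.
Let H := dihedral_H v r s.
Let C : {group gT} := <[r ^+ 2]>%G.
Let char2 : 2%N \in [pchar k] := ms_charp hms.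
Let sQG i : Q i \subset G := dihedral_Q_sub hG i.
Let sHG i : H i \subset G := dihedral_H_sub hG i.
Let nHG i : G \subset 'N(H i)%g := dihedral_H_norm v_ge3 v_odd hG i.
Let Gr : r \in G := dihedral_r hG.
Let Gs : s \in G := dihedral_s hG.
Let injI := ms_inj hms.

Let ov : o ^+ v = -1.
Proof. by case: (red_primitive_root hms v_odd prim_w ow). Qed.

Let prim_ro : v.-primitive_root (red o).
Proof. by case: (red_primitive_root hms v_odd prim_w ow). Qed.

(* Since o ^+ v = -1, a character r |-> o ^+ e is trivial on r ^+ v, which lies in
   Q 3, only when e is even. *)
Definition ts_exponent (i a : nat) : nat := if i == 3%N then (2 * a)%N else a.

Definition ts_linear i a : mx_representation O (H i) 1 :=
  lin_repr (H i) (cycle_char r (o ^+ ts_exponent i a)).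

Definition ts_lattice i a := ind_repr (ts_linear i a) (sHG i).

Definition ts_index i a := (i \in [:: 1; 3]%N) || (a == 0%N).

Lemma ts_indexP i (a : 'I_(dihedral_size v i)) : ts_index i a.
Proof.
rewrite /ts_index; case: i a => [|[|[|[|i]]]] [a lt_a] //=; by move: lt_a;
  rewrite ltnS leqn0.
Qed.

Let o_order a : (o ^+ a) ^+ #[r]%g = 1.
Proof.
rewrite (dihedral_or v_ge3 hG) -exprM [(_ * _)%N](_ : _ = v * (2 * a))%N; last by lia.
by rewrite exprM ov exprM sqrrN !expr1n.
Qed.

Lemma ts_linearE i a x : ts_index i a ->
  ts_linear i a x = (cycle_char r (o ^+ ts_exponent i a) x)%:M.
Proof.
move=> ia; apply: lin_reprE.
  by rewrite -(expg0 r) cycle_charX.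
(* On reflections [discrete_log] has a junk value, which is harmless for a = 0: the base of the
   power is then 1. *)
move=> x1 y1 Hx Hy; move: ia => /orP[i13|/eqP->]; last first.
  by rewrite /ts_exponent if_same !cycle_char1 mulr1.
have sHr : H i \subset <[r]>%g.
  rewrite -[<[r]>%g]/(gval <[r]>%G) -(dihedral_H3 v_ge3 v_odd hG).
  by move: i13; rewrite !inE => /orP[]/eqP->;
    rewrite (dihedral_H_sub_H v_ge3 v_odd hG).
by rewrite cycle_charM ?(subsetP sHr).
Qed.

Lemma ts_linear_Q i a q t : ts_index i a -> (1 <= i <= 5)%N -> q \in Q i -> t \in G ->
  ts_linear i a (q ^ t)%g = 1%:M.
Proof.
move=> ia i15 Qq Gt; rewrite ts_linearE //; case: ia => /orP[i13|/eqP->]; last first.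
  by rewrite /ts_exponent if_same cycle_char1.
move: i13 Qq; rewrite !inE => /orP[]/eqP->.
  by move/set1P->; rewrite conj1g -(expg0 r) cycle_charX.
case/cycleP=> j ->; rewrite conjXg.
have -> : (r ^+ v ^ t = r ^+ v)%g.
  by rewrite conjgE (dihedral_z_comm hG Gt) mulKg.
rewrite -expgM cycle_charX // /ts_exponent /= -exprM [(_ * _)%N](_ : _ =
  v * (2 * (a * j)))%N; last by lia.
by rewrite exprM ov exprM sqrrN !expr1n.
Qed.

Lemma ts_latticeP i a : exists E D, induced_via (ts_linear i a) (ts_lattice i a) E D.
Proof. exact: ind_repr_via. Qed.

Lemma ts_lattice_ker i a q : ts_index i a -> (1 <= i <= 5)%N -> q \in Q i ->
  ts_lattice i a q = 1%:M.
Proof.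
move=> ia i15 Qq; have [E [D iN]] := ts_latticeP i a.
have Gq := subsetP (sQG i) q Qq.
apply: (induced_kernel (sHG i) iN Gq) => t Gt.
split; last exact: ts_linear_Q.
rewrite memJ_norm ?(subsetP (nHG i)) //.
exact: (subsetP (dihedral_QH v r s i)).
Qed.

Lemma ts_lattice_odd_index i : odd #|H i : Q i|%g.
Proof. exact: (odd_index_joinC v_ge3 v_odd hG (sQG i)
  (dihedral_Q_2group v_ge3 hG i)). Qed.

Lemma odd_natr_unit m : odd m -> (m%:R : O) \is a GRing.unit.
Proof.
by move=> odd_m; apply: (ms_unit hms); rewrite rmorph_nat (odd_natr_neq0 hms).
Qed.

Lemma ts_lattice_retract i a : ts_index i a -> (1 <= i <= 5)%N ->
  retract (ts_lattice i a) (ind_repr (triv_repr O (Q i)) (sQG i)).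
Proof.
move=> ia i15; have [E [D iN]] := ts_latticeP i a.
apply: (induced_retract_triv (sQG i) iN (sHG i) (dihedral_QH v r s i)).
  by move=> q Qq; rewrite -[q]conjg1 ts_linear_Q.
exact: odd_natr_unit (ts_lattice_odd_index i).
Qed.

Definition ts_module i a := map_repr red (ts_lattice i a).

Let mu i a := red o ^+ ts_exponent i a.

Lemma ts_moduleP i a : exists E D,
  induced_via (map_repr red (ts_linear i a)) (ts_module i a) E D.
Proof.
have [E [D iN]] := ts_latticeP i a; exists (map_mx red E), (map_mx red D).
exact: induced_via_map.
Qed.

Lemma ts_module_retract i a : ts_index i a -> (1 <= i <= 5)%N ->
  retract (ts_module i a) (ind_repr (triv_repr k (Q i)) (sQG i)).
Proof.
move=> ia i15; have [E [D iN]] := ts_moduleP i a.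
apply: (induced_retract_triv (sQG i) iN (sHG i) (dihedral_QH v r s i)).
  by move=> q Qq; rewrite map_reprE -[q]conjg1 ts_linear_Q // map_mx1.
by rewrite unitfE (odd_natr_neq0 hms) // ts_lattice_odd_index.
Qed.

Lemma ts_module_linear i a u : ts_index i a -> (r ^+ u)%g \in H i ->
  map_repr red (ts_linear i a) (r ^+ u)%g = (mu i a ^+ u)%:M.
Proof.
by move=> ia _; rewrite map_reprE ts_linearE // cycle_charX // map_scalar_mx
  !rmorphXn.
Qed.

Lemma ts_module_linear0 i h : map_repr red (ts_linear i 0) h = 1%:M.
Proof.
rewrite map_reprE ts_linearE ?/ts_index ?orbT //.
by rewrite /ts_exponent if_same cycle_char1 map_scalar_mx rmorph1.
Qed.

Lemma ts_scalar_expv i a : mu i a ^+ v = 1.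
Proof. by rewrite -exprM mulnC exprM (prim_expr_order prim_ro) expr1n. Qed.

Lemma ts_scalar_neq1 i (a : 'I_(dihedral_size v i)) : a != 0%N :> nat -> mu i a != 1.
Proof.
move=> nza; have lt_av : (2 * a < v)%N.
  have := ltn_ord a; have := odd_double_half v; rewrite v_odd.
  by case: i a nza => [|[|[|[|i]]]] a /= nza; lia.
rewrite -(prim_order_dvd prim_ro) /ts_exponent; apply/negP=> /dvdn_leq.
by case: eqP => _; lia.
Qed.

Lemma ts_H_cycle i : i \in [:: 1; 3]%N -> H i \subset <[r]>%g.
Proof.
rewrite -[<[r]>%g]/(gval <[r]>%G) -(dihedral_H3 v_ge3 v_odd hG).
by rewrite !inE => /orP[]/eqP->; rewrite (dihedral_H_sub_H v_ge3 v_odd hG).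
Qed.

Lemma ts_simple_socle i (a : 'I_(dihedral_size v i)) :
  exists S0 x0 d, simple_socle (ts_module i a) S0 x0 d.
Proof.
have [E [D iN]] := ts_moduleP i a.
have [a0|nza] := eqVneq (a : nat) 0%N.
  exists (fun x => {in G, forall g, x *m ts_module i a g = x}),
    (rtrace (H i) (triv_repr k G) (ts_module i a) E), D.
  apply: (permutation_simple_socle char2 hG (sHG i) (dihedral_CH v r s i)
    (nHG i) _ iN).
  by move=> h _; rewrite a0 ts_module_linear0.
have i13 : i \in [:: 1; 3]%N by have := ts_indexP a;
  rewrite /ts_index (negPf nza) orbF.
exists (fun x => x *m ts_module i a r = mu i a *: x),
  (monomial_socle r (H i) (mu i a) (ts_module i a) E), D.
apply: (monomial_simple_socle char2 v_ge3 v_odd hG (ts_H_cycle i13)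
  (dihedral_CH v r s i) _ (ts_scalar_expv i a) iN (ts_scalar_neq1 nza)).
by move=> u Hu; apply: ts_module_linear (ts_indexP a) Hu.
Qed.

Lemma ts_module_indecomposable i (a : 'I_(dihedral_size v i)) : indecomposable
  (ts_module i a).
Proof. by have [S0 [x0 [d soc]]] := ts_simple_socle a;
  apply: socle_indecomposable soc. Qed.

Lemma ts_module_trivial_source i (a : 'I_(dihedral_size v i)) : (1 <= i <= 5)%N ->
  trivial_source 2 (ts_module i a).
Proof.
move=> i15; split; first exact: ts_module_indecomposable.
exists (Q i), (sQG i); split; first exact: dihedral_Q_2group v_ge3 hG i.
by apply: field_direct_summand; apply: ts_module_retract i15; apply: ts_indexP.
Qed.

Lemma ts_lattice_trivial_source i (a : 'I_(dihedral_size v i)) : (1 <= i <= 5)%N ->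
  trivial_source 2 (ts_lattice i a).
Proof.
move=> i15; split; first exact: indecomposable_map (ts_module_indecomposable a).
exists (Q i), (sQG i); split; first exact: dihedral_Q_2group v_ge3 hG i.
apply: (retract_direct_summand (ms_surj hms) (ms_unit hms)).
by apply: ts_lattice_retract i15; apply: ts_indexP.
Qed.

Lemma ts_module_kerQ i a : ts_index i a -> (1 <= i <= 5)%N -> Q i \subset rker
  (ts_module i a).
Proof.
move=> ia i15; apply/subsetP=> q Qq; apply/rkerP; split;
  first exact: (subsetP (sQG i)).
by rewrite map_reprE ts_lattice_ker // map_mx1.
Qed.

Lemma ts_module_dim i (a : 'I_(dihedral_size v i)) :
  (0 < \sum_(j < #|rcosets (H i) G|%g) 1)%N.
Proof. by case: (ts_module_indecomposable a). Qed.

Lemma ts_module_projective i a : ts_index i a -> (1 <= i <= 5)%N ->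
  rel_projective (sQG i) (ts_module i a).
Proof. by move=> ia i15; apply: retract_triv_rel_projective
  (ts_module_retract ia i15). Qed.

(** [Q i] acts trivially, so a subgroup for which the module is relatively projective contains a
    conjugate of [Q i] and cannot be smaller. *)
Lemma ts_module_vertex i (a : 'I_(dihedral_size v i)) : (1 <= i <= 5)%N ->
  is_vertex (Q i) (ts_module i a).
Proof.
move=> i15; split; first by exists (sQG i); apply: ts_module_projective i15;
  apply: ts_indexP.
move=> S sSG prSQ projS.
have kerQ := ts_module_kerQ (ts_indexP a) i15.
have [x Gx sQS] := rel_projective_trivial_action char2 (ts_module_dim a) kerQ
  (dihedral_Q_2group v_ge3 hG i) projS.
by have := subset_leq_card sQS; rewrite cardJg leqNgt proper_card.
Qed.

Let w2v : w ^+ (2 * v) = 1 := prim_expr_order prim_w.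

Let nz_w : w != 0.
Proof.
apply: contra_eq_neq w2v => ->; rewrite expr0n.
have -> : (2 * v == 0)%N = false by lia.
by rewrite eq_sym oner_eq0.
Qed.

Lemma ts_lattice_trace0 i (e : bool) u : (1 <= i <= 5)%N ->
  inj (\tr (ts_lattice i 0 (s ^+ e * r ^+ u)%g))
    = if dihedral_mem i e u then (4 %/ #|Q i|)%N%:R else 0.
Proof.
move=> i15; have [E [D iN]] := ts_latticeP i 0.
have Gx : (s ^+ e * r ^+ u)%g \in G by rewrite groupM // groupX.
rewrite (mxtrace_induced (sHG i) iN Gx).
rewrite (eq_bigr (fun=> (dihedral_mem i e u)%:R)) => [|A].
  rewrite sumr_const -[#|rcosets _ _|%g]/(#|G : H i|%g)
    (dihedral_H_index v_ge3 v_odd hG).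
  by case: ifP => _; rewrite ?mul0rn ?rmorph0 // rmorph_nat.
case/(mem_repr_rcosets (sHG i)) => GA _.
rewrite memJ_norm ?groupV ?(subsetP (nHG i)) // (dihedral_mem_H v_ge3 v_odd hG).
case: ifP => // _; rewrite ts_linearE ?/ts_index ?orbT // /ts_exponent if_same.
by rewrite cycle_char1 mxtrace1.
Qed.

Lemma ts_lattice_trace i a (e : bool) u : i \in [:: 1; 3]%N ->
  inj (\tr (ts_lattice i a (s ^+ e * r ^+ u)%g))
    = if dihedral_mem i e u
      then #|<[r]> : H i|%g%:R * (w ^+ (ts_exponent i a * u) + w ^-
        (ts_exponent i a * u))
      else 0.
Proof.
move=> i13; have [E [D iN]] := ts_latticeP i a.
have Gx : (s ^+ e * r ^+ u)%g \in G by rewrite groupM // groupX.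
rewrite (mxtrace_induced (sHG i) iN Gx).
have memE A : A \in rcosets (H i) G ->
    ((s ^+ e * r ^+ u) ^ (repr A)^-1 \in H i)%g = dihedral_mem i e u.
  case/(mem_repr_rcosets (sHG i)) => GA _.
  by rewrite memJ_norm ?groupV ?(subsetP (nHG i)) // (dihedral_mem_H v_ge3 v_odd hG).
case: ifP => [mem_eu|nmem]; last first.
  by rewrite big1 ?rmorph0 // => A HA; rewrite memE // nmem.
have e0 : e = false by move: i13 mem_eu; rewrite !inE => /orP[]/eqP->; case: (e).
pose z := o ^+ ts_exponent i a.
pose f t := cycle_char r z ((r ^+ u) ^ t^-1)%g.
rewrite (eq_bigr (fun A => f (repr A))) => [|A HA]; last first.
  rewrite memE // mem_eu ts_linearE; last by rewrite /ts_index i13.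
  by rewrite mxtrace_scalar e0 expg0 mul1g.
have sHr := ts_H_cycle i13.
have srG : <[r]>%g \subset G by rewrite cycle_subG.
have nr : G \subset 'N(<[r]>)%g.
  by have := nHG 3; rewrite /H (dihedral_H3 v_ge3 v_odd hG).
have f_inv : coset_invariant G <[r]>%G f.
  move=> h t rh Gt; rewrite /f invMg conjgM; congr (cycle_char r z _).
  have : ((r ^+ u) ^ t^-1)%g \in <[r]>%g.
    by rewrite memJ_norm ?mem_cycle // groupV (subsetP nr).
  case/cycleP=> j ->; case/cycleP: rh => l ->.
  by rewrite conjgE invgK mulgA -expgD addnC expgD mulgK.
(* [f] is constant on the cosets of <[r]>, whence the factor [#|<[r]> : H i|]; the two
   representatives 1 and s give the power of w and its inverse. *)
rewrite (sum_rcosets_index (K := <[r]>%G) sHr srG f_inv).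
have index2 : {in G, forall x, x \notin <[r]>%g -> (x * s^-1)%g \in <[r]>%g}.
  move=> x Gx' nrx; have := dihedral_H_index2 v_ge3 v_odd hG (i := 3) isT.
  rewrite (dihedral_H3 v_ge3 v_odd hG) => /(_ x s Gx' Gs nrx); apply.
  exact: dihedral_s_notin v_ge3 hG.
rewrite (sum_rcosets_index2 srG Gs (dihedral_s_notin v_ge3 hG) index2 f_inv).
rewrite rmorphMn mulr_natl rmorphD; congr ((_ + _) *+ _).
  by rewrite /f invg1 conjg1 cycle_charX ?o_order // rmorphXn /z rmorphXn ow -exprM.
have [j [rj _]] := dihedral_rN v_ge3 hG u.
rewrite /f (dihedral_sV hG) (dihedral_rXs hG) rj cycle_charX ?o_order //.
have : inj (z ^+ j) * w ^+ (ts_exponent i a * u) = 1.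
  rewrite -ow -rmorphXn -rmorphM exprM -exprD -(rmorph1 inj); congr (inj _).
  by rewrite -(cycle_charX _ (o_order _)) expgD -rj mulVg -(expg0 r) cycle_charX
    ?o_order.
move=> zw; have nzw : w ^+ (ts_exponent i a * u) != 0.
  by apply: contra_eq_neq zw => ->; rewrite mulr0 eq_sym oner_eq0.
by apply: (mulIf nzw); rewrite zw mulVf.
Qed.

Lemma dihedral_linear_charE (e : bool) u :
  [/\ chi 1 (s ^+ e * r ^+ u)%g = 1, chi 2 (s ^+ e * r ^+ u)%g = (-1) ^+ u,
      chi 3 (s ^+ e * r ^+ u)%g = (-1) ^+ e
    & chi 4 (s ^+ e * r ^+ u)%g = (-1) ^+ e * (-1) ^+ u].
Proof.
have [chiM [[c1r c1s] [c2r c2s] [c3r c3s] [c4r c4s]] _] := hchi.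
have chiE i : (1 <= i <= 4)%N -> chi i r != 0 ->
    chi i (s ^+ e * r ^+ u)%g = chi i s ^+ e * chi i r ^+ u.
  move=> i14 nzr; have cM := chiM i i14.
  have c1 : chi i 1%g = 1.
    by apply: (mulIf nzr); rewrite -cM ?mul1g ?mul1r.
  have cX g l : g \in G -> chi i (g ^+ l)%g = chi i g ^+ l.
    move=> Gg; elim: l => [|l IHl]; first by rewrite expg0 c1.
    by rewrite expgS cM ?groupX // IHl exprS.
  by rewrite cM ?groupX // !cX.
by split; rewrite chiE ?c1r ?c1s ?c2r ?c2s ?c3r ?c3s ?c4r ?c4s ?oppr_eq0
  ?oner_eq0 // ?expr1n ?mul1r ?mulr1.
Qed.

Definition ts_label (i a : nat) x : K :=
  match i with
  | 1 => if a == 0%N then chi 1%N x + chi 2%N x + chi 3%N x + chi 4%N x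
         else chi (4 + a)%N x + chi (4 + (v - a))%N x
  | 2 => chi 1%N x + chi 4%N x
  | 3 => if a == 0%N then chi 1%N x + chi 3%N x else chi (4 + 2 * a)%N x
  | 4 => chi 1%N x + chi 2%N x
  | _ => chi 1%N x
  end.

Lemma ts_lattice_label i (a : 'I_(dihedral_size v i)) x : (1 <= i <= 5)%N ->
  x \in G -> inj (\tr (ts_lattice i a x)) = ts_label i a x.
Proof.
move=> i15 /(dihedral_elt hG)[e [u ->]].
have [c1 c2 c3 c4] := dihedral_linear_charE e u.
have [q1 q2 q3 q4 q5] := dihedral_Q_card v_ge3 hG.
have [a0|nza] := eqVneq (a : nat) 0%N.
  rewrite a0 ts_lattice_trace0 // /ts_label eqxx c1 c2 c3 c4.
  have [-> ->] : (-1) ^+ e = (if e then -1 else 1) :> K /\ (-1) ^+ u =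
    (if odd u then -1 else 1) :> K.
    by rewrite -(signr_odd _ u); case: (e); case: (odd u).
  case: i a i15 {a0} => [|[|[|[|[|[|i]]]]]] //= _ _; rewrite /Q ?q1 ?q2 ?q3 ?q4 ?q5
    -?[(4 %/ 1)%N]/4%N -?[(4 %/ 2)%N]/2%N -?[(4 %/ 4)%N]/1%N.
  - by case: (e); case: (odd u) => /=; ring.
  - by case: (e); case: (odd u) => /=; ring.
  - by case: (e); case: (odd u) => /=; ring.
  - by case: (e); case: (odd u) => /=; ring.
  by case: (e); case: (odd u) => /=; ring.
have i13 : i \in [:: 1; 3]%N by have := ts_indexP a;
  rewrite /ts_index (negPf nza) orbF.
have lt_2a : (2 * a < v)%N.
  have := ltn_ord a; have := odd_double_half v; rewrite v_odd.
  by case: i a {i15 i13 nza} => [|[|[|[|i]]]] a /=; lia.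
rewrite ts_lattice_trace //; have [_ _ chi5] := hchi.
have chi4E m : (1 <= m <= v.-1)%N -> chi (4 + m)%N (s ^+ e * r ^+ u)%g =
    if e then 0 else w ^+ (m * u) + w ^- (m * u).
  move=> /chi5/(_ u)[rm sm]; case: (e); first by rewrite expg1.
  by rewrite expg0 mul1g rm !exprM exprVn.
have a_gt0 : (0 < a)%N by rewrite lt0n.
move: (nat_of_ord a) nza lt_2a a_gt0 i13 => {}a nza lt_2a a_gt0.
rewrite !inE => /orP[]/eqP ei.
  (* Since w^v = -1, the characters chi_(4+a) and chi_(4+(v-a)) agree on even powers of r and are
     opposite on odd ones, which lie outside [H 1]. *)
  have w_opp l : (l <= v)%N -> w ^+ (v - l) = - w ^- l.
    move=> le_lv; have nzw : w ^+ l != 0 by rewrite expf_neq0 // nz_w.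
    apply: (mulIf nzw); rewrite -exprD subnK // mulNr mulVf //.
    by rewrite -ow -rmorphXn ov rmorphN1.
  have -> : #|<[r]> : H i|%g = 2.
    rewrite -divgS ?ts_H_cycle ?ei // (card_dihedral_H v_ge3 v_odd hG) -/Q q1 mul1n.
    by rewrite -[#|_|]/#[r]%g (dihedral_or v_ge3 hG) mulnK // (leq_trans _ v_ge3).
  rewrite /ts_label ei (negPf nza) /ts_exponent /= !chi4E; try by lia.
  rewrite !exprM w_opp; last by lia.
  rewrite -(exprVn (- _)) invrN invrK -exprVn [(- w ^- a) ^+ u]exprNn [(- w ^+ a)
    ^+ u]exprNn.
  by rewrite -(signr_odd _ u); case: (e); case: (odd u) => /=; ring.
have -> : #|<[r]> : H i|%g = 1%N by rewrite ei /H
  (dihedral_H3 v_ge3 v_odd hG) indexgg.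
rewrite /ts_label ei (negPf nza) /ts_exponent /= chi4E; last by lia.
by case: (e); rewrite /= ?mul1r.
Qed.

Lemma ts_entry i j (a : 'I_(dihedral_size v i)) (b : 'I_(dihedral_size v j)) :
    (1 <= i <= 5)%N -> (1 <= j <= 5)%N ->
  brauer_char inj red (brauer_quotient (sQG j) (ts_module i a))
      (coset (Q j) (dihedral_col r b))
    = if Q j \subset Q i then ts_label i a (r ^+ (2 * b))%g else 0.
Proof.
move=> i15 j15; have [cN [cp _ _]] := dihedral_column_labels v_ge3 v_odd hG j15.
have [Nb _] := cN b; have [Nqb oqb] := cp b.
have ia := ts_indexP a.
case: ifP => [sji | nsji].
  have L1 q : q \in Q j -> ts_lattice i a q = 1%:M.
    by move=> Qq; apply: ts_lattice_ker => //; apply: (subsetP sji).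
  have kerj : Q j \subset rker (ts_module i a).
    by apply: subset_trans sji (ts_module_kerQ ia i15).
  have Hb : dihedral_col r b \in H i.
    by apply: (subsetP (dihedral_CH v r s i)); rewrite /dihedral_col expgM mem_cycle.
  have Gb : dihedral_col r b \in G := subsetP (sHG i) _ Hb.
  have dL := ind_repr_diag (ts_linear i a) (sHG i) (nHG i) Hb.
  have chi_b := char_poly_brauer_quotient char2 (sQG j) kerj
    (dihedral_Q_2group v_ge3 hG j) Nb.
  (* The power of the column element by the order of its image lies in [Q j], which acts
     trivially. *)
  have Lb l : ts_lattice i a (dihedral_col r b) l l ^+ #[coset (Q j)
    (dihedral_col r b)]%g = 1.
    rewrite -(diag_mx_repr_exp l _ Gb dL) -[ind_repr _ _]/(ts_lattice i a) L1
      ?mxE ?eqxx //.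
    have nQb : dihedral_col r b \in 'N(Q j)%g by case/setIP: Nb.
    apply: coset_idr; first by rewrite groupX.
    by rewrite morphX // expg_order.
  rewrite (brauer_char_lift inj chi_b dL Lb); first exact: ts_lattice_label.
  by rewrite (odd_natr_neq0 hms) // odd_2'nat.
move: (nsji); rewrite (dihedral_Q_sub_Q v_ge3 v_odd hG) // => nij.
have [l [l15 l234 il jl]] := separating_index i15 j15 (negbT nij).
have sHl : H i \subset H l by rewrite (dihedral_H_sub_H v_ge3 v_odd hG).
have nQl : ~~ (Q j \subset H l) by rewrite (dihedral_Q_sub_H v_ge3 v_odd hG).
have [E [D iN]] := ts_moduleP i a.
apply: brauer_char_dim0; apply: (brauer_quotient_dim0 (sQG j)).
apply: (induced_rfix_sub_trace_sum (sQG j) iN sHl (sHG l) _ nQl).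
exact: dihedral_H_index2 v_ge3 v_odd hG _ l234.
Qed.

Lemma ts_scalar_sqr_root i : i \in [:: 1; 3]%N ->
  exists2 z, v.-primitive_root z & forall a, mu i a ^+ 2 = z ^+ a.
Proof.
move=> i13; have cop2 : coprime 2 v by rewrite coprime2n.
have prim2 : v.-primitive_root (red o ^+ 2) by rewrite
  (prim_root_exp_coprime _ prim_ro).
have prim4 : v.-primitive_root (red o ^+ 2 ^+ 2) by rewrite
  (prim_root_exp_coprime _ prim2).
move: i13; rewrite !inE => /orP[]/eqP->.
  by exists (red o ^+ 2) => // a; rewrite /mu /ts_exponent /= -!exprM mulnC.
by exists (red o ^+ 2 ^+ 2) => // a; rewrite /mu /ts_exponent /= -!exprM mulnAC.
Qed.

Let nz_mu i a : mu i a != 0.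
Proof.
apply: contra_eq_neq (ts_scalar_expv i a) => ->; rewrite expr0n.
have -> : (v == 0)%N = false by lia.
by rewrite eq_sym oner_eq0.
Qed.

Lemma ts_module_quadratic i a (x : 'rV_(\sum_(j < #|rcosets
  (H i) G|%g) 1)) : i \in [:: 1; 3]%N ->
  x *m ts_module i a (r ^+ 2)%g *m ts_module i a (r ^+ 2)%g + x
    = (mu i a ^+ 2 + mu i a ^- 2) *: (x *m ts_module i a (r ^+ 2)%g).
Proof.
move=> i13; have [E [D iN]] := ts_moduleP i a.
apply: (monomial_quadratic v_ge3 hG (ts_H_cycle i13) (dihedral_CH v r s i) _
  (ts_scalar_expv i a) iN).
by move=> u Hu; apply: ts_module_linear Hu; rewrite /ts_index i13.
Qed.

(** An isomorphism carries [E] to an r^2-eigenvector with eigenvalue [mu i a ^+ 2]; the quadratic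
    relation in the target allows only [mu i b ^+ 2] and its inverse, so a and b agree up to sign
    modulo v. *)
Lemma ts_module_inj i (a b : 'I_(dihedral_size v i)) :
  repr_iso (ts_module i a) (ts_module i b) -> a = b.
Proof.
case=> X [Y [XY YX hX]]; apply/val_inj => /=.
have [i13|ni13] := boolP (i \in [:: 1; 3]%N); last first.
  have := ts_indexP a; have := ts_indexP b.
  by rewrite /ts_index (negPf ni13) /= => /eqP-> /eqP->.
have ei : dihedral_size v i = v./2.+1 by move: i13; rewrite !inE => /orP[]/eqP->.
have lt_half (c : 'I_(dihedral_size v i)) : (c < v./2.+1)%N by rewrite -ei.
apply: (half_eq v_odd (lt_half a) (lt_half b)).
have [z prim_z muE] := ts_scalar_sqr_root i13.
have [E [D iN]] := ts_moduleP i a.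
have Hr2 : (r ^+ 2)%g \in H i by apply: (subsetP (dihedral_CH v r s i));
  rewrite cycle_id.
have Er2 : E *m ts_module i a (r ^+ 2)%g = mu i a ^+ 2 *: E.
  by rewrite (induced_l iN) // ts_module_linear ?mul_scalar_mx // /ts_index i13.
pose y := E *m X; have yr2 : y *m ts_module i b (r ^+ 2)%g = mu i a ^+ 2 *: y.
  by rewrite -mulmxA -hX ?groupX // mulmxA Er2 -scalemxAl.
have nzy : y != 0.
  apply: contra_eq_neq (induced_1 iN) => y0.
  rewrite -[E]mulmx1 -XY mulmxA -/y y0 !mul0mx eq_sym -(scalemx1 1).
  by rewrite scaler_eq0 negb_or oner_eq0 /= matrix_nonzero1.
have := ts_module_quadratic b y i13; rewrite yr2 -scalemxAl yr2 !scalerA.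
rewrite -{2}[y]scale1r -scalerDl => /eqP;
  rewrite -subr_eq0 -scalerBl scaler_eq0 (negPf nzy) orbF.
have nzb : mu i b ^+ 2 != 0 by rewrite expf_neq0.
have -> : mu i a ^+ 2 * mu i a ^+ 2 + 1 - (mu i b ^+ 2 + mu i b ^- 2) * mu i a ^+ 2
    = (mu i a ^+ 2 - mu i b ^+ 2) * (mu i a ^+ 2 - mu i b ^- 2).
  rewrite -[1 in LHS](mulfV nzb); ring.
rewrite mulf_eq0 !subr_eq0 => /orP[]; rewrite /eq_sign_mod !muE.
  by rewrite (eq_prim_root_expr prim_z) => ->.
move=> /eqP ab; rewrite (prim_order_dvd prim_z) exprD ab mulVf ?eqxx ?orbT //.
by rewrite -muE.
Qed.

(** * Classification of the trivial source modules *)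

Section Classification.

Variables (n : nat) (rM : mx_representation k G n).
Hypothesis indM : indecomposable rM.

Lemma ts_module_eigenvector i (a : 'I_(dihedral_size v i)) (u : 'rV_n) :
    a != 0%N :> nat -> u != 0 -> u *m rM (r ^+ 2)%g = mu i a ^+ 2 *: u ->
    (if i == 3 then
       forall y : 'rV_n, y *m rM (r ^+ 2)%g = mu i a ^+ 2 *: y -> y *m rM r =
         mu i a *: y
     else u *m rM r != mu i a *: u) ->
  repr_iso rM (ts_module i a).
Proof.
move=> nza nzu ur2 hu; have [E [D iN]] := ts_moduleP i a.
have i13 : i \in [:: 1; 3]%N by have := ts_indexP a;
  rewrite /ts_index (negPf nza) orbF.
have memr l : (r ^+ l \in H i)%g = (i == 3%N) || ~~ odd l.
  have := dihedral_mem_H v_ge3 v_odd hG i false l; rewrite mul1g => ->.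
  by move: i13; rewrite !inE => /orP[]/eqP->.
apply: repr_iso_sym; apply: (retract_indecomposable (ts_module_dim a) indM).
apply: (monomial_retract char2 v_ge3 v_odd hG (ts_H_cycle i13)
  (dihedral_CH v r s i) _ (ts_scalar_expv i a) iN (ts_scalar_neq1 nza) _ nzu ur2).
- by move=> l Hl; apply: ts_module_linear Hl; apply: ts_indexP.
- by move=> l; rewrite -{2}[r]expg1 !memr orbF => /orP[]; [left | right].
by have := memr 1%N; rewrite expg1 orbF => ->.
Qed.

Lemma ts_module_principal (P : {group gT}) (sPG : P \subset G) : (2%N.-group P)%g ->
    retract rM (ind_repr (triv_repr k P) sPG) -> rM (r ^+ 2)%g = 1%:M ->
  exists i (a : 'I_(dihedral_size v i)),
    (1 <= i <= 5)%N /\ repr_iso rM (ts_module i a).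
Proof.
move=> pP retM r21; have [i i15 eH] := dihedral_2subgroup_join v_ge3 v_odd hG sPG pP.
have size_gt0 : (0 < dihedral_size v i)%N by case: i i15 {eH} => [|[|[|[|i]]]].
exists i, (Ordinal size_gt0); split=> //.
apply: (retract_indecomposable (proj1 indM) (ts_module_indecomposable _)) => /=.
have [E' [D' iP]] := ind_repr_via (triv_repr k P) sPG.
have [U [V [hU hV UV]]] := induced_retract sPG iP retM.
have [E [D iN]] := ts_moduleP i 0.
have C1 c : c \in C -> rM c = 1%:M.
  case/cycleP=> l ->; elim: l => [|l IHl]; first by rewrite repr_mx1.
  by rewrite expgS repr_mxM ?groupX // IHl r21 mulmx1.
(* C acts trivially, so H i acts through P; maps that P fixes are fixed by H i too. *)
have memH h : h \in H i -> exists2 q, q \in P & rM h = rM q.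
  rewrite -[_ \in _]/(h \in gval (H i)) /H -eH /= norm_joinEl; last first.
    exact: subset_trans sPG (dihedral_C_norm hG).
  case/mulsgP=> q c Pq Cc ->; exists q => //.
  have Gq := subsetP sPG q Pq; have Gc := subsetP (dihedral_C_sub hG) c Cc.
  by rewrite repr_mxM // (C1 c) // mulmx1.
have hU' : {in H i, forall h, U *m rM h = U}.
  by move=> h /memH[q Pq ->]; rewrite hU // mul1mx.
have hV' : {in H i, forall h, rM h *m V = V}.
  by move=> h /memH[q Pq ->]; rewrite hV //; apply: mulmx1.
apply: (retract_induced (sHG i) iN (U := U) (V := V)).
- by move=> h Hh; rewrite ts_module_linear0 mul1mx hU'.
- by move=> h Hh; rewrite ts_module_linear0 mulmx1 hV'.
have hVU : intertwines (H i) rM rM (V *m U).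
  by move=> h Hh; rewrite mulmxA hV' // -mulmxA hU'.
have sPH : P \subset H i by rewrite /H -eH joing_subl.
move: UV; rewrite (rtrace_index sPH (sHG i) hVU).
have odd_i : odd #|H i : P|%g by rewrite /H -eH;
  apply: (odd_index_joinC v_ge3 v_odd hG sPG pP).
suff -> : #|H i : P|%g%:R = 1 :> k by rewrite scale1r.
by rewrite -[#|_ : _|%g]odd_double_half odd_i mulrS -muln2 natrM
  (pcharf0 char2) mulr0 addr0.
Qed.

Lemma ts_module_nonprincipal : rM (r ^+ 2)%g != 1%:M ->
  exists i (a : 'I_(dihedral_size v i)),
    (1 <= i <= 5)%N /\ repr_iso rM (ts_module i a).
Proof.
move=> nr21; set T := rM (r ^+ 2)%g in nr21.
have [n_gt0 _] := indM.
have cop2 : coprime 2 v by rewrite coprime2n.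
have prim2 : v.-primitive_root (red o ^+ 2) by rewrite
  (prim_root_exp_coprime _ prim_ro).
have [j [u [j_lt nzu uT]]] : exists j (u : 'rV_n), [/\ (0 < j < v)%N,
  u != 0 & u *m T = red o ^+ 2 ^+ j *: u].
  rewrite {}/T in nr21 *; move: rM nr21 n_gt0; case: (n) => // n' rM' nr21 _.
  apply: root_unity_eigenvector => //.
  have rX l : rM' (r ^+ 2)%g ^+ l = rM' (r ^+ 2 ^+ l)%g.
    elim: l => [|l IHl]; first by rewrite expg0 repr_mx1 expr0.
    by rewrite exprS IHl (expgS (r ^+ 2)%g) [RHS]repr_mxM ?groupX.
  by rewrite rX -expgM (dihedral_r2v hG) repr_mx1.
have ro_v := prim_expr_order prim_ro.
have nz_ro : red o != 0 by have := nz_mu 1 1; rewrite /mu /ts_exponent /= expr1.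
(* [mu 3 b ^+ 2] is the 4b-th power of [red o] and the eigenvalue found is the 2j-th, so b has to be
   j/2 modulo v. A wrong sign is repaired by s, which inverts the eigenvalue. *)
have [b lt_b jb] := half_ex v_odd (j * v.+1./2).
have j4 : red o ^+ (4 * (j * v.+1./2)) = red o ^+ (2 * j).
  by rewrite four_half // exprD (exprM _ v) ro_v expr1n mulr1.
have [y nzy yT] : exists2 y : 'rV_n, y != 0 & y *m T = mu 3 b ^+ 2 *: y.
  have muE : mu 3 b ^+ 2 = red o ^+
    (4 * b) by rewrite /mu /ts_exponent /= -exprM mulnAC.
  case/orP: jb => [jb|jb].
    exists u => //; rewrite uT muE -exprM -j4; congr (_ *: _); apply/eqP.
    by rewrite (eq_prim_root_expr prim_ro) -modnMmr (eqP jb) modnMmr.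
  exists (u *m rM s); first by rewrite mulmx_repr_eq0.
  rewrite /T (dihedral_repr_sX hG) (eigenvector_reprV _ _ uT) ?groupX ?expf_neq0 //.
  rewrite -scalemxAl muE; congr (_ *: _); apply: (mulIf (x := red o ^+ 2 ^+ j));
    first by rewrite -exprM expf_neq0.
  rewrite mulVf; last by rewrite -exprM expf_neq0.
  rewrite -exprM -j4 -exprD -mulnDr addnC; apply/esym/eqP.
  by rewrite -(prim_order_dvd prim_ro) dvdn_mull.
have nzb : b != 0%N.
  apply: contraTneq jb => ->; rewrite /eq_sign_mod mod0n addn0 orbb.
  rewrite -[(_ == _)]/(v %| j * v.+1./2)%N; apply/negP=> dv.
  have : red o ^+ (2 * j) = 1.
    by have /dvdnP[q eq_q] := dv; rewrite -j4 eq_q mulnA mulnC exprM ro_v expr1n.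
  by move/eqP; rewrite -(prim_order_dvd prim_ro) ndvdn_double.
(* Here the vertex is decided: Q 3 if r is a scalar on the eigenspace of r^2, and Q 1 otherwise. *)
have [allr|/row_subPn[l]] := boolP (eigenspace T (mu 3 b ^+ 2) <= eigenspace
  (rM r) (mu 3 b))%MS.
  exists 3%N, (Ordinal lt_b : 'I_(dihedral_size v 3)); split=> //.
  apply: (@ts_module_eigenvector 3 (Ordinal lt_b) y) => //= x xT.
  by apply/eigenspaceP/(submx_trans _ allr)/eigenspaceP.
have /eigenspaceP := row_sub l (eigenspace T (mu 3 b ^+ 2)).
set x := row l _ => xT nxr.
have {}nxr : x *m rM r != mu 3 b *: x.
  by apply: contraNneq nxr => xr; apply/eigenspaceP.
have nzx : x != 0 by apply: contraNneq nxr => ->; rewrite mul0mx scaler0.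
(* The exponent 2b used for Q 3 is renamed to a in the half range, up to sign; for the sign -1 the
   vector x is replaced by x s. *)
have [a lt_a ba] := half_ex v_odd (2 * b).
have nza : a != 0%N.
  apply: contraTneq ba => ->; rewrite /eq_sign_mod mod0n addn0 orbb.
  rewrite -[(_ == _)]/(v %| 2 * b)%N ndvdn_double // lt0n nzb.
  by rewrite (leq_trans lt_b) // half_lt.
exists 1%N, (Ordinal lt_a : 'I_(dihedral_size v 1)); split=> //.
have mu1 : mu 1 a = red o ^+ a by [].
have mu3 : mu 3 b = red o ^+ (2 * b) by [].
case/orP: ba => [/eqP ba|ba].
  have e13 : mu 1 a = mu 3 b.
    by rewrite mu1 mu3; apply/esym/eqP; rewrite (eq_prim_root_expr prim_ro) ba.
  by apply: (@ts_module_eigenvector 1 (Ordinal lt_a) x) => //=; rewrite e13.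
have e13 : mu 3 b * mu 1 a = 1.
  by apply/eqP; rewrite mu1 mu3 -exprD -(prim_order_dvd prim_ro).
have e1 : mu 1 a = (mu 3 b)^-1 by apply: (mulfI (nz_mu 3 b)); rewrite e13 mulfV.
apply: (@ts_module_eigenvector 1 (Ordinal lt_a) (x *m rM s)) => //=.
- by rewrite mulmx_repr_eq0.
- rewrite (dihedral_repr_sX hG) (eigenvector_reprV _ _ xT) ?groupX ?expf_neq0 //.
  by rewrite -scalemxAl e1 exprVn.
apply: contra_neq nxr; rewrite (dihedral_repr_s hG rM x).1 scalemxAl e1 => xr.
have {}xr : x *m rM r^-1%g = (mu 3 b)^-1 *: x.
  apply/eqP; rewrite -subr_eq0 -(mulmx_repr_eq0 rM _ Gs) mulmxBl xr subrr //.
by have := eigenvector_reprV (rN := rM) (g := r^-1%g) _ _ xr;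
  rewrite invgK invrK; apply; rewrite ?groupV ?invr_neq0.
Qed.

Lemma ts_module_classification : trivial_source 2 rM ->
  exists i (a : 'I_(dihedral_size v i)),
    (1 <= i <= 5)%N /\ repr_iso rM (ts_module i a).
Proof.
case=> _ [P [sPG [pP sumM]]].
have [r21|nr21] := eqVneq (rM (r ^+ 2)%g) 1%:M; last exact: ts_module_nonprincipal.
exact: (ts_module_principal pP (direct_summand_retract sumM) r21).
Qed.

End Classification.

Lemma ts_module_reps i : (1 <= i <= 5)%N ->
  TS_reps 2 (Q i) (fun a : 'I_(dihedral_size v i) => Representation (ts_module i a)).
Proof.
move=> i15; split=> [a|a b|n rM tsM [[sQ projM] minM]].
- by split; [apply: ts_module_trivial_source | apply: ts_module_vertex].
- exact: ts_module_inj.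
have [indM _] := tsM; have [j [a [j15 isoM]]] := ts_module_classification indM tsM.
have [ij|nij] := eqVneq i j.
  by case: j / ij in a j15 isoM *; exists a.
(* If a module with vertex [Q i] were in the list for another index j, then [Q j] would be properly
   contained in [Q i], and projectivity relative to [Q j] would contradict the minimality of the
   vertex. *)
have projj : rel_projective (sQG i) (ts_module j a).
  rewrite (bool_irrelevance (sQG i) sQ).
  exact: rel_projective_retract (repr_iso_retract (repr_iso_sym isoM)) projM.
have kerQ := ts_module_kerQ (ts_indexP a) j15.
have [x Gx sQjx] := rel_projective_trivial_action char2 (ts_module_dim a) kerQ
  (dihedral_Q_2group v_ge3 hG j) projj.
have sQjH : Q j \subset H i.
  rewrite -(conjSg _ _ x) (normP (subsetP (nHG i) x Gx)).
  exact: subset_trans sQjx (dihedral_QH v r s i).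
have sji : Q j \subset Q i.
  by move: sQjH; rewrite (dihedral_Q_sub_H v_ge3 v_odd hG) //
    (dihedral_Q_sub_Q v_ge3 v_odd hG).
have prji : Q j \proper Q i.
  rewrite properE sji; move: sji.
  rewrite !(dihedral_Q_sub_Q v_ge3 v_odd hG) // (negPf nij) (eq_sym j i)
    (negPf nij) !orbF.
  by move: nij; case: (j) => [|[|[|[|[|[|l]]]]]]; case: (i) => [|[|[|[|[|[|l']]]]]].
case: (minM (Q j) (sQG j) prji).
apply: rel_projective_retract (repr_iso_retract isoM) _.
exact: ts_module_projective (ts_indexP a) j15.
Qed.

Lemma ts_label_classfun i (a : 'I_(dihedral_size v i)) : (1 <= i <= 5)%N ->
  lift_character 2 inj red (Representation (ts_module i a)) (ts_label i a).
Proof.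
move=> i15; apply: (lift_character_map hms (ts_lattice_trivial_source a i15)) => x Gx.
exact: ts_lattice_label.
Qed.

(** At an even power of r the sign w^v = -1 is squared away, so chi_(4+a) and chi_(4+(v-a)) agree
    there; this is the factor 2 in the first block row. *)
Lemma ts_label_r2 i a u : ts_index i a -> (2 * a < v)%N ->
  ts_label i a (r ^+ (2 * u))%g =
    match i with
    | 1 => if a == 0%N then 4%:R else 2%:R * ((w ^+ a) ^+ (2 * u) + (w ^- a) ^+
      (2 * u))
    | 3 => if a == 0%N then 2%:R else (w ^+ (2 * a)) ^+ (2 * u) + (w ^-
      (2 * a)) ^+ (2 * u)
    | 2 | 4 => 2%:R
    | _ => 1
    end.
Proof.
move=> ia lt_av; have := dihedral_linear_charE false (2 * u);
  rewrite mul1g => -[c1 c2 c3 c4].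
have {}c2 : chi 2 (r ^+ (2 * u))%g = 1 by rewrite c2 exprM sqrrN !expr1n.
have {}c4 : chi 4 (r ^+ (2 * u))%g = 1 by rewrite c4 mul1r exprM sqrrN !expr1n.
have [_ _ chi5] := hchi.
have chiE m : (1 <= m <= v.-1)%N -> chi (4 + m)%N (r ^+ (2 * u))%g =
    (w ^+ m) ^+ (2 * u) + (w ^- m) ^+ (2 * u).
  by case/chi5/(_ (2 * u)%N).
rewrite /ts_label c1 c2 c3 c4; have [a0|nza] := eqVneq a 0%N.
  by case: i {ia} => [|[|[|[|[|i]]]]] //=; rewrite ?a0 /=; ring.
case: i ia => [|[|[|[|[|i]]]]]; rewrite /ts_index ?(negPf nza) //= => _; last first.
  by rewrite chiE //; lia.
rewrite !chiE; try lia.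
have le_av : (a <= v)%N by lia.
have wv : w ^+ v ^+ (2 * u) = 1.
  by rewrite -exprM mulnA (mulnC v) exprM w2v expr1n.
have nzwa : w ^+ a != 0 by rewrite expf_neq0.
have wva : w ^+ (v - a) ^+ (2 * u) = w ^- a ^+ (2 * u).
  have -> : w ^+ (v - a) = w ^+ v * w ^- a.
    by apply: (mulIf nzwa); rewrite mulfVK // -exprD subnK.
  by rewrite exprMn wv mul1r.
rewrite [w ^- (v - a) ^+ _]exprVn wva -exprVn invrK.
ring.
Qed.

End DihedralTable.

(** * The row permutation and the assembled table *)

(** 2 is invertible modulo v, so doubling permutes the residues up to sign. The default of [odflt]
    is never taken, by [half_ex]. *)
Lemma half_double_perm v : odd v ->
  exists sigma : {perm 'I_(v./2.+1)}, forall a : 'I_(v./2.+1),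
    eq_sign_mod v (2 * a) (sigma a).
Proof.
move=> v_odd; pose f (a : 'I_(v./2.+1)) := odflt a [pick b : 'I_(v./2.+1) |
  eq_sign_mod v (2 * a) b].
have fP (a : 'I_(v./2.+1)) : eq_sign_mod v (2 * a) (f a).
  rewrite /f; case: pickP => // nb; have [b lt_b ab] := half_ex v_odd (2 * a).
  by have := nb (Ordinal lt_b); rewrite /= ab.
have f_inj : injective f.
  move=> a b fab; apply/val_inj/(half_eq v_odd (ltn_ord a) (ltn_ord b)).
  have fPa := fP a; rewrite fab in fPa.
  exact: eq_sign_mod_trans (eq_sign_mod_half v_odd fPa) (eq_sign_mod_half v_odd
    (fP b)).
by exists (perm f_inj) => a; rewrite permE.
Qed.

(** Only powers of w^2 occur, so exponents matter modulo v; and the sum is invariant under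
    inversion. *)
Lemma eq_sign_mod_expr (K : fieldType) v (w : K) a b u : w ^+ (2 * v) = 1 -> w != 0 ->
    eq_sign_mod v a b ->
  (w ^+ a) ^+ (2 * u) + (w ^- a) ^+ (2 * u) =
    (w ^+ b) ^+ (2 * u) + (w ^- b) ^+ (2 * u).
Proof.
move=> w2v nzw ab; have zv : w ^+ 2 ^+ v = 1 by rewrite -exprM.
have E c : (w ^+ c) ^+ (2 * u) = w ^+ 2 ^+ c ^+ u.
  by rewrite -!exprM mulnCA mulnA.
rewrite !exprVn !E; case/orP: ab => [/eqP ab|/dvdnP[q eq_ab]].
  by rewrite -(expr_mod a zv) ab expr_mod.
have abV : w ^+ 2 ^+ a = (w ^+ 2 ^+ b)^-1.
  have nzb : w ^+ 2 ^+ b != 0 by rewrite !expf_neq0.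
  by apply: (mulIf nzb); rewrite mulVf // -exprD eq_ab mulnC exprM zv expr1n.
by rewrite abV exprVn invrK addrC.
Qed.

Theorem theorem5p7
    (O : idomainType) (K : fieldType) (k : closedFieldType)
    (inj : {rmorphism O -> K}) (red : {rmorphism O -> k})
    (hms : modular_system 2 inj red)
    (v : nat) (hv : (3 <= v)%N) (hodd : odd v)
    (gT : finGroupType) (G : {group gT}) (r s : gT)
    (hG : dihedral_presented v G r s)
    (hK : large_enough K G)
    (w : K) (hw : (2 * v).-primitive_root w)
    (chi : nat -> gT -> K) (hchi : dihedral_characters v G r s w chi) :
  let Q := dihedral_Q v r s in
  let col := @dihedral_col v gT r in
  let e m u : K := (w ^+ m) ^+ u + (w ^- m) ^+ u in
  p_subgroup_reps 2 G [seq Q i | i <- [:: 1; 2; 3; 4; 5]%N] /\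
  (forall j, (1 <= j <= 5)%N -> column_labels 2 G (Q j) (@col j)) /\
  exists M : forall i, 'I_(dihedral_size v i) -> representation k G,
  let T i j : 'M[K]_(dihedral_size v i, dihedral_size v j) :=
    ts_block inj red (@M i) (dihedral_Q_sub hG j) (@col j) in
  let label i a (psi : gT -> K) := lift_character 2 inj red (M i a) psi in
  (forall i, (1 <= i <= 5)%N -> TS_reps 2 (Q i) (@M i)) /\
  [/\ [/\ forall a : 'I_(dihedral_size v 1), label 1%N a (fun x =>
            if a == 0%N :> nat then chi 1%N x + chi 2%N x + chi 3%N x + chi 4%N x
            else chi (4 + a)%N x + chi (4 + (v - a))%N x),
          T 1%N 1%N = \matrix_(a, b)
            (if a == 0%N :> nat then 4%:R else 2%:R * e a (2 * b)%N)
        & forall j, j \in [:: 2; 3; 4; 5]%N -> T 1%N j = 0],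
      [/\ forall a : 'I_(dihedral_size v 2), label 2%N a (fun x =>
        chi 1%N x + chi 4%N x),
          T 2%N 1%N = const_mx 2%:R,
          T 2%N 2%N = const_mx 2%:R
        & forall j, j \in [:: 3; 4; 5]%N -> T 2%N j = 0],
      [/\ forall a : 'I_(dihedral_size v 3), label 3%N a (fun x =>
            if a == 0%N :> nat then chi 1%N x + chi 3%N x
            else chi (4 + 2 * a)%N x),
          T 3%N 1%N = \matrix_(a, b)
            (if a == 0%N :> nat then 2%:R else e (2 * a)%N (2 * b)%N),
          T 3%N 3%N = \matrix_(a, b)
            (if a == 0%N :> nat then 2%:R else e (2 * a)%N (2 * b)%N)
        & forall j, j \in [:: 2; 4; 5]%N -> T 3%N j = 0],
      [/\ forall a : 'I_(dihedral_size v 4), label 4%N a (fun x =>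
        chi 1%N x + chi 2%N x),
          T 4%N 1%N = const_mx 2%:R,
          T 4%N 4%N = const_mx 2%:R
        & forall j, j \in [:: 2; 3; 5]%N -> T 4%N j = 0]
    & (forall a : 'I_(dihedral_size v 5), label 5%N a (chi 1%N)) /\
      (forall j, (1 <= j <= 5)%N -> T 5%N j = const_mx 1)] /\
  T 3%N 3%N = T 3%N 1%N /\
  exists sigma : {perm 'I_(dihedral_size v 1)},
    T 3%N 1%N = 2%:R^-1 *: row_perm sigma (T 1%N 1%N).
Proof.
have [o ow] : exists o, inj o = w.
  apply: (unity_root_integral hms (n := 2 * v)); last exact: prim_expr_order hw.
  by rewrite muln_gt0 (leq_trans _ hv).
move=> Q col e; split; first exact: dihedral_p_subgroup_reps.
split; first by move=> j; apply: dihedral_column_labels.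
exists (fun i a => Representation (ts_module red hG o i a)) => T label.
have w2v := prim_expr_order hw.
have nzw : w != 0.
  apply: contra_eq_neq w2v => ->; rewrite expr0n muln_eq0 /=.
  by rewrite (gtn_eqF (leq_trans _ hv)) // eq_sym oner_eq0.
have e0 u : e 0%N u = 2%:R by rewrite /e expr0 invr1 !expr1n.
have subQ i j : (1 <= i <= 5)%N -> (1 <= j <= 5)%N ->
    (Q j \subset Q i) = [|| j == 1, i == 5 | i == j]%N.
  by move=> i15 j15; apply: (dihedral_Q_sub_Q hv hodd hG).
have entry i j a b (i15 : (1 <= i <= 5)%N) (j15 : (1 <= j <= 5)%N) :
    T i j a b = if [|| j == 1, i == 5 | i == j]%N
                then ts_label v chi i a (r ^+ (2 * b))%g else 0.
  by rewrite mxE (ts_entry hms hv hodd hG hw ow hchi) // subQ.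
have T0 i j (i15 : (1 <= i <= 5)%N) (j15 : (1 <= j <= 5)%N) :
    ~~ [|| j == 1, i == 5 | i == j]%N -> T i j = 0.
  by move=> /negPf nij; apply/matrixP=> a b; rewrite entry // nij mxE.
have small i (a : 'I_(dihedral_size v i)) : (2 * a < v)%N.
  have lt_a : (a <= v./2)%N.
    by case: i a => [|[|[|[|i]]]] [a lt_a] //=; rewrite ltnS in lt_a;
      rewrite ?(leq_trans lt_a).
  rewrite (leq_ltn_trans (n := v./2.*2)) //; first by rewrite mul2n leq_double.
  by rewrite -{2}(odd_double_half v) hodd.
have labelE i (a : 'I_(dihedral_size v i)) u := ts_label_r2 hms hv hodd hG hw ow
  hchi u (ts_indexP a) (small i a).
have lab i a : (1 <= i <= 5)%N -> label i a (ts_label v chi i a).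
  exact: (ts_label_classfun hms hv hodd hG hw ow hchi).
have T11 : T 1%N 1%N = \matrix_(a,
  b) (if a == 0%N :> nat then 4%:R else 2%:R * e a (2 * b)%N).
  by apply/matrixP=> a b; rewrite entry // labelE mxE.
have T31 : T 3%N 1%N = \matrix_(a,
  b) (if a == 0%N :> nat then 2%:R else e (2 * a)%N (2 * b)%N).
  by apply/matrixP=> a b; rewrite entry // labelE mxE.
have T33 : T 3%N 3%N = \matrix_(a,
  b) (if a == 0%N :> nat then 2%:R else e (2 * a)%N (2 * b)%N).
  by apply/matrixP=> a b; rewrite entry // labelE mxE.
split; first by move=> i; apply: (ts_module_reps hms hv hodd hG hw ow).
split.
  split; split=> //.
  - by move=> a; apply: lab.
  - by move=> j; rewrite !inE => /or4P[]/eqP->; apply: T0.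
  - by move=> a; apply: lab.
  - by apply/matrixP=> a b; rewrite entry // labelE mxE.
  - by apply/matrixP=> a b; rewrite entry // labelE mxE.
  - by move=> j; rewrite !inE => /or3P[]/eqP->; apply: T0.
  - by move=> a; apply: lab.
  - by move=> j; rewrite !inE => /or3P[]/eqP->; apply: T0.
  - by move=> a; apply: lab.
  - by apply/matrixP=> a b; rewrite entry // labelE mxE.
  - by apply/matrixP=> a b; rewrite entry // labelE mxE.
  - by move=> j; rewrite !inE => /or3P[]/eqP->; apply: T0.
  - by move=> a; apply: lab.
  by move=> j j15; apply/matrixP=> a b; rewrite entry // orbT labelE mxE.
split; first by rewrite T33 T31.
have [sigma sigmaP] := half_double_perm hodd.
exists sigma; rewrite T31 T11; apply/matrixP=> a b; rewrite !mxE.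
have nz2 : 2%:R != 0 :> K by have /pcharf0P-> := ms_char0 hms.
(* Row 0 obeys the general formula because e 0 = 2, so [sigma] needs no special treatment of 0. *)
have -> : (if a == 0%N :> nat then 2%:R else e (2 * a)%N (2 * b)%N) =
  e (2 * a)%N (2 * b)%N.
  by case: eqP => // ->; rewrite muln0 e0.
have -> : (if sigma a == 0%N :> nat then 4%:R else 2%:R * e (sigma a) (2 * b)%N)
    = 2%:R * e (sigma a) (2 * b)%N.
  by case: eqP => // ->; rewrite e0 -natrM.
by rewrite mulKf //; exact: (eq_sign_mod_expr b w2v nzw (sigmaP a)).
Qed.
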